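(* Let $D\subset\mathbb{R}^2$ be an elliptic domain (the bounded open region enclosed by an ellipse $\partial D$) with different semi-axes, and consider the dynamics of a Keplerian billiard in $D$, either reflective or refractive. Then there exists a subset $\widetilde D\subset D$ such that: (1) for any $P\in\widetilde D$, if the Keplerian mass is located at $P$, then the dynamics is chaotic for large enough inner energies, i.e. there is $h^*>0$ such that for every inner energy $h_I>h^*$ the dynamics admits a topologically chaotic subsystem; (2) $D\setminus\widetilde D$ has zero (Lebesgue) measure, and the foci of $\partial D$ belong to $D\setminus\widetilde D$.
   Context: Let $\mu>0$ and, in the refractive case, $\omega,h_E>0$ be fixed parameters. When the Keplerian mass is located at $P\in D$, translate coordinates so that $P$ becomes the origin; all the potentials below are centred at the origin (i.e. at $P$). Inner potential: $V_I(z)=h_I+\frac{\mu}{|z|}$ for $z$ in the domain, where $h_I>0$ is the inner energy. Inside the domain the particle moves according to $z''=\nabla V_I(z)$ with energy relation $\frac12|z'|^2-V_I(z)=0$ (arcs of Keplerian hyperbolae); collisions with the origin are regularised by the Levi-Civita regularisation, so that a particle moving radially into the mass is reflected back along the same half-line. Reflective Keplerian billiard: when an inner arc hits $\partial D$ it is reflected elastically (the tangent component of the velocity is kept, the normal one changes sign). Parameterising $\partial D$ by a regular closed curve $\gamma:[0,2\pi)\to\mathbb{R}^2$, initial conditions of inner arcs at the given energy are described by $(\xi,\alpha)\in[0,2\pi)\times(-\frac{\pi}{2},\frac{\pi}{2})$, where $p=\gamma(\xi)$ is the starting point and $\alpha$ is the angle from the inward normal at $p$ to the initial velocity. The first return map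 $F:(\xi_0,\alpha_0)\mapsto(\xi_1,\alpha_1)$ sends the initial conditions of an inner arc to those of the next inner arc, obtained after the reflection. It is defined whenever the arc does not meet $\partial D$ tangentially. Refractive Keplerian billiard: outside the domain the particle is subject to $V_E(z)=h_E-\frac{\omega^2}{2}|z|^2$, that is $z''=\nabla V_E(z)$ with $\frac12|z'|^2-V_E(z)=0$ (arcs of harmonic ellipses); it is assumed that $V_E>0$ on $\partial D$ for every position $P\in D$ of the mass. At each crossing of $\partial D$ at a point $z$ (in either direction) the velocity is refracted by Snell's law $\sqrt{V_I(z)}\sin\alpha_I=\sqrt{V_E(z)}\sin\alpha_E$, where $\alpha_E$ and $\alpha_I$ are the angles of the outer and inner arc, respectively, with the normal to $\partial D$ at $z$. The first return map $G:(\xi_0,\alpha_0)\mapsto(\xi_1,\alpha_1)$, with $\alpha$ now the angle of the velocity with the outward normal, sends the initial conditions of an outer arc to those of the next outer arc, after following the outer arc, the refraction inwards, the subsequent inner arc, and the refraction outwards. It is defined whenever these arcs and refractions exist (in particular, whenever the last Snell equation is solvable for $\alpha_E$). Admitting a topologically chaotic subsystem means that there is an invariant set of initial conditions on which the first return map ($F$ in the reflective case, $G$ in the refractive case) and all its iterates are defined, and on which the map is topologically conjugate to the Bernoulli shift on bi-infinite sequences over a finite alphabet with at least two symbols. *)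

(* Defs.v *)
From HB Require Import structures.
From mathcomp Require Import all_boot all_order all_algebra.
From mathcomp Require Import all_classical all_reals all_analysis.

Set Implicit Arguments.
Unset Strict Implicit.
Unset Printing Implicit Defensive.

Import Order.TTheory GRing.Theory Num.Theory.
Import numFieldNormedType.Exports.

Local Open Scope classical_set_scope.
Local Open Scope ring_scope.

Section Plane.
Context {R : realType}.
Implicit Types (p q z n : R * R) (V : R * R -> R) (alpha : R).

Definition dot p q : R := p.1 * q.1 + p.2 * q.2.

(* The library norm on R * R is the sup norm, hence this Euclidean one. *)
Definition enorm p : R := Num.sqrt (dot p p).

(* Angles are oriented counterclockwise. *)
Definition rot alpha p : R * R :=
  (cos alpha * p.1 - sin alpha * p.2, sin alpha * p.1 + cos alpha * p.2).

Definition grad V z : R * R := ('D_(1, 0) V z, 'D_(0, 1) V z).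

(* The velocity at p which has energy |v|^2/2 - V p = 0 and forms the angle
   alpha with the unit vector n. *)
Definition launch V p n alpha : R * R := Num.sqrt (2 * V p) *: rot alpha n.

Definition reflect n v : R * R := v - (2 * dot v n) *: n.

End Plane.

Section Ellipse.
Context {R : realType}.

Record ellipse := Ellipse {
  centre : R * R;
  tilt : R; (* angle from the first coordinate axis to the major axis *)
  semi_major : R;
  semi_minor : R }.

Variable E : ellipse.

Definition major_dir : R * R := rot (tilt E) (1, 0).
Definition minor_dir : R * R := rot (tilt E) (0, 1).

Definition ellipse_form (z : R * R) : R :=
  (dot (z - centre E) major_dir / semi_major E) ^+ 2 +
  (dot (z - centre E) minor_dir / semi_minor E) ^+ 2.

Definition elliptic_domain : set (R * R) := [set z | ellipse_form z < 1].
Definition elliptic_boundary : set (R * R) := [set z | ellipse_form z = 1].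

Definition foci : set (R * R) :=
  let f := Num.sqrt (semi_major E ^+ 2 - semi_minor E ^+ 2) *: major_dir in
  [set centre E + f; centre E - f].

Definition outward_normal (p : R * R) : R * R :=
  (enorm (grad ellipse_form p))^-1 *: grad ellipse_form p.
Definition inward_normal (p : R * R) : R * R := - outward_normal p.

(* A closed curve [0, 2 pi) -> R^2 is given by its periodic extension. *)
Definition regular_parametrisation (gamma : R -> R * R) : Prop :=
  [/\ forall t, gamma (t + 2 * pi) = gamma t,
      exists dgamma : R -> R * R, continuous dgamma /\
        (forall t : R, is_derive t 1 gamma (dgamma t) /\ dgamma t != 0) &
      set_bij `[0, 2 * pi[%classic elliptic_boundary gamma].

End Ellipse.
Arguments ellipse : clear implicits.

Section Motions.
Context {R : realType}.
Implicit Types (P : R * R) (z u : R -> R * R).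

Definition V_inner (mu hI : R) P (x : R * R) : R := hI + mu / enorm (x - P).
Definition V_outer (omega hE : R) P (x : R * R) : R :=
  hE - omega ^+ 2 / 2 * enorm (x - P) ^+ 2.

Definition newton_at (V : R * R -> R) z u (t : R) : Prop :=
  [/\ is_derive t 1 z (u t), is_derive t 1 u (grad V (z t)) &
      enorm (u t) ^+ 2 / 2 - V (z t) = 0].

(* Complete motions, with position z and velocity u, in the whole plane.
   Only collinear motions reach P; the last clause is the effect of the
   Levi-Civita regularisation on them: the particle comes back along the same
   half-line, with the time-reversed motion.  The value of u at a collision
   time is irrelevant. *)
Definition inner_motion (mu hI : R) P z u : Prop :=
  [/\ continuous z,
      forall t, z t <> P -> newton_at (V_inner mu hI P) z u t &
      forall t, z t = P -> forall s, z (t + s) = z (t - s)].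

Definition outer_motion (omega hE : R) P z u : Prop :=
  forall t, newton_at (V_outer omega hE P) z u t.

(* The arc of a motion from (p, v) to its first return, at (q, w), to the
   common boundary B of the region Omega it runs through. *)
Definition arc (motion : (R -> R * R) -> (R -> R * R) -> Prop)
    (Omega B : set (R * R)) (p v q w : R * R) : Prop :=
  exists z u T, [/\ motion z u, z 0 = p /\ u 0 = v, 0 < T,
    (forall t, 0 < t < T -> Omega (z t)) & [/\ B (z T), z T = q & u T = w]].

End Motions.

Inductive billiard (R : Type) :=
  | Reflective
  | Refractive (omega hE : R).
Arguments Reflective {R}.

Section FirstReturn.
Context {R : realType}.
Variables (E : ellipse R) (mu hI : R) (P : R * R) (gamma : R -> R * R).

Let D := elliptic_domain E.
Let bD := elliptic_boundary E.
Let VI := V_inner mu hI P.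

Definition open_angle (alpha : R) : Prop := - (pi / 2) < alpha < pi / 2.

Definition phase_space : set (R * R) :=
  [set x | 0 <= x.1 < 2 * pi /\ open_angle x.2].

Definition inner_arc := arc (inner_motion mu hI P) D bD.
Definition outer_arc omega hE := arc (outer_motion omega hE P) (~` (D `|` bD)) bD.

Definition snell (omega hE : R) (p : R * R) (alphaI alphaE : R) : Prop :=
  Num.sqrt (VI p) * sin alphaI = Num.sqrt (V_outer omega hE P p) * sin alphaE.

(* Graphs of the (partial) first return maps, as relations. *)
Definition F_return (x y : R * R) : Prop :=
  let p := gamma x.1 in let q := gamma y.1 in
  [/\ phase_space x, phase_space y &
      exists w, inner_arc p (launch VI p (inward_normal E p) x.2) q w /\
        reflect (outward_normal E q) w = launch VI q (inward_normal E q) y.2].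

(* p --outer--> m, refraction inwards, m --inner--> q, refraction outwards.
   At m, velocities make the angles aE, aI with the inward normal; at q,
   they make the angles bI, y.2 with the outward normal. *)
Definition G_return (omega hE : R) (x y : R * R) : Prop :=
  let VE := V_outer omega hE P in
  let p := gamma x.1 in let q := gamma y.1 in
  [/\ phase_space x, phase_space y &
      exists m aE aI bI,
      [/\ [/\ open_angle aE, open_angle aI & open_angle bI],
          outer_arc omega hE p (launch VE p (outward_normal E p) x.2)
                    m (launch VE m (inward_normal E m) aE),
          snell omega hE m aI aE,
          inner_arc m (launch VI m (inward_normal E m) aI)
                    q (launch VI q (outward_normal E q) bI) &
          snell omega hE q bI y.2]].

Definition first_return (B : billiard R) : R * R -> R * R -> Prop :=
  match B with
  | Reflective => F_return
  | Refractive omega hE => G_return omega hE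
  end.

End FirstReturn.

Section Chaos.

Definition bisequence (A : finType) : topologicalType :=
  prod_topology (fun _ : int => discrete_topology A).

Definition bernoulli_shift (A : finType) (s : bisequence A) : bisequence A :=
  fun i : int => s (i + 1).

(* f is the graph of a partial map; h is the conjugacy, with inverse g.  By
   the last clause and the injectivity of h, f is single-valued on X, and maps
   X into X. *)
Definition has_bernoulli_subsystem (S : topologicalType)
    (f : S -> S -> Prop) : Prop :=
  exists (A : finType) (X : set S) (h : S -> bisequence A)
         (g : bisequence A -> S),
  [/\ (2 <= #|A|)%N,
      {within X, continuous h} /\ continuous g,
      forall x, X x -> g (h x) = x,
      forall s, X (g s) /\ h (g s) = s &
      forall x, X x -> (exists y, f x y) /\
        forall y, f x y -> X y /\ h y = bernoulli_shift (h x)].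

End Chaos.

Section Chaotic.
Context {R : realType}.

(* [0, 2 pi) is the circle: phase space carries the topology induced by the
   map (xi, alpha) |-> (gamma xi, alpha), not that of the interval. *)
Definition phase_topology (gamma : R -> R * R) : topologicalType :=
  initial_topology (fun x : R * R => (gamma x.1, x.2)).

Definition chaotic (E : ellipse R) (mu : R) (B : billiard R)
    (P : R * R) (hI : R) : Prop :=
  forall gamma, regular_parametrisation E gamma ->
    has_bernoulli_subsystem
      (first_return E mu hI P gamma B : phase_topology gamma -> _ -> Prop).

Definition admissible (E : ellipse R) (B : billiard R) : Prop :=
  match B with
  | Reflective => True
  | Refractive omega hE =>
      [/\ 0 < omega, 0 < hE &
          forall P z, elliptic_domain E P -> elliptic_boundary E z ->
            0 < V_outer omega hE P z]
  end.

Definition lebesgue_null (A : set (R * R)) : Prop :=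
  ((@lebesgue_measure R \x @lebesgue_measure R)%E).-negligible A.

End Chaotic.

(* Main.v *)
Require Import Defs.
From mathcomp Require Import all_boot all_order all_algebra.
From mathcomp Require Import all_classical all_reals all_analysis.
From mathcomp Require Import ring lra zify.
From mathcomp Require Import measurable_realfun.
Import Order.TTheory GRing.Theory Num.Theory.
Import numFieldNormedType.Exports.
Local Open Scope classical_set_scope.
Local Open Scope ring_scope.
Set Implicit Arguments.
Unset Strict Implicit.
Unset Printing Implicit Defensive.

(** Take for the good positions P those on neither axis of the ellipse: the axes
    are two lines, hence negligible, and the foci lie on one of them.  Chaos comes
    from the limit of infinite inner energy, in which an inner arc from p to q runs
    straight from p to the mass and straight on to q, for whatever q.

    Off the axes, the distance to P has two nondegenerate critical points on the
    ellipse, in opposite quadrants and not opposite as seen from P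
    (critical_points, critical_half_dot).  A particle launched radially from one
    of them reaches the mass and can be sent to either one; at finite but high
    energy one looks for true trajectories that bounce near them in any
    prescribed order.

    Inner arcs are explicit in Levi-Civita's coordinate, the complex square root
    of the position relative to P, where Kepler's equation is linear
    (levi_civita_motion).  Between two points p, q not opposite as seen from P
    there is, at every energy, an arc that swings round the mass; it runs
    through convex combinations of p, q and a point close to P, so it stays in
    the domain (kepler_arc, inner_arc_bpoint).  Its velocity at q is radial up to
    an error of the order of eta = mu / hI, with uniform Lipschitz bounds
    (arrival_tangentE, ulip_arrival_defect).

    Reflection and Snell's law both say that the tangential component of the
    velocity is continuous at the ellipse.  For a chain of points x_i close to
    the critical points prescribed by a bi-infinite sequence s, this reads
        slope (x_i) + (small coupling of x_(i-1), x_i, x_(i+1)) = 0,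
    where slope is the derivative of half the squared distance to P, with simple
    zeros at the critical points.  In the refractive billiard there are two
    unknowns per return, the ends of an outer arc, which is an explicit arc of a
    harmonic ellipse lying outside the domain (outer_connection,
    outer_arc_bpoint); its contribution to the coupling is of the order of
    hI ^ (- 1 / 2).  A contraction, uniform in s, solves the chain for every s at
    once, with a solution that depends continuously on s and is compatible with
    the shift (coded_fixed_point, perturbed_chain).

    It remains to see that the first return map is really conjugate to the shift
    on these trajectories.  It is single-valued, because motions are determined
    by their initial conditions, also through a collision (inner_motion_unique,
    outer_motion_unique, arc_unique).  It is injective, because arcs can be
    reversed; so a state determines all its future and past symbols, which are
    told by the side of the minor axis where the points lie.  Compactness of the sequence space makes
    the conjugacy a homeomorphism (bernoulli_of_coding). *)

(** * Differentiation on the line and in the plane *)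

Section Calculus.
Context {R : realType}.
Implicit Types (f g : R -> R) (z : R -> R * R).

Lemma is_derive_cst' (t c : R) : is_derive t 1 (fun _ => c) 0.
Proof. exact: is_derive_cst. Qed.

Lemma is_derive_id' (t : R) : is_derive t 1 (fun x => x) 1.
Proof. exact: is_derive_id. Qed.

Lemma is_deriveD' f g (t a b : R) : is_derive t 1 f a -> is_derive t 1 g b ->
  is_derive t 1 (fun x => f x + g x) (a + b).
Proof. by move=> fa gb; exact: is_deriveD. Qed.

Lemma is_deriveN' f (t a : R) : is_derive t 1 f a ->
  is_derive t 1 (fun x => - f x) (- a).
Proof. by move=> fa; exact: is_deriveN. Qed.

Lemma is_deriveM' f g (t a b : R) : is_derive t 1 f a -> is_derive t 1 g b ->
  is_derive t 1 (fun x => f x * g x) (f t * b + g t * a).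
Proof. by move=> fa gb; exact: is_deriveM. Qed.

Lemma is_deriveX' f n (t a : R) : is_derive t 1 f a ->
  is_derive t 1 (fun x => f x ^+ n.+1) (n.+1%:R * f t ^+ n * a).
Proof.
move=> fa; have -> : (fun x => f x ^+ n.+1) = f ^+ n.+1 by rewrite exprfctE.
exact: is_deriveX.
Qed.

Lemma is_deriveV' f (t a : R) : f t != 0 -> is_derive t 1 f a ->
  is_derive t 1 (fun x => (f x)^-1) (- (f t) ^- 2 * a).
Proof. by move=> f0 fa; exact: is_deriveV. Qed.

Lemma is_derive_comp' f g (t a b : R) : is_derive (g t) 1 f a -> is_derive t 1 g b ->
  is_derive t 1 (fun x => f (g x)) (a * b).
Proof. by move=> fa gb; exact: is_derive1_comp. Qed.

Lemma is_derive_sqrt' f (t a : R) : 0 < f t -> is_derive t 1 f a ->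
  is_derive t 1 (fun x => Num.sqrt (f x)) ((2 * Num.sqrt (f t))^-1 * a).
Proof. by move=> f0 fa; apply: is_derive_comp' => //; exact: is_derive1_sqrt. Qed.

Lemma scaleRE (a b : R) : a *: b = a * b. Proof. by []. Qed.

Lemma is_derive_change f (t a b : R) : is_derive t 1 f a -> a = b -> is_derive t 1 f b.
Proof. by move=> ? <-. Qed.

Lemma is_derive_continuous (V : normedModType R) (h : R -> V) (t : R) a :
  is_derive t 1 h a -> {for t, continuous h}.
Proof.
move=> [ha _]; apply: differentiable_continuous; exact/derivable1_diffP.
Qed.

End Calculus.

(* The premises are left as goals: typeclass resolution would fill the values of
   the derivatives with unevaluated terms. *)
Ltac deriv1 := cbv beta; lazymatch goal with
| |- is_derive _ _ (fun _ => ?c) _ => exact: is_derive_cst'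
| |- is_derive _ _ (fun y => y) _ => exact: is_derive_id'
| |- is_derive _ _ (fun y => @?f y + @?g y) _ =>
    notypeclasses refine (@is_deriveD' _ f g _ _ _ _ _)
| |- is_derive _ _ (fun y => - (@?f y)) _ =>
    notypeclasses refine (@is_deriveN' _ f _ _ _)
| |- is_derive _ _ (fun y => @?f y * @?g y) _ =>
    notypeclasses refine (@is_deriveM' _ f g _ _ _ _ _)
| |- is_derive _ _ (fun y => @?f y ^+ ?n.+1) _ =>
    notypeclasses refine (@is_deriveX' _ f n _ _ _)
| |- is_derive _ _ (fun y => (@?f y)^-1) _ =>
    notypeclasses refine (@is_deriveV' _ f _ _ _ _)
| |- is_derive _ _ (fun y => Num.sqrt (@?f y)) _ =>
    notypeclasses refine (@is_derive_sqrt' _ f _ _ _ _)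
| |- is_derive _ _ (fun y => expR (@?f y)) _ =>
    notypeclasses refine (@is_derive_comp' _ expR f _ _ _ (is_derive_expR _) _)
| |- is_derive _ _ (fun y => sin (@?f y)) _ =>
    notypeclasses refine (@is_derive_comp' _ sin f _ _ _ (is_derive_sin _) _)
| |- is_derive _ _ (fun y => cos (@?f y)) _ =>
    notypeclasses refine (@is_derive_comp' _ cos f _ _ _ (is_derive_cos _) _)
| |- is_derive _ _ _ _ => eassumption
end.
(* Differentiates a closed expression; the first goal is the value of the
   derivative, the others are the nonvanishing conditions. *)
Ltac deriv := notypeclasses refine (is_derive_change _ _); [repeat deriv1 | cbv beta].

Section PlaneCalculus.
Context {R : realType}.
Implicit Types (z : R -> R * R).

(** Planar motions are differentiated coordinate by coordinate: the difference
    quotient of a pair is the pair of the difference quotients. *)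
Lemma is_derive_pairP z (t : R) (u : R * R) :
  is_derive t 1 z u <->
  is_derive t 1 (fun s => (z s).1) u.1 /\ is_derive t 1 (fun s => (z s).2) u.2.
Proof.
have E (V : normedModType R) (h : R -> V) d : is_derive t 1 h d <->
    (fun x : R => x^-1 *: ((h \o shift t) (x *: 1) - h t)) @ 0^' --> d.
  split=> [[hd <-]|hd]; first exact: hd.
  by split; [apply/cvg_ex; exists d | exact/cvg_lim].
rewrite !E; split=> [zu|[z1 z2]].
  split; first exact: (continuous_cvg (h := fst) _ cvg_fst zu).
  exact: (continuous_cvg (h := snd) _ cvg_snd zu).
rewrite [u]surjective_pairing.
have -> : (fun x : R => x^-1 *: ((z \o shift t) (x *: 1) - z t)) =
  (fun x : R => (x^-1 *: (((fun s => (z s).1) \o shift t) (x *: 1) - (z t).1),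
    x^-1 *: (((fun s => (z s).2) \o shift t) (x *: 1) - (z t).2))).
  by [].
exact: (cvg_pair (G := nbhs u.1) (H := nbhs u.2) z1 z2).
Qed.

(** The partial derivatives that make up the gradient are derivatives at 0 of
    functions of one variable, to which the differentiation tactic applies. *)
Lemma gradE (V : R * R -> R) (z : R * R) (a b : R) :
  is_derive (0 : R) 1 (fun s => V (z.1 + s, z.2)) a ->
  is_derive (0 : R) 1 (fun s => V (z.1, z.2 + s)) b -> grad V z = (a, b).
Proof.
have E (W : R -> R * R) v : (forall s, W s = s *: v + z) ->
    'D_v V z = 'D_1 (fun s => V (W s)) 0.
  move=> WE; rewrite /derive.
  have -> // : (fun h : R => h^-1 *: ((V \o shift z) (h *: v) - V z)) =
    (fun h : R => h^-1 *: (((fun s => V (W s)) \o shift 0) (h *: 1) - V (W 0))).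
  apply/funext => s /=.
  by rewrite !WE scale0r add0r addr0 /(s *: 1) /= mulr1.
move=> [_ <-] [_ <-]; rewrite /grad; congr (_, _); apply: E => s;
  by apply: injective_projections => /=;
    rewrite ?/(s *: _) /= ?mulr1 ?mulr0 ?add0r // addrC.
Qed.

End PlaneCalculus.

(** * The Euclidean norm and the two forces *)

Section Potentials.
Context {R : realType}.
Implicit Types (p q P x z : R * R).

Lemma dot_ge0 p : 0 <= dot p p.
Proof. by rewrite /dot -!expr2 addr_ge0 ?sqr_ge0. Qed.

Lemma dot_gt0 p : p != 0 -> 0 < dot p p.
Proof.
move=> p0; rewrite lt_neqAle dot_ge0 andbT eq_sym; apply: contra p0.
rewrite /dot -!expr2 paddr_eq0 ?sqr_ge0// !sqrf_eq0 => /andP[/eqP a /eqP b].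
by apply/eqP/injective_projections.
Qed.

Lemma enorm_ge0 p : 0 <= enorm p. Proof. exact: sqrtr_ge0. Qed.

Lemma enorm_gt0 p : p != 0 -> 0 < enorm p.
Proof. by move=> p0; rewrite sqrtr_gt0 dot_gt0. Qed.

Lemma sqr_enorm p : enorm p ^+ 2 = dot p p.
Proof. by rewrite sqr_sqrtr// dot_ge0. Qed.

Lemma enormE p (r : R) : 0 <= r -> r ^+ 2 = dot p p -> enorm p = r.
Proof. by move=> r0 rp; rewrite /enorm -rp sqrtr_sqr ger0_norm. Qed.

Lemma enorm_eq0 p : (enorm p == 0) = (p == 0).
Proof.
apply/idP/idP => [|/eqP ->]; last by rewrite /enorm /dot /= !mulr0 addr0 sqrtr0.
by apply: contraLR => /enorm_gt0/gt_eqF ->.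
Qed.

Lemma grad_V_inner (mu hI : R) P z : z != P ->
  grad (V_inner mu hI P) z = (- (mu / enorm (z - P) ^+ 3)) *: (z - P).
Proof.
rewrite -subr_eq0 => zP; have := enorm_gt0 zP; have := dot_gt0 zP.
rewrite [RHS]/(_ *: _) /= /V_inner /enorm /dot /= => d0 s0.
set r := Num.sqrt _ in s0 *; have r0 := lt0r_neq0 s0.
by apply: gradE => /=; deriv; rewrite ?(addr0 z.1) ?(addr0 z.2) -/r//;
  rewrite /GRing.scale /=; field.
Qed.

Lemma grad_V_outer (omega hE : R) P z :
  grad (V_outer omega hE P) z = (- omega ^+ 2) *: (z - P).
Proof.
have E : V_outer omega hE P = fun x => hE - omega ^+ 2 / 2 * dot (x - P) (x - P).
  by apply/funext => x; rewrite /V_outer sqr_enorm.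
rewrite E [RHS]/(_ *: _) /=.
by apply: gradE; rewrite /dot /=; deriv; rewrite /=  /GRing.scale /=; field.
Qed.

End Potentials.

(** * Levi-Civita motions *)

Section LeviCivita.
Context {R : realType}.
Variables (A B P : R * R) (k mu : R).
Hypotheses (k_gt0 : 0 < k) (mu_gt0 : 0 < mu)
  (AB : dot A B = - (mu / (8 * k ^+ 2))).
Implicit Types (s t : R).

(** Regard the plane as the complex numbers, and put z - P = w ^ 2 with the new
    time s given by dt = |w| ^ 2 ds.  Kepler's equation at energy 2 * k ^ 2
    becomes the linear equation w'' = k ^ 2 * w, without singularity, with
    solutions w = A e^(k s) + B e^(- k s).  Here (lc1, lc2) is w and
    (dlc1, dlc2) its derivative; lc_radius is |w| ^ 2 = |z - P|, lc_time the
    physical time as a function of s, and lc_vel is 2 w w' / |w| ^ 2.  The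
    hypothesis on dot A B is the energy relation. *)
Definition lc1 s := A.1 * expR (k * s) + B.1 * expR (- (k * s)).
Definition lc2 s := A.2 * expR (k * s) + B.2 * expR (- (k * s)).
Definition dlc1 s := k * (A.1 * expR (k * s) - B.1 * expR (- (k * s))).
Definition dlc2 s := k * (A.2 * expR (k * s) - B.2 * expR (- (k * s))).
Definition lc_radius s := lc1 s ^+ 2 + lc2 s ^+ 2.
Definition lc_time s :=
  dot A A * ((expR (k * s) ^+ 2 - 1) / (2 * k)) +
  dot B B * ((1 - expR (- (k * s)) ^+ 2) / (2 * k)) + 2 * dot A B * s.
Definition lc_pos s : R * R :=
  (P.1 + (lc1 s ^+ 2 - lc2 s ^+ 2), P.2 + 2 * (lc1 s * lc2 s)).
Definition lc_vel s : R * R :=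
  (2 * (lc1 s * dlc1 s - lc2 s * dlc2 s) / lc_radius s,
   2 * (lc1 s * dlc2 s + lc2 s * dlc1 s) / lc_radius s).

Let k_neq0 : k != 0. Proof. exact: lt0r_neq0. Qed.

Lemma dotAB_lt0 : dot A B < 0.
Proof. by rewrite AB oppr_lt0 divr_gt0// mulr_gt0// exprn_gt0. Qed.

Let expE s : expR (k * s) * expR (- (k * s)) = 1.
Proof. exact: expRxMexpNx_1. Qed.

Lemma lc_energy s :
  dlc1 s ^+ 2 + dlc2 s ^+ 2 = k ^+ 2 * lc_radius s + mu / 2.
Proof.
have -> : mu / 2 = - (4 * k ^+ 2 * dot A B * (expR (k * s) * expR (- (k * s)))).
  by rewrite expE AB; field.
by rewrite /dlc1 /dlc2 /lc_radius /lc1 /lc2 /dot; ring.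
Qed.

Lemma is_derive_lc1 s : is_derive s 1 lc1 (dlc1 s).
Proof. by rewrite /lc1 /dlc1; deriv; ring. Qed.

Lemma is_derive_lc2 s : is_derive s 1 lc2 (dlc2 s).
Proof. by rewrite /lc2 /dlc2; deriv; ring. Qed.

Lemma is_derive_dlc1 s : is_derive s 1 dlc1 (k ^+ 2 * lc1 s).
Proof. by rewrite /lc1 /dlc1; deriv; ring. Qed.

Lemma is_derive_dlc2 s : is_derive s 1 dlc2 (k ^+ 2 * lc2 s).
Proof. by rewrite /lc2 /dlc2; deriv; ring. Qed.

Lemma is_derive_lc_time s : is_derive s 1 lc_time (lc_radius s).
Proof.
rewrite /lc_time /lc_radius /lc1 /lc2; deriv.
have -> : 2 * dot A B = 2 * dot A B * (expR (k * s) * expR (- (k * s))).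
  by rewrite expE mulr1.
by rewrite /dot; field.
Qed.

Lemma lc_radius_ge0 s : 0 <= lc_radius s.
Proof. by rewrite addr_ge0 ?sqr_ge0. Qed.

Lemma lc_radius_eq0 s : lc_radius s = 0 -> lc1 s = 0 /\ lc2 s = 0.
Proof.
move/eqP; rewrite /lc_radius paddr_eq0 ?sqr_ge0// !sqrf_eq0.
by move=> /andP[/eqP -> /eqP ->].
Qed.

(** A zero of w satisfies A e^(k s) = - B e^(- k s); as A is not 0, this
    determines e^(2 k s).  So a motion collides at most once. *)
Lemma lc_radius_zero_unique s t : lc_radius s = 0 -> lc_radius t = 0 -> s = t.
Proof.
move=> /lc_radius_eq0[s1 s2] /lc_radius_eq0[t1 t2].
have E (x : R) : lc1 x = 0 -> lc2 x = 0 ->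
    dot A A * expR (k * x) ^+ 2 = - dot A B.
  move=> x1 x2; have : (A.1 * lc1 x + A.2 * lc2 x) * expR (k * x) = 0.
    by rewrite x1 x2 !mulr0 addr0 mul0r.
  rewrite /lc1 /lc2 => e; apply/eqP; rewrite -subr_eq0 opprK; apply/eqP.
  rewrite -{}e -[dot A B]mulr1 -(expE x) /dot; ring.
have := E s s1 s2; rewrite -(E t t1 t2) => /eqP; rewrite -subr_eq0 -mulrBr mulf_eq0.
have A0 : dot A A != 0.
  apply/eqP => A0; have := E s s1 s2; rewrite A0 mul0r => /esym/eqP.
  by rewrite oppr_eq0 lt_eqF// dotAB_lt0.
rewrite (negPf A0) /= subr_eq0 eqrXn2 ?expR_ge0// => /eqP /expR_inj.
by move/(mulfI k_neq0).
Qed.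

Lemma lc_time_continuous : continuous lc_time.
Proof. by move=> s; exact: is_derive_continuous (is_derive_lc_time s). Qed.

Lemma lc_time_MVT s t : s < t ->
  exists2 c, s < c < t & lc_time t - lc_time s = lc_radius c * (t - s).
Proof.
move=> st; have [c cst e] := MVT st (fun x _ => is_derive_lc_time x)
  (continuous_subspaceT lc_time_continuous).
by exists c => //; rewrite in_itv /= in cst.
Qed.

(** The derivative of the time is |w| ^ 2, which may vanish at one point c of
    the interval given by the mean value theorem; that theorem on [s, c] then gives
    another point, where it does not vanish. *)
Lemma lc_time_lt s t : s < t -> lc_time s < lc_time t.
Proof.
move=> st; have [c /andP[sc ct] e] := lc_time_MVT st.
have := lc_radius_ge0 c; rewrite le0r => /orP[/eqP c0|c0]; last first.
  by rewrite -subr_gt0 e mulr_gt0// subr_gt0.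
have [d /andP[sd dc] e'] := lc_time_MVT sc.
have [d' _ e''] := lc_time_MVT ct.
apply: (@lt_le_trans _ _ (lc_time c)).
  rewrite -subr_gt0 e' mulr_gt0 ?subr_gt0// lt0r lc_radius_ge0 andbT.
  by apply/eqP => d0; move: dc; rewrite (lc_radius_zero_unique d0 c0) ltxx.
by rewrite -subr_ge0 e'' mulr_ge0 ?lc_radius_ge0// subr_ge0 ltW.
Qed.

Lemma lc_time_inj : injective lc_time.
Proof.
move=> s t e; have [/lc_time_lt|/lc_time_lt|//] := ltgtP s t.
  by rewrite e ltxx.
by rewrite e ltxx.
Qed.

Lemma lc_time_ltE s t : (lc_time s < lc_time t) = (s < t).
Proof.
have [st|ts|->] := ltgtP s t; first exact: lc_time_lt.
  by apply/negbTE; rewrite -leNgt ltW// lc_time_lt.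
by rewrite ltxx.
Qed.

Lemma lc_time0 : lc_time 0 = 0.
Proof. by rewrite /lc_time mulr0 oppr0 !expR0 expr1n subrr !mul0r !mulr0 !addr0. Qed.

End LeviCivita.

Section LeviCivitaMotion.
Context {R : realType}.
Implicit Types (A B P : R * R) (k mu s t : R).

Lemma lc_timeN A B k s : lc_time A B k (- s) = - lc_time B A k s.
Proof. by rewrite /lc_time mulrN opprK /dot; ring. Qed.

(** The exponential term of the time, which is at least quadratic in s, wins
    over its linear term 2 * dot A B * s. *)
Lemma lc_time_ge A B k y : 0 < k -> dot A B < 0 -> exists s, y <= lc_time A B k s.
Proof.
move=> k0 AB.
have A0 : 0 < dot A A.
  rewrite dot_gt0//; apply/eqP => A0; move: AB.
  by rewrite A0 /dot /= !mul0r addr0 ltxx.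
pose d := dot A A * k / 2; have d0 : 0 < d by rewrite !mulr_gt0// invr_gt0.
have dE : dot A A * k = 2 * d by rewrite /d; field.
clearbody d.
pose s := 1 + (`|y| + 2 * `|dot A B|) / d.
have s1 : 1 <= s.
  by rewrite lerDl divr_ge0 ?(ltW d0)// addr_ge0// mulr_ge0.
have s0 : 0 <= s by exact: le_trans s1.
exists s; have ks0 : 0 <= k * s by rewrite mulr_ge0// ltW.
have e1 : 2 * (k * s) + (k * s) ^+ 2 <= expR (k * s) ^+ 2 - 1.
  have h : 1 + k * s <= expR (k * s) by exact: expR_ge1Dx.
  have h0 : 0 <= 1 + k * s by rewrite addr_ge0.
  have h2 : (1 + k * s) ^+ 2 <= expR (k * s) ^+ 2 by rewrite lerXn2r// nnegrE ?expR_ge0.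
  by nra.
have e2 : 0 <= 1 - expR (- (k * s)) ^+ 2.
  have : expR (- (k * s)) <= 1 by rewrite expR_le1 oppr_le0.
  by have := expR_ge0 (- (k * s)); nra.
have t1 : dot A A * ((2 * (k * s) + (k * s) ^+ 2) / (2 * k)) <=
    dot A A * ((expR (k * s) ^+ 2 - 1) / (2 * k)).
  by rewrite ler_wpM2l ?(ltW A0)// ler_wpM2r// invr_ge0 mulr_ge0// ltW.
have t2 : 0 <= dot B B * ((1 - expR (- (k * s)) ^+ 2) / (2 * k)).
  by rewrite mulr_ge0 ?dot_ge0// divr_ge0// mulr_ge0// ltW.
have t3 : - (2 * `|dot A B| * s) <= 2 * dot A B * s.
  rewrite -mulNr ler_wpM2r// -mulrN ler_wpM2l//.
  by rewrite lerNl -normrN ler_norm.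
apply: (@le_trans _ _ (d * s * s - 2 * `|dot A B| * s)).
  have -> : d * s * s = (d + `|y| + 2 * `|dot A B|) * s.
    by congr (_ * s); rewrite /s; field; exact: lt0r_neq0.
  have yy := ler_norm y; have y0 : 0 <= `|y| by [].
  have : `|y| * 1 <= `|y| * s by rewrite ler_wpM2l.
  have : 0 <= d * s by rewrite mulr_ge0// ltW.
  lra.
rewrite /lc_time.
have e : dot A A * ((2 * (k * s) + (k * s) ^+ 2) / (2 * k)) =
    dot A A * s + d * s * s.
  have -> : d * s * s = dot A A * k * s * s / 2 by rewrite dE; field.
  by field; exact: lt0r_neq0.
have : 0 <= dot A A * s by rewrite mulr_ge0// ltW.
by lra.
Qed.

Lemma lc_time_surj A B k y : 0 < k -> dot A B < 0 -> exists s, lc_time A B k s = y.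
Proof.
move=> k0 AB; have BA : dot B A < 0 by rewrite /dot (mulrC B.1) (mulrC B.2).
have [s2 h2] := lc_time_ge y k0 AB.
have [s1] := lc_time_ge (- y) k0 BA; rewrite lerNl -lc_timeN => h1.
have C : continuous (lc_time A B k).
  by move=> s; exact: is_derive_continuous (is_derive_lc_time _ _ k0 s).
have [le|/ltW le] := leP (- s1) s2.
  have [|c _ <-] := IVT (v := y) le (continuous_subspaceT C); last by exists c.
  by rewrite ge_min le_max h1 h2 orbT.
have [|c _ <-] := IVT (v := y) le (continuous_subspaceT C); last by exists c.
by rewrite ge_min le_max h1 h2 !orbT.
Qed.

(** The time change is a homeomorphism of the line, and differentiable with
    nonzero derivative away from the collision: Newton's equation and the energy
    relation for z = P + w ^ 2 follow from those for w by the chain rule.  If w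
    vanishes at c then w (c + x) = - w (c - x), so that w ^ 2 and the time elapsed
    since c are even and odd in x: this is the reflection prescribed at a
    collision. *)
Lemma levi_civita_motion A B P k mu : 0 < k -> 0 < mu ->
  dot A B = - (mu / (8 * k ^+ 2)) ->
  exists z u, inner_motion mu (2 * k ^+ 2) P z u /\
    forall s, z (lc_time A B k s) = lc_pos A B P k s /\
              u (lc_time A B k s) = lc_vel A B k s.
Proof.
move=> k0 mu0 AB; have AB0 := dotAB_lt0 k0 mu0 AB.
pose T := lc_time A B k.
have [tau tauK] : exists tau : R -> R, forall t, T (tau t) = t.
  exists (fun t => projT1 (cid (lc_time_surj t k0 AB0))) => t.
  by case: cid.
have Tinj : injective T := lc_time_inj k0 mu0 AB.
have tK s : tau (T s) = s by apply: Tinj; rewrite tauK.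
have TC : continuous T by exact: lc_time_continuous.
have tauC : continuous tau.
  move=> t; rewrite -(tauK t).
  have K : {near tau t, cancel T tau} by apply: filterE => ?; exact: tK.
  have C : \forall x \near tau t, {for x, continuous T} by apply: filterE => ?; exact: TC.
  exact: nbhs_singleton (near_can_continuous K C).
pose z t := lc_pos A B P k (tau t); pose u t := lc_vel A B k (tau t).
exists z, u; split; last by move=> s; rewrite /z /u -/T !tK.
have rE s : (lc1 A B k s ^+ 2 - lc2 A B k s ^+ 2) ^+ 2 +
    (2 * (lc1 A B k s * lc2 A B k s)) ^+ 2 = lc_radius A B k s ^+ 2.
  by rewrite /lc_radius; ring.
have nE t : enorm (z t - P) = lc_radius A B k (tau t).
  apply: enormE; first exact: lc_radius_ge0.
  by rewrite -rE /dot /z /lc_pos /=; ring.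
split.
- move=> t.
  have C1 : is_derive (tau t) 1 (lc1 A B k) (dlc1 A B k (tau t)) by exact: is_derive_lc1.
  have C2 : is_derive (tau t) 1 (lc2 A B k) (dlc2 A B k (tau t)) by exact: is_derive_lc2.
  have c1 : {for t, continuous ((fun s => (lc_pos A B P k s).1) \o tau)}.
    apply: continuous_comp; first exact: tauC.
    notypeclasses refine (is_derive_continuous _); rewrite /lc_pos /=; repeat deriv1.
  have c2 : {for t, continuous ((fun s => (lc_pos A B P k s).2) \o tau)}.
    apply: continuous_comp; first exact: tauC.
    notypeclasses refine (is_derive_continuous _); rewrite /lc_pos /=; repeat deriv1.
  exact: (cvg_pair (G := nbhs (z t).1) (H := nbhs (z t).2) c1 c2).
- move=> t zP.
  have r0 : lc_radius A B k (tau t) != 0.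
    by rewrite -nE enorm_eq0 subr_eq0; apply/eqP.
  have dtau : is_derive t 1 tau (lc_radius A B k (tau t))^-1.
    have K : {near tau t, cancel T tau} by apply: filterE => ?; exact: tK.
    have C : \forall x \near tau t, {for x, continuous T} by apply: filterE => ?; exact: TC.
    have := is_derive_inverse K C (is_derive_lc_time A B k0 (tau t)) r0.
    by rewrite -/T tauK.
  have d1 : is_derive t 1 (fun t => lc1 A B k (tau t))
      (dlc1 A B k (tau t) / lc_radius A B k (tau t)).
    by apply: is_derive_comp' => //; exact: is_derive_lc1.
  have d2 : is_derive t 1 (fun t => lc2 A B k (tau t))
      (dlc2 A B k (tau t) / lc_radius A B k (tau t)).
    by apply: is_derive_comp' => //; exact: is_derive_lc2.
  have e1 : is_derive t 1 (fun t => dlc1 A B k (tau t))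
      (k ^+ 2 * lc1 A B k (tau t) / lc_radius A B k (tau t)).
    by apply: is_derive_comp' => //; exact: is_derive_dlc1.
  have e2 : is_derive t 1 (fun t => dlc2 A B k (tau t))
      (k ^+ 2 * lc2 A B k (tau t) / lc_radius A B k (tau t)).
    by apply: is_derive_comp' => //; exact: is_derive_dlc2.
  have en := lc_energy k0 AB (tau t).
  split.
  + by apply/is_derive_pairP; split; rewrite /z /u /lc_pos /lc_vel /=;
      deriv; rewrite /lc_radius; field.
  + rewrite grad_V_inner; last exact/eqP.
    rewrite nE [X in is_derive _ _ _ X](_ : _ =
      (- (mu / lc_radius A B k (tau t) ^+ 3) * (z t - P).1,
       - (mu / lc_radius A B k (tau t) ^+ 3) * (z t - P).2)) //.
    have -> : mu = 2 * (dlc1 A B k (tau t) ^+ 2 + dlc2 A B k (tau t) ^+ 2 -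
       k ^+ 2 * lc_radius A B k (tau t)) by rewrite en; field.
    apply/is_derive_pairP; split; rewrite /z /u /lc_pos /lc_vel /=;
      rewrite /lc_radius in r0 *; deriv => //; rewrite /lc_radius; field => //.
  + rewrite /V_inner nE sqr_enorm.
    have -> : mu = 2 * (dlc1 A B k (tau t) ^+ 2 + dlc2 A B k (tau t) ^+ 2 -
       k ^+ 2 * lc_radius A B k (tau t)) by rewrite en; field.
    rewrite /dot /u /lc_vel /=; rewrite /lc_radius in r0 *; field => //.
- move=> t zP s.
  have : lc_radius A B k (tau t) = 0.
    by rewrite -nE zP subrr; apply/eqP; rewrite enorm_eq0.
  have Tc : T (tau t) = t := tauK t.
  move: Tc; set c := tau t => Tc /lc_radius_eq0[w1 w2].
  pose e := expR (k * c); pose e' := expR (- (k * c)).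
  have ee' : e * e' = 1 by exact: expRxMexpNx_1.
  have B1 : B.1 * e' = - (A.1 * e).
    by apply/eqP; rewrite -addr_eq0 addrC; apply/eqP.
  have B2 : B.2 * e' = - (A.2 * e).
    by apply/eqP; rewrite -addr_eq0 addrC; apply/eqP.
  have exD x : expR (k * (c + x)) = e * expR (k * x).
    by rewrite mulrDr expRD.
  have exN x : expR (- (k * (c + x))) = e' * expR (- (k * x)).
    by rewrite mulrDr opprD expRD.
  (* w is odd about the collision. *)
  have w1N x : lc1 A B k (c - x) = - lc1 A B k (c + x).
    by rewrite /lc1 !exD !exN !mulrA B1 mulrN opprK; ring.
  have w2N x : lc2 A B k (c - x) = - lc2 A B k (c + x).
    by rewrite /lc2 !exD !exN !mulrA B2 mulrN opprK; ring.
  have TE x : T (c + x) - T c = dot A A * e ^+ 2 *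
     ((expR (k * x) ^+ 2 - expR (- (k * x)) ^+ 2) / (2 * k) - 2 * x).
    have BB : dot B B * e' ^+ 2 = dot A A * e ^+ 2.
      transitivity ((B.1 * e') ^+ 2 + (B.2 * e') ^+ 2); first by rewrite /dot; ring.
      by rewrite B1 B2 /dot; ring.
    have AB' : dot A B = - (dot A A * e ^+ 2).
      transitivity (A.1 * e * (B.1 * e') + A.2 * e * (B.2 * e')).
        by rewrite -[LHS]mulr1 -ee' /dot; ring.
      by rewrite B1 B2 /dot; ring.
    transitivity (dot A A * e ^+ 2 * ((expR (k * x) ^+ 2 - 1) / (2 * k)) +
      dot B B * e' ^+ 2 * ((1 - expR (- (k * x)) ^+ 2) / (2 * k)) + 2 * dot A B * x).
      rewrite /T /lc_time exD exN -/e -/e'.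
      by field; exact: lt0r_neq0.
    by rewrite BB AB'; field; exact: lt0r_neq0.
  pose x := tau (t + s) - c.
  have cx : c + x = tau (t + s) by rewrite addrC subrK.
  have cNx : c - x = tau (t - s).
    apply: Tinj; rewrite tauK.
    apply: (@addIr _ (- T c)); rewrite TE mulrN opprK.
    transitivity (- (T (c + x) - T c)); first by rewrite TE; ring.
    by rewrite cx tauK Tc; ring.
  by rewrite /z -cx -cNx /lc_pos w1N w2N !sqrrN mulrNN.
Qed.

End LeviCivitaMotion.

(** * The Kepler arc joining two points *)

Section KeplerArc.
Context {R : realType}.
Implicit Types (p q P a b : R * R).

(** For nonzero p, q making the angle 2 theta, this is |p q| ^ (1 / 2) cos theta:
    the absolute value of the scalar product of complex square roots of p and
    q.  It vanishes iff p and q are opposite as seen from the mass. *)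
Definition half_dot p q : R := Num.sqrt ((enorm p * enorm q + dot p q) / 2).

(** The square root of the complex number p q that points into the angle
    between p and q. *)
Definition bisector p q : R * R :=
  (2 * half_dot p q)^-1 *: (enorm q *: p + enorm p *: q).

(** The arc from p to q is w ^ 2 for the solution of w'' = k ^ 2 w that joins a
    to b in the time T, where a ^ 2 = p and b ^ 2 = q.  Its energy condition is a
    quadratic equation for x = 1 / cosh (k T), of which this is the positive
    solution; eta is mu / h.  It tends to 0, and the arc to the two radii from P,
    when the energy h tends to infinity. *)
Definition bend (eta : R) p q : R :=
  eta / (half_dot p q + Num.sqrt (half_dot p q ^+ 2 + eta ^+ 2 +
                                  eta * (enorm p + enorm q))).

Definition arrival (mu h : R) p q : R * R :=
  let x := bend (mu / h) p q in
  (Num.sqrt (2 * h) / (enorm q * Num.sqrt (1 - x ^+ 2))) *: (q + x *: bisector p q).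

Lemma pairD p q : p + q = (p.1 + q.1, p.2 + q.2). Proof. by []. Qed.
Lemma dotC p q : dot p q = dot q p. Proof. by rewrite /dot; ring. Qed.

Lemma half_dotC p q : half_dot p q = half_dot q p.
Proof. by rewrite /half_dot dotC (mulrC (enorm p)). Qed.

Lemma bisectorC p q : bisector p q = bisector q p.
Proof. by rewrite /bisector half_dotC addrC. Qed.

Lemma bendC eta p q : bend eta p q = bend eta q p.
Proof. by rewrite /bend half_dotC (addrC (enorm p)). Qed.

Lemma complex_sqrt p : exists a, p = (a.1 ^+ 2 - a.2 ^+ 2, 2 * (a.1 * a.2)).
Proof.
have p1 : `|p.1| <= enorm p.
  by rewrite -sqrtr_sqr ler_wsqrtr// /dot -expr2 lerDl -expr2 sqr_ge0.
move: p1; rewrite ler_norml => /andP[l1 l2].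
pose r := enorm p.
have r2 : r ^+ 2 = p.1 ^+ 2 + p.2 ^+ 2 by rewrite /r sqr_enorm /dot.
pose c := Num.sqrt ((r + p.1) / 2); pose s := Num.sqrt ((r - p.1) / 2).
have c2 : c ^+ 2 = (r + p.1) / 2 by rewrite sqr_sqrtr// divr_ge0//; rewrite /r; lra.
have s2 : s ^+ 2 = (r - p.1) / 2 by rewrite sqr_sqrtr// divr_ge0//; rewrite /r; lra.
have cs : 2 * (c * s) = `|p.2|.
  have h : (2 * (c * s)) ^+ 2 = `|p.2| ^+ 2.
    rewrite real_normK ?num_real// exprMn exprMn c2 s2.
    have -> : p.2 ^+ 2 = r ^+ 2 - p.1 ^+ 2 by rewrite r2; ring.
    by field.
  apply: (pexpIrn (isT : (0 < 2)%N)) => //; rewrite nnegrE//.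
  by rewrite !mulr_ge0// sqrtr_ge0.
case: (ltP p.2 0) => p2.
  exists (c, - s); apply: injective_projections => /=.
    by rewrite sqrrN c2 s2; field.
  by rewrite 2!mulrN cs ltr0_norm// opprK.
exists (c, s); apply: injective_projections => /=.
  by rewrite c2 s2; field.
by rewrite cs ger0_norm.
Qed.

Lemma bend_eq eta p q (m := half_dot p q) (x := bend eta p q) :
  0 < m -> 0 < eta ->
  [/\ 0 < x, x < 1 & (eta + enorm p + enorm q) * x ^+ 2 + 2 * m * x = eta].
Proof.
move=> m0 e0; have pq : 0 <= enorm p + enorm q by rewrite addr_ge0 ?enorm_ge0.
pose S := Num.sqrt (m ^+ 2 + eta ^+ 2 + eta * (enorm p + enorm q)).
have ep : 0 <= eta * (enorm p + enorm q) by rewrite mulr_ge0// ltW.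
have S2 : S ^+ 2 = m ^+ 2 + eta ^+ 2 + eta * (enorm p + enorm q).
  by rewrite sqr_sqrtr// addr_ge0// addr_ge0 ?sqr_ge0.
have S0 : 0 <= S by exact: sqrtr_ge0.
have mS : 0 < m + S by rewrite ltr_wpDr.
have eS : eta <= S by rewrite -(ler_pXn2r (n := 2)) ?nnegrE ?(ltW e0)// S2; nra.
have xE : x = eta / (m + S) by [].
split.
- by rewrite xE divr_gt0.
- by rewrite xE ltr_pdivrMr// mul1r; lra.
- have e : eta / (m + S) * (m + S) = eta by rewrite divfK// gt_eqF.
  have -> : (eta + enorm p + enorm q) * x ^+ 2 =
      (S ^+ 2 - m ^+ 2) / eta * x ^+ 2.
    by rewrite S2; congr (_ * _); field; rewrite gt_eqF.
  rewrite xE; field; by rewrite !gt_eqF.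
Qed.

(** The arc that swings round the mass.  Of the two square roots of q one takes b
    with dot a b <= 0, so that w turns from a to b by at least a right angle and
    passes near 0 at high energy.  It is w = l a + n b, with l and n the hyperbolic
    sines of k (T - s) and k s divided by that of k T; hence
    l ^ 2 + n ^ 2 + 2 l n / x = 1, and w ^ 2 is a convex combination of p, q and
    of the point - x * bisector p q near P. *)
Lemma kepler_arc (mu h : R) P p q (x := bend (mu / h) p q) :
  0 < mu -> 0 < h -> p != 0 -> q != 0 -> 0 < half_dot p q ->
  exists z u T, [/\ inner_motion mu h P z u, 0 < T,
    z 0 = P + p /\ u 0 = - arrival mu h q p,
    z T = P + q /\ u T = arrival mu h p q &
    forall t, 0 < t < T -> exists l n, [/\ 0 < l, 0 < n,
      l ^+ 2 + n ^+ 2 + 2 * l * n / x = 1 &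
      z t = P + (l ^+ 2 *: p + n ^+ 2 *: q + (2 * l * n / x) *: (- x *: bisector p q))]].
Proof.
move=> mu0 h0 p0 q0 m0.
pose m := half_dot p q; pose eta := mu / h.
have e0 : 0 < eta by rewrite divr_gt0.
have [x0 x1 xE] := bend_eq m0 e0; rewrite -/m -/eta -/x in m0 x0 x1 xE.
have [a pa] := complex_sqrt p; have [b0 qb0] := complex_sqrt q.
have [b [qb ab]] : exists b, q = (b.1 ^+ 2 - b.2 ^+ 2, 2 * (b.1 * b.2)) /\ dot a b <= 0.
  case: (leP (dot a b0) 0) => ab; first by exists b0.
  exists (- b0); split; first by rewrite /= !sqrrN mulrNN.
  by rewrite /dot /= !mulrN -opprD oppr_le0 ltW.
have rp : enorm p = dot a a.
  by apply: enormE; rewrite ?dot_ge0// pa /dot /=; ring.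
have rq : enorm q = dot b b.
  by apply: enormE; rewrite ?dot_ge0// qb /dot /=; ring.
have abm : dot a b = - m.
  have h2 : (enorm p * enorm q + dot p q) / 2 = dot a b ^+ 2.
    by rewrite rp rq pa qb /dot /=; field.
  by rewrite /m /half_dot h2 sqrtr_sqr ler0_norm ?opprK.
have mD : m = - dot a b by rewrite abm opprK.
have sgE : bisector p q = - (a.1 * b.1 - a.2 * b.2, a.1 * b.2 + a.2 * b.1).
  have d0 : dot a b != 0 by rewrite abm oppr_eq0 gt_eqF.
  rewrite /bisector -/m mD rp rq pa qb /dot /= in d0 *.
  by apply: injective_projections; rewrite /= /GRing.scale /=; field.
have rp0 : dot a a != 0 by rewrite -rp gt_eqF// enorm_gt0.
have rq0 : dot b b != 0 by rewrite -rq gt_eqF// enorm_gt0.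
(* s = tanh (k T), as x = 1 / cosh (k T). *)
pose s := Num.sqrt (1 - x ^+ 2).
have x21 : 0 < 1 - x ^+ 2 by rewrite subr_gt0 expr_lt1// ltW.
have s0 : 0 < s by rewrite sqrtr_gt0.
have s2 : s ^+ 2 = 1 - x ^+ 2 by rewrite sqr_sqrtr// ltW.
have s1 : s < 1.
  by rewrite -(ltr_pXn2r (n := 2)) ?nnegrE ?(ltW s0)// s2 expr1n ltrBlDr ltrDl exprn_gt0.
have x0' : x != 0 by rewrite gt_eqF.
have s0' : s != 0 by rewrite gt_eqF.
pose k := Num.sqrt (2 * h) / 2.
have k0 : 0 < k by rewrite divr_gt0// sqrtr_gt0 mulr_gt0.
have k2 : 2 * k ^+ 2 = h.
  by rewrite /k expr_div_n sqr_sqrtr ?mulr_ge0 ?(ltW h0)//; field.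
(* A + B = a, and A e^(k T) + B e^(- k T) = b. *)
pose A : R * R := ((x * b.1 - (1 - s) * a.1) / (2 * s), (x * b.2 - (1 - s) * a.2) / (2 * s)).
pose B : R * R := (((1 + s) * a.1 - x * b.1) / (2 * s), ((1 + s) * a.2 - x * b.2) / (2 * s)).
have AB : dot A B = - (mu / (8 * k ^+ 2)).
  have -> : mu / (8 * k ^+ 2) = eta / 4.
    by rewrite /eta -k2; field; rewrite gt_eqF.
  transitivity ((2 * x * dot a b - (1 - s ^+ 2) * dot a a - x ^+ 2 * dot b b) / (4 * s ^+ 2)).
    by rewrite /dot /A /B /=; field.
  have -> : 1 - s ^+ 2 = x ^+ 2 by rewrite s2; ring.
  rewrite abm -rp -rq.
  have -> : 2 * x * - m - x ^+ 2 * enorm p - x ^+ 2 * enorm q = - eta * s ^+ 2.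
    transitivity (eta * x ^+ 2 -
      ((eta + enorm p + enorm q) * x ^+ 2 + 2 * m * x)); first by ring.
    by rewrite xE s2; ring.
  by field.
have [z [u [zu zuE]]] := levi_civita_motion P k0 mu0 AB; rewrite k2 in zu.
(* E = e^(k T) and E' = e^(- k T). *)
pose E := (1 + s) / x; pose E' := (1 - s) / x.
have E'0 : 0 < E' by rewrite divr_gt0// subr_gt0.
have E0 : 0 < E by rewrite divr_gt0// addr_gt0.
have EE' : E * E' = 1.
  have -> : E * E' = (1 - s ^+ 2) / x ^+ 2 by rewrite /E /E'; field.
  by rewrite s2; field.
have E1 : 1 < E by rewrite ltr_pdivlMr// mul1r; lra.
pose T0 := ln E / k.
have kT0 : k * T0 = ln E by rewrite mulrC divfK// gt_eqF.
have T00 : 0 < T0 by rewrite divr_gt0// ln_gt0.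
have eT : expR (k * T0) = E by rewrite kT0 lnK.
have eT' : expR (- (k * T0)) = E'.
  by rewrite expRN eT; apply: (mulfI (lt0r_neq0 E0)); rewrite divff ?EE'// gt_eqF.
have T00' : lc_time A B k 0 = 0 by exact: lc_time0.
have AB0 : dot A B < 0 by exact: dotAB_lt0 k0 mu0 AB.
exists z, u, (lc_time A B k T0); split => //.
- by rewrite -T00'; apply: (lc_time_lt k0 mu0 AB).
- have [z0 u0] := zuE 0; rewrite T00' in z0 u0.
  rewrite z0 u0 /lc_pos /lc_vel /lc_radius /lc1 /lc2 /dlc1 /dlc2 mulr0 oppr0 expR0.
  have w1 : A.1 * 1 + B.1 * 1 = a.1 by rewrite /A /B /=; field.
  have w2 : A.2 * 1 + B.2 * 1 = a.2 by rewrite /A /B /=; field.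
  rewrite w1 w2; split; first by rewrite pa.
  have d1 : k * (A.1 * 1 - B.1 * 1) = k * (x * b.1 - a.1) / s.
    by rewrite /A /B /=; field.
  have d2 : k * (A.2 * 1 - B.2 * 1) = k * (x * b.2 - a.2) / s.
    by rewrite /A /B /=; field.
  rewrite d1 d2 /arrival bendC -/eta -/x -/s bisectorC sgE rp.
  have -> : Num.sqrt (2 * h) = 2 * k by rewrite /k; field.
  rewrite pa /dot /= in rp0 *.
  by apply: injective_projections; rewrite /= /GRing.scale /=; field; rewrite s0'.
- have [z0 u0] := zuE T0.
  rewrite z0 u0 /lc_pos /lc_vel /lc_radius /lc1 /lc2 /dlc1 /dlc2 eT eT'.
  have s2' : 1 - s ^+ 2 = x ^+ 2 by rewrite s2; ring.
  have w1 : A.1 * E + B.1 * E' = b.1 by rewrite /A /B /E /E' /=; field; rewrite x0' s0'.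
  have w2 : A.2 * E + B.2 * E' = b.2 by rewrite /A /B /E /E' /=; field; rewrite x0' s0'.
  rewrite w1 w2; split; first by rewrite qb.
  have D (y1 y2 : R) : k * ((x * y2 - (1 - s) * y1) / (2 * s) * E -
      ((1 + s) * y1 - x * y2) / (2 * s) * E') = k * (y2 - x * y1) / s.
    transitivity (k * (x * y2 - (1 - s ^+ 2) * y1) / (s * x)).
      by rewrite /E /E'; field; rewrite x0' s0'.
    by rewrite s2'; field; rewrite x0' s0'.
  have d1 : k * (A.1 * E - B.1 * E') = k * (b.1 - x * a.1) / s by exact: D.
  have d2 : k * (A.2 * E - B.2 * E') = k * (b.2 - x * a.2) / s by exact: D.
  rewrite d1 d2 /arrival -/eta -/x -/s sgE rq.
  have -> : Num.sqrt (2 * h) = 2 * k by rewrite /k; field.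
  rewrite qb /dot /= in rq0 *.
  by apply: injective_projections; rewrite /= /GRing.scale /=; field; rewrite s0'.
- move=> t /andP[t0 tT].
  have [c ct] := lc_time_surj t k0 AB0.
  have c0 : 0 < c by rewrite -(lc_time_ltE k0 mu0 AB) T00' ct.
  have cT : c < T0 by rewrite -(lc_time_ltE k0 mu0 AB) ct.
  pose e := expR (k * c); pose e' := expR (- (k * c)).
  have ee' : e * e' = 1 by exact: expRxMexpNx_1.
  have e1 : 1 < e by rewrite -expR0 ltr_expR mulr_gt0.
  have eE : e < E by rewrite -eT ltr_expR ltr_pM2l.
  have e'0 : 0 < e' by exact: expR_gt0.
  pose l := ((1 + s) * e' - (1 - s) * e) / (2 * s).
  pose n := x * (e - e') / (2 * s).
  exists l, n.
  have l0 : 0 < l.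
    rewrite divr_gt0//; last by rewrite mulr_gt0.
    have -> : (1 + s) * e' - (1 - s) * e = x * (E * e' - E' * e).
      by rewrite /E /E'; field.
    rewrite mulr_gt0// subr_gt0.
    apply: (@lt_trans _ _ 1); first by rewrite -EE' mulrC ltr_pM2r.
    by rewrite -ee' ltr_pM2r.
  have n0 : 0 < n.
    have ee0 : 0 < e - e' by nra.
    by rewrite divr_gt0// mulr_gt0.
  split => //.
  + have S : (e + e') ^+ 2 = 4 + (e - e') ^+ 2.
      by transitivity (4 * (e * e') + (e - e') ^+ 2); [ring | rewrite ee' mulr1].
    transitivity ((s ^+ 2 * (e + e') ^+ 2 - (1 - x ^+ 2) * (e - e') ^+ 2) / (4 * s ^+ 2)).
      by rewrite /l /n; field; rewrite x0' s0'.
    by rewrite -s2 S; field.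
  + rewrite -ct (zuE c).1 /lc_pos /lc1 /lc2 -/e -/e' sgE pa qb /l /n /A /B.
    by apply: injective_projections; rewrite /= /GRing.scale /=; field; rewrite x0' s0'.
Qed.

End KeplerArc.

(** * Uniformly bounded and Lipschitz families *)

Section UniformLipschitz.
Context {R : realType} {H X : Type}.
Variables (W : H -> Prop) (D : X -> Prop) (d : X -> X -> R).
Hypothesis d_ge0 : forall x y, 0 <= d x y.
Implicit Types (f g : H -> X -> R).

(** Families of functions on D, indexed by a parameter h such as the energy,
    with one bound and one Lipschitz constant for the whole family.  This is a
    substitute for C1 estimates that is stable under algebraic operations. *)
Definition ulip f := exists2 K : R, 0 <= K & forall h x y, W h -> D x -> D y ->
  `|f h x| <= K /\ `|f h x - f h y| <= K * d x y.

Lemma ulip_cst (c : H -> R) (K : R) : (forall h, W h -> `|c h| <= K) ->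
  ulip (fun h _ => c h).
Proof.
move=> cK; exists `|K| => // h x y Wh _ _; split.
  by rewrite (le_trans (cK _ Wh))// ler_norm.
by rewrite subrr normr0 mulr_ge0.
Qed.

Lemma ulip_const (c : R) : ulip (fun _ _ => c).
Proof. exact: (ulip_cst (K := `|c|)). Qed.

Lemma ulipD f g : ulip f -> ulip g -> ulip (fun h x => f h x + g h x).
Proof.
move=> [K K0 fK] [L L0 gL]; exists (K + L); first exact: addr_ge0.
move=> h x y Wh Dx Dy; have [f1 f2] := fK h x y Wh Dx Dy.
have [g1 g2] := gL h x y Wh Dx Dy; split.
  by rewrite (le_trans (ler_normD _ _))// lerD.
by rewrite opprD addrACA (le_trans (ler_normD _ _))// mulrDl lerD.
Qed.

Lemma ulipN f : ulip f -> ulip (fun h x => - f h x).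
Proof.
move=> [K K0 fK]; exists K => // h x y Wh Dx Dy.
by have [f1 f2] := fK h x y Wh Dx Dy; rewrite -opprD !normrN.
Qed.

Lemma ulipM f g : ulip f -> ulip g -> ulip (fun h x => f h x * g h x).
Proof.
move=> [K K0 fK] [L L0 gL]; exists (2 * (K * L)); first by rewrite !mulr_ge0.
move=> h x y Wh Dx Dy; have [f1 f2] := fK h x y Wh Dx Dy.
have [g1 g2] := gL h x y Wh Dx Dy; have [g3 _] := gL h y x Wh Dy Dx.
have KL : 0 <= K * L by rewrite mulr_ge0.
split.
  rewrite normrM; apply: (@le_trans _ _ (K * L)); first by rewrite ler_pM.
  by lra.
have -> : f h x * g h x - f h y * g h y =
    f h x * (g h x - g h y) + (f h x - f h y) * g h y by ring.
rewrite (le_trans (ler_normD _ _))// !normrM.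
have -> : 2 * (K * L) * d x y = K * (L * d x y) + (K * d x y) * L by ring.
by rewrite lerD// ler_pM.
Qed.

Lemma ulipX f n : ulip f -> ulip (fun h x => f h x ^+ n).
Proof.
move=> fl; elim: n => [|n IH].
  by under eq_fun do under eq_fun do rewrite expr0; exact: ulip_const.
under eq_fun do under eq_fun do rewrite exprS.
exact: ulipM.
Qed.

(** Division and square root preserve the class on arguments that stay away
    from 0. *)
Lemma ulipV f (r : R) : 0 < r -> (forall h x, W h -> D x -> r <= f h x) ->
  ulip f -> ulip (fun h x => (f h x)^-1).
Proof.
move=> r0 rf [K K0 fK]; exists (r^-1 + r^-1 * r^-1 * K).
  have r0' : 0 <= r^-1 by rewrite invr_ge0 ltW.
  by rewrite addr_ge0// !mulr_ge0.
have r0' : 0 <= r^-1 by rewrite invr_ge0 ltW.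
move=> h x y Wh Dx Dy; have [f1 f2] := fK h x y Wh Dx Dy.
have fx := rf h x Wh Dx; have fy := rf h y Wh Dy.
have fx0 : 0 < f h x by exact: lt_le_trans fx.
have fy0 : 0 < f h y by exact: lt_le_trans fy.
have ix : `|(f h x)^-1| <= r^-1.
  by rewrite gtr0_norm ?invr_gt0// lef_pV2.
have iy : `|(f h y)^-1| <= r^-1.
  by rewrite gtr0_norm ?invr_gt0// lef_pV2.
split; first by rewrite (le_trans ix)// lerDl !mulr_ge0.
have -> : (f h x)^-1 - (f h y)^-1 = - ((f h x)^-1 * (f h y)^-1 * (f h x - f h y)).
  by field; rewrite !gt_eqF.
rewrite normrN normrM normrM mulrDl.
have : 0 <= r^-1 * d x y by rewrite mulr_ge0.
suff : `|(f h x)^-1| * `|(f h y)^-1| * `|f h x - f h y| <= r^-1 * r^-1 * K * d x y by lra.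
rewrite -[leRHS]mulrA ler_pM// ?mulr_ge0//; by rewrite ler_pM.
Qed.

Lemma ulip_sqrt f (r : R) : 0 < r -> (forall h x, W h -> D x -> r <= f h x) ->
  ulip f -> ulip (fun h x => Num.sqrt (f h x)).
Proof.
move=> r0 rf [K K0 fK]; pose s := Num.sqrt r.
have s0 : 0 < s by rewrite sqrtr_gt0.
exists (1 + K + s^-1 * K).
  by rewrite !addr_ge0// mulr_ge0// invr_ge0 ltW.
move=> h x y Wh Dx Dy; have [f1 f2] := fK h x y Wh Dx Dy.
have fx := rf h x Wh Dx; have fy := rf h y Wh Dy.
have fx0 : 0 < f h x by exact: lt_le_trans fx.
have fy0 : 0 < f h y by exact: lt_le_trans fy.
pose a := Num.sqrt (f h x); pose b := Num.sqrt (f h y).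
have a2 : a ^+ 2 = f h x by rewrite sqr_sqrtr// ltW.
have b2 : b ^+ 2 = f h y by rewrite sqr_sqrtr// ltW.
have sa : s <= a by rewrite ler_wsqrtr.
have b0 : 0 <= b by exact: sqrtr_ge0.
have sK : 0 <= s^-1 * K by rewrite mulr_ge0// invr_ge0 ltW.
have fxK := le_trans (ler_norm _) f1.
split; rewrite -/a -/b.
  rewrite ger0_norm; last exact: le_trans (ltW s0) sa.
  by nra.
have ab : `|a - b| * (a + b) = `|f h x - f h y|.
  have ab0 : 0 <= a + b by rewrite addr_ge0// (le_trans (ltW s0)).
  by rewrite -a2 -b2 subr_sqr normrM (ger0_norm ab0).
have h1 : `|a - b| * s <= K * d x y.
  apply: le_trans f2; rewrite -ab ler_wpM2l//.
  by rewrite (le_trans sa)// lerDl.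
have h2 : `|a - b| <= s^-1 * K * d x y.
  by rewrite -mulrA mulrC ler_pdivlMr.
apply: (le_trans h2); rewrite ler_wpM2r//.
by rewrite lerDr addr_ge0.
Qed.

End UniformLipschitz.

(** * Uniqueness of motions and of arcs *)

Section RealLine.
Context {R : realType}.
Implicit Types (f : R -> R) (t : R).

Lemma near_ballP (t : R) (Q : R -> Prop) : (\forall x \near t, Q x) ->
  exists2 e : R, 0 < e & forall x, `|x - t| < e -> Q x.
Proof.
move=> /nbhs_ex[e eQ]; exists e%:num => // x xt; apply: eQ.
by rewrite -ball_normE /= distrC.
Qed.

Lemma left_limit_zero f s t : s < t -> {for t, continuous f} ->
  (forall x, s <= x < t -> f x = 0) -> f t = 0.
Proof.
move=> st fc f0; apply: contrapT => /eqP ft0.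
have [e e0 fe] := near_ballP (cvgr_neq0 _ fc ft0).
pose x := Num.max s (t - e / 2).
have xt : x < t by rewrite gt_max st ltrBlDr ltrDl divr_gt0.
have sx : s <= x by rewrite le_max lexx.
have ex : t - e / 2 <= x by rewrite le_max lexx orbT.
suff /fe/eqP : `|x - t| < e by apply; apply: f0; rewrite sx.
by rewrite distrC ger0_norm; lra.
Qed.

Lemma left_derivative_zero f s t a : s < t -> is_derive t 1 f a ->
  (forall x, s <= x <= t -> f x = 0) -> a = 0.
Proof.
move=> st /is_derive1_caratheodory[g [gE gc <-]] f0.
apply: (left_limit_zero st gc) => x /andP[sx xt].
have := gE x; rewrite !f0 ?sx ?(ltW xt) ?lexx ?(ltW st)// subrr => /esym/eqP.
by rewrite mulf_eq0 subr_eq0 (lt_eqF xt) orbF => /eqP.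
Qed.

(** G (y) e^(- K y) is nonincreasing, so it cannot leave 0 upwards. *)
Lemma gronwall_zero (G G' : R -> R) (K s t : R) :
  (forall x, s <= x <= t -> is_derive x 1 G (G' x)) ->
  (forall x, s <= x <= t -> G' x <= K * G x) ->
  (forall x, 0 <= G x) -> G s = 0 -> forall x, s <= x <= t -> G x = 0.
Proof.
move=> dG GK G0 Gs x /andP[]; rewrite le_eqVlt => /orP[/eqP <- //|sx] xt.
pose F y := G y * expR (- (K * y)).
have dF y : s <= y <= t ->
    is_derive y 1 F ((G' y - K * G y) * expR (- (K * y))).
  by move=> /dG dGy; rewrite /F; deriv; ring.
have dF' y : y \in `]s, x[ ->
    is_derive y 1 F ((G' y - K * G y) * expR (- (K * y))).
  rewrite in_itv /= => /andP[sy yx].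
  by apply: dF; rewrite (ltW sy) (le_trans (ltW yx)).
have Fc : {within `[s, x], continuous F}.
  apply: continuous_in_subspaceT => y; rewrite inE /= in_itv /= => /andP[sy yx].
  by apply: (is_derive_continuous (dF y _)); rewrite sy (le_trans yx).
have [c] := MVT sx dF' Fc; rewrite in_itv /= => /andP[sc cx] Fx.
have : F x <= 0.
  have -> : F x = F x - F s by rewrite /F Gs mul0r subr0.
  rewrite Fx pmulr_lle0 ?subr_gt0// pmulr_lle0 ?expR_gt0// subr_le0 GK//.
  by rewrite (ltW sc) (le_trans (ltW cx)).
rewrite /F pmulr_lle0 ?expR_gt0// => Gx.
by apply/eqP; rewrite eq_le Gx G0.
Qed.

End RealLine.

Section Uniqueness.
Context {R : realType}.
Implicit Types (P x y : R * R) (z u : R -> R * R) (r M t : R).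

Definition dist1 x y : R := `|x.1 - y.1| + `|x.2 - y.2|.

Lemma dist1_ge0 x y : 0 <= dist1 x y. Proof. by rewrite addr_ge0. Qed.

Lemma ulip_proj {H : Type} (W : H -> Prop) (D : R * R -> Prop) M :
  0 <= M -> (forall x, D x -> `|x.1| <= M /\ `|x.2| <= M) ->
  ulip W D dist1 (fun _ x => x.1) /\ ulip W D dist1 (fun _ x => x.2).
Proof.
move=> M0 DM; split; exists (M + 1); rewrite ?addr_ge0// => _ x y _ Dx _.
  split; first by rewrite (le_trans (DM x Dx).1)// lerDl.
  rewrite mulrDl mul1r (le_trans (_ : _ <= dist1 x y)) ?lerDl ?lerDr//.
  by rewrite mulr_ge0// dist1_ge0.
split; first by rewrite (le_trans (DM x Dx).2)// lerDl.
rewrite mulrDl mul1r (le_trans (_ : _ <= dist1 x y)) ?lerDl ?lerDr//.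
by rewrite mulr_ge0// dist1_ge0.
Qed.

Lemma kepler_force_lipschitz mu r M : 0 < r -> 0 <= M ->
  exists2 L, 0 <= L & forall x y,
    (r <= dot x x /\ (`|x.1| <= M /\ `|x.2| <= M)) ->
    (r <= dot y y /\ (`|y.1| <= M /\ `|y.2| <= M)) ->
    `|- (mu / enorm x ^+ 3) * x.1 - - (mu / enorm y ^+ 3) * y.1| <= L * dist1 x y /\
    `|- (mu / enorm x ^+ 3) * x.2 - - (mu / enorm y ^+ 3) * y.2| <= L * dist1 x y.
Proof.
move=> r0 M0; pose W (_ : unit) := True.
pose D x := r <= dot x x /\ (`|x.1| <= M /\ `|x.2| <= M).
have [p1 p2] := ulip_proj W M0 (fun x (Dx : D x) => Dx.2).
have d0 := @dist1_ge0.
have fl : ulip W D dist1 (fun _ x => - (mu / enorm x ^+ 3)).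
  apply: ulipN => //; apply: ulipM => //; first exact: ulip_const.
  apply: (@ulipV _ _ _ _ _ _ _ _ (Num.sqrt r ^+ 3)) => //.
  - by rewrite exprn_gt0// sqrtr_gt0.
  - move=> _ x _ [rx _]; rewrite lerXn2r ?nnegrE ?sqrtr_ge0//.
    by rewrite ler_wsqrtr.
  - apply: ulipX => //; apply: (@ulip_sqrt _ _ _ _ _ _ _ _ r) => //.
      by move=> _ x _ [].
    by rewrite /dot; apply: ulipD => //; exact: ulipM.
have [L L0 HL] := ulipM fl p1; have [L' L'0 HL'] := ulipM fl p2.
exists (L + L') => [|x y Dx Dy]; first exact: addr_ge0.
split.
  rewrite (le_trans (HL tt x y I Dx Dy).2)// ler_wpM2r ?dist1_ge0//.
  by rewrite lerDl.
rewrite (le_trans (HL' tt x y I Dx Dy).2)// ler_wpM2r ?dist1_ge0//.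
by rewrite lerDr.
Qed.

(** Gronwall's argument for G = |z - z'| ^ 2 + |u - u'| ^ 2, which satisfies
    G' <= (1 + 4 L) G as long as both motions stay where the force has the
    Lipschitz constant L. *)
Lemma inner_motion_local_unique mu hI P z u z' u' t :
  inner_motion mu hI P z u -> inner_motion mu hI P z' u' ->
  z t != P -> z t = z' t -> u t = u' t ->
  exists2 e : R, 0 < e & forall s, t <= s <= t + e -> z s = z' s.
Proof.
move=> [zc zN _] [zc' zN' _] zP zz uu.
have d0 : 0 < dot (z t - P) (z t - P) by rewrite dot_gt0// subr_eq0.
pose r := dot (z t - P) (z t - P) / 2; have r0 : 0 < r by rewrite divr_gt0.
pose M := `|(z t - P).1| + `|(z t - P).2| + 1.
have M0 : 0 <= M by rewrite !addr_ge0.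
have near_ok (y : R -> R * R) : continuous y -> y t = z t ->
    \forall s \near t, r <= dot (y s - P) (y s - P) /\
      (`|(y s - P).1| <= M /\ `|(y s - P).2| <= M).
  move=> yc yt.
  have c1 : {for t, continuous (fun s => (y s - P).1)}.
    by apply: cvgB (cvg_cst _); exact: (continuous_cvg (h := fst) _ cvg_fst (yc t)).
  have c2 : {for t, continuous (fun s => (y s - P).2)}.
    by apply: cvgB (cvg_cst _); exact: (continuous_cvg (h := snd) _ cvg_snd (yc t)).
  have cd : {for t, continuous (fun s => dot (y s - P) (y s - P))}.
    by rewrite /dot; apply: cvgD; apply: cvgM.
  have n1 : {for t, continuous (fun s => `|(y s - P).1|)} by exact: cvg_norm c1.
  have n2 : {for t, continuous (fun s => `|(y s - P).2|)} by exact: cvg_norm c2.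
  have hd : r < dot (y t - P) (y t - P) by rewrite yt /r; lra.
  have h1 : `|(y t - P).1| < M.
    by rewrite yt /M -addrA ltrDl ltr_wpDl.
  have h2 : `|(y t - P).2| < M.
    by rewrite yt /M addrAC ltrDr ltr_wpDl.
  near=> s; split; last split; apply: ltW; near: s.
  - exact: cvgr_gt cd _ hd.
  - exact: cvgr_lt n1 _ h1.
  - exact: cvgr_lt n2 _ h2.
have [e1 e10 ok1] := near_ballP (near_ok z zc erefl).
have [e2 e20 ok2] := near_ballP (near_ok z' zc' (esym zz)).
have [L L0 HL] := kepler_force_lipschitz mu r0 M0.
pose e := Num.min e1 e2 / 2.
have e0 : 0 < e by rewrite divr_gt0// lt_min e10.
exists e => //.
have ok s : t <= s <= t + e ->
    (r <= dot (z s - P) (z s - P) /\ (`|(z s - P).1| <= M /\ `|(z s - P).2| <= M)) /\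
    (r <= dot (z' s - P) (z' s - P) /\ (`|(z' s - P).1| <= M /\ `|(z' s - P).2| <= M)).
  move=> /andP[ts se].
  have b : `|s - t| < Num.min e1 e2.
    have : 0 < Num.min e1 e2 by rewrite lt_min e10.
    by rewrite ger0_norm ?subr_ge0// /e in se *; lra.
  by move: b; rewrite lt_min => /andP[b1 b2]; split; [exact: ok1 | exact: ok2].
have neP y : r <= dot (y - P) (y - P) -> y != P.
  move=> ry; apply/eqP => yP; move: ry.
  by rewrite yP subrr /dot /= mulr0 addr0 leNgt r0.
pose G s := ((z s).1 - (z' s).1) ^+ 2 + ((z s).2 - (z' s).2) ^+ 2 +
  (((u s).1 - (u' s).1) ^+ 2 + ((u s).2 - (u' s).2) ^+ 2).
pose F (y : R * R) := - (mu / enorm (y - P) ^+ 3).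
pose G' s := 2 * ((z s).1 - (z' s).1) * ((u s).1 - (u' s).1) +
  2 * ((z s).2 - (z' s).2) * ((u s).2 - (u' s).2) +
  (2 * ((u s).1 - (u' s).1) * (F (z s) * (z s - P).1 - F (z' s) * (z' s - P).1) +
   2 * ((u s).2 - (u' s).2) * (F (z s) * (z s - P).2 - F (z' s) * (z' s - P).2)).
have dG s : t <= s <= t + e -> is_derive s 1 G (G' s).
  move=> /ok[[rz _] [rz' _]].
  have /eqP nz := neP _ rz; have /eqP nz' := neP _ rz'.
  have [dz du _] := zN s nz; have [dz' du' _] := zN' s nz'.
  rewrite !grad_V_inner in du du'; try exact/eqP.
  move/is_derive_pairP: dz => [? ?]; move/is_derive_pairP: dz' => [? ?].
  move/is_derive_pairP: du => [? ?]; move/is_derive_pairP: du' => [? ?].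
  rewrite /G; deriv; rewrite /G' /F /= !scaleRE; ring.
have GK s : t <= s <= t + e -> G' s <= (1 + 4 * L) * G s.
  move=> /ok[q1 q2].
  pose a := F (z s) * (z s - P).1 - F (z' s) * (z' s - P).1.
  pose a' := F (z s) * (z s - P).2 - F (z' s) * (z' s - P).2.
  pose b := (z s).1 - (z' s).1; pose c := (z s).2 - (z' s).2.
  pose v := (u s).1 - (u' s).1; pose w := (u s).2 - (u' s).2.
  have [h1 h2] : `|a| <= L * (`|b| + `|c|) /\ `|a'| <= L * (`|b| + `|c|).
    have := HL _ _ q1 q2; have trE (x y o : R) : x - o - (y - o) = x - y by ring.
    by rewrite /dist1 /= !trE.
  rewrite /G' /G -/a -/a' -/b -/c -/v -/w.
  have va : v * a <= `|v| * (L * (`|b| + `|c|)).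
    by rewrite (le_trans (ler_norm _))// normrM ler_wpM2l.
  have wa : w * a' <= `|w| * (L * (`|b| + `|c|)).
    by rewrite (le_trans (ler_norm _))// normrM ler_wpM2l.
  rewrite -(real_normK (num_real b)) -(real_normK (num_real c))
    -(real_normK (num_real v)) -(real_normK (num_real w)).
  have bv : b * v <= `|b| * `|v| by rewrite -normrM ler_norm.
  have cw : c * w <= `|c| * `|w| by rewrite -normrM ler_norm.
  move: {h1 h2} va wa bv cw.
  move: (normr_ge0 b) (normr_ge0 c) (normr_ge0 v) (normr_ge0 w).
  move: `|b| `|c| `|v| `|w| => B C V X B0 C0 V0 X0 va wa bv cw.
  have k1 := mulr_ge0 L0 (sqr_ge0 (V - B)).
  have k2 := mulr_ge0 L0 (sqr_ge0 (V - C)).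
  have k3 := mulr_ge0 L0 (sqr_ge0 (X - B)).
  have k4 := mulr_ge0 L0 (sqr_ge0 (X - C)).
  have k5 := sqr_ge0 (B - V); have k6 := sqr_ge0 (C - X).
  have l1 := mulr_ge0 L0 (sqr_ge0 B); have l2 := mulr_ge0 L0 (sqr_ge0 C).
  have l3 := mulr_ge0 L0 (sqr_ge0 V); have l4 := mulr_ge0 L0 (sqr_ge0 X).
  lra.
have G0 s : 0 <= G s by rewrite !addr_ge0 ?sqr_ge0.
have Gt : G t = 0 by rewrite /G zz uu !subrr expr0n /= !addr0.
move=> s /(gronwall_zero dG GK G0 Gt) /eqP.
rewrite /G paddr_eq0 ?addr_ge0 ?sqr_ge0// => /andP[+ _].
rewrite paddr_eq0 ?sqr_ge0// !sqrf_eq0 !subr_eq0 => /andP[/eqP ? /eqP ?].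
exact: injective_projections.
Unshelve. all: by end_near. Qed.

End Uniqueness.

Section ArcUniqueness.
Context {R : realType}.
Implicit Types (P p q v w : R * R) (z u : R -> R * R) (t : R).

Lemma left_eq z z' s t : s < t -> continuous z -> continuous z' ->
  (forall x, s <= x < t -> z x = z' x) -> z t = z' t.
Proof.
move=> st zc zc' zz; apply: injective_projections; apply/eqP; rewrite -subr_eq0;
  apply/eqP.
- apply: (left_limit_zero (f := fun x => (z x).1 - (z' x).1) st).
    by apply: cvgB; [exact: (continuous_cvg (h := fst) _ cvg_fst (zc t))|
                     exact: (continuous_cvg (h := fst) _ cvg_fst (zc' t))].
  by move=> x /zz ->; rewrite subrr.
- apply: (left_limit_zero (f := fun x => (z x).2 - (z' x).2) st).
    by apply: cvgB; [exact: (continuous_cvg (h := snd) _ cvg_snd (zc t))|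
                     exact: (continuous_cvg (h := snd) _ cvg_snd (zc' t))].
  by move=> x /zz ->; rewrite subrr.
Qed.

Lemma left_velocity_eq z z' u u' s t : s < t ->
  is_derive t 1 z (u t) -> is_derive t 1 z' (u' t) ->
  (forall x, s <= x <= t -> z x = z' x) -> u t = u' t.
Proof.
move=> st /is_derive_pairP[z1 z2] /is_derive_pairP[z1' z2'] zz.
apply: injective_projections; apply/eqP; rewrite -subr_eq0; apply/eqP.
- have d : is_derive t 1 (fun x => (z x).1 - (z' x).1) ((u t).1 - (u' t).1).
    by deriv.
  by apply: (left_derivative_zero st d) => x /zz ->; rewrite subrr.
- have d : is_derive t 1 (fun x => (z x).2 - (z' x).2) ((u t).2 - (u' t).2).
    by deriv.
  by apply: (left_derivative_zero st d) => x /zz ->; rewrite subrr.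
Qed.

(** The motions agree up to a supremum c, by continuity also at c.  Off the mass,
    local uniqueness continues the agreement past c.  At a collision it is the
    reflection clause that does so: it determines the motion on [c, 2 c] by the
    motion on [0, c]. *)
Lemma inner_motion_unique mu hI P z u z' u' :
  inner_motion mu hI P z u -> inner_motion mu hI P z' u' ->
  z 0 != P -> z 0 = z' 0 -> u 0 = u' 0 -> forall t, 0 <= t -> z t = z' t.
Proof.
move=> m m' zP z0 u0; have [zc zN zR] := m; have [zc' zN' zR'] := m'.
pose agree t := forall s, 0 <= s <= t -> z s = z' s.
have ext t : 0 <= t -> agree t -> exists2 e : R, 0 < e & agree (t + e).
  move=> t0 ag; have zt : z t = z' t by apply: ag; rewrite t0 lexx.
  have [tP|tP] := eqVneq (z t) P.
    have t0' : 0 < t.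
      by rewrite lt_neqAle t0 andbT; apply: contraNneq zP => ->; exact/eqP.
    exists t => // s /andP[s0 st].
    have [lst|lst] := leP s t; first by apply: ag; rewrite s0.
    have -> : s = t + (s - t) by ring.
    rewrite zR// zR' -?zt//; apply: ag; lra.
  have ut : u t = u' t.
    move: t0; rewrite le_eqVlt => /orP[/eqP <- //|t0].
    have [d1 _ _] := zN t (elimN eqP tP).
    have [d2 _ _] : newton_at (V_inner mu hI P) z' u' t.
      by apply: zN'; rewrite -zt; exact/eqP.
    exact: left_velocity_eq t0 d1 d2 ag.
  have [e e0 E] := inner_motion_local_unique m m' tP zt ut.
  exists e => // s /andP[s0 st].
  have [lst|lst] := leP s t; first by apply: ag; rewrite s0.
  by apply: E; rewrite (ltW lst).
move=> t1 t10; apply: contrapT => zt1.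
pose S := [set t : R | 0 <= t <= t1 /\ agree t].
have S0 : S 0.
  by split; rewrite ?lexx// => s; rewrite -eq_le => /eqP <-.
have Sub : ubound S t1 by move=> s [/andP[_ ?] _].
have Ss : has_sup S by split; [exists 0 | exists t1].
pose c := sup S.
have c0 : 0 <= c by exact: sup_upper_bound.
have ct : c <= t1 by apply: ge_sup => //; exists 0.
have agc : agree c.
  move=> s /andP[s0]; rewrite le_eqVlt => /orP[/eqP ->|sc].
    move: c0; rewrite le_eqVlt => /orP[/eqP <- //|c0].
    apply: (left_eq c0 zc zc') => x /andP[x0 xc].
    have [y [_ ag] xy] := sup_gt (ex_intro _ 0 S0) xc.
    by apply: ag; rewrite x0 ltW.
  have [y [_ ag] xy] := sup_gt (ex_intro _ 0 S0) sc.
  by apply: ag; rewrite s0 ltW.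
have [e e0 age] := ext c c0 agc.
have ct' : c < t1.
  rewrite lt_neqAle ct andbT; apply/eqP => c1; apply: zt1; apply: agc.
  by rewrite c1 t10 lexx.
pose y := Num.min (c + e) t1.
have Sy : S y.
  split; first by rewrite le_min ge_min t10 lexx orbT addr_ge0// ltW.
  move=> s /andP[s0]; rewrite le_min => /andP[sy _].
  by apply: age; rewrite s0.
have := sup_upper_bound Ss Sy; rewrite -/c leNgt /y lt_min ct' andbT.
by rewrite ltrDl e0.
Qed.

(** The energy of the difference of two solutions of the harmonic equation is
    conserved. *)
Lemma outer_motion_unique (omega hE : R) P z u z' u' : omega != 0 ->
  outer_motion omega hE P z u -> outer_motion omega hE P z' u' ->
  z 0 = z' 0 -> u 0 = u' 0 -> forall t, z t = z' t.
Proof.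
move=> o0 m m' z0 u0 t.
pose G s := omega ^+ 2 * (((z s).1 - (z' s).1) ^+ 2 + ((z s).2 - (z' s).2) ^+ 2) +
  (((u s).1 - (u' s).1) ^+ 2 + ((u s).2 - (u' s).2) ^+ 2).
have dG (s : R) : is_derive s 1 G 0.
  have [dz du _] := m s; have [dz' du' _] := m' s.
  rewrite !grad_V_outer in du du'.
  move/is_derive_pairP: dz => [? ?]; move/is_derive_pairP: dz' => [? ?].
  move/is_derive_pairP: du => [? ?]; move/is_derive_pairP: du' => [? ?].
  rewrite /G; deriv; rewrite /= !scaleRE; ring.
have /eqP : G t = 0.
  rewrite (is_derive_0_is_cst t 0 dG) /G z0 u0 !subrr expr0n /=.
  by rewrite !addr0 mulr0.
have o2 : 0 < omega ^+ 2 by rewrite exprn_even_gt0.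
have H x y : 0 <= x ^+ 2 + y ^+ 2 :> R by rewrite addr_ge0 ?sqr_ge0.
have H2 x y : 0 <= omega ^+ 2 * (x ^+ 2 + y ^+ 2).
  by apply: mulr_ge0 => //; exact: ltW.
rewrite /G paddr_eq0// => /andP[+ _].
rewrite mulf_eq0 (gt_eqF o2) /= paddr_eq0 ?sqr_ge0// !sqrf_eq0 !subr_eq0.
by move=> /andP[/eqP ? /eqP ?]; exact: injective_projections.
Qed.

(** Two arcs of the same motion end at the same time, for before its end an arc
    stays off B.  The final velocities agree as derivatives of the same curve. *)
Lemma arc_unique (motion : (R -> R * R) -> (R -> R * R) -> Prop)
    (Omega B : set (R * R)) p v q w q' w' :
  (forall z u z' u', motion z u -> motion z' u' -> z 0 = p -> z 0 = z' 0 ->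
     u 0 = u' 0 -> forall t, 0 <= t -> z t = z' t) ->
  (forall z u t, motion z u -> B (z t) -> is_derive t 1 z (u t)) ->
  (forall x, Omega x -> ~ B x) ->
  Defs.arc motion Omega B p v q w -> Defs.arc motion Omega B p v q' w' -> q = q' /\ w = w'.
Proof.
move=> uniq vel disj [z [u [T [m [z0 u0] T0 zO [zB zq uw]]]]].
move=> [z' [u' [T' [m' [z0' u0'] T0' zO' [zB' zq' uw']]]]].
have E : forall t, 0 <= t -> z t = z' t.
  by apply: (uniq z u z' u') => //; [rewrite z0 z0' | rewrite u0 u0'].
have TT : T = T'.
  have [lt|lt|//] := ltgtP T T'.
    by have := disj _ (zO' T _); rewrite T0 lt -E ?(ltW T0)// => /(_ isT) [].
  by have := disj _ (zO T' _); rewrite T0' lt E ?(ltW T0')// => /(_ isT) [].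
subst T'; split; first by rewrite -zq -zq' E// ltW.
have d := vel z u T m zB; have d' := vel z' u' T m' zB'.
have d2 : is_derive T 1 z' (u T).
  apply: near_eq_is_derive d.
  have : \forall t \near T, 0 < t by exact: lt_nbhsr.
  by apply: filterS => t /ltW /E.
by rewrite -uw -uw'; case: d2 => _ <-; case: d' => _ <-.
Qed.

End ArcUniqueness.

(** * The ellipse seen from the mass *)

Section EllipseGeometry.
Context {R : realType}.
Variables (E : ellipse R) (P : R * R).
Let a := semi_major E.
Let b := semi_minor E.
Hypotheses (a_gt0 : 0 < a) (b_gt0 : 0 < b).
Implicit Types (x y z p q : R * R) (c s X Y : R).

Definition frame X Y : R * R := X *: major_dir E + Y *: minor_dir E.
Definition xcoord y : R := dot y (major_dir E).
Definition ycoord y : R := dot y (minor_dir E).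

Let u := xcoord (P - centre E).
Let v := ycoord (P - centre E).

(** A point of the ellipse is given by the cosine c and the sine s of its
    eccentric anomaly, and by its position relative to P; bnormal is an outward
    normal there, and btangent the derivative of bpoint in the anomaly. *)
Definition bpoint c s := frame (a * c - u) (b * s - v).
Definition bnormal c s := frame (c / a) (s / b).
Definition btangent c s := frame (- (a * s)) (b * c).

Lemma cos2sin2 : cos (tilt E) ^+ 2 + sin (tilt E) ^+ 2 = 1.
Proof. exact: cos2Dsin2. Qed.

Lemma frame_coord y : y = frame (xcoord y) (ycoord y).
Proof.
have e := cos2sin2.
rewrite /frame /xcoord /ycoord /major_dir /minor_dir /rot /dot.
apply: injective_projections; rewrite /= !scaleRE ?mulr0 ?mulr1 ?subr0 ?addr0 ?sub0r ?add0r.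
  by rewrite -[LHS]mulr1 -e; ring.
by rewrite -[LHS]mulr1 -e; ring.
Qed.

Lemma xcoord_frame X Y : xcoord (frame X Y) = X.
Proof.
have e := cos2sin2.
rewrite /frame /xcoord /major_dir /minor_dir /rot /dot /= !scaleRE.
transitivity (X * (cos (tilt E) ^+ 2 + sin (tilt E) ^+ 2)); first by ring.
by rewrite e mulr1.
Qed.

Lemma ycoord_frame X Y : ycoord (frame X Y) = Y.
Proof.
have e := cos2sin2.
rewrite /frame /ycoord /major_dir /minor_dir /rot /dot /= !scaleRE.
transitivity (Y * (cos (tilt E) ^+ 2 + sin (tilt E) ^+ 2)); first by ring.
by rewrite e mulr1.
Qed.

Lemma dot_frame X Y X' Y' : dot (frame X Y) (frame X' Y') = X * X' + Y * Y'.
Proof.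
have e := cos2sin2.
rewrite /frame /major_dir /minor_dir /rot /dot /= !scaleRE.
transitivity ((X * X' + Y * Y') * (cos (tilt E) ^+ 2 + sin (tilt E) ^+ 2)).
  by ring.
by rewrite e mulr1.
Qed.

Lemma frameD X Y X' Y' : frame X Y + frame X' Y' = frame (X + X') (Y + Y').
Proof. by rewrite /frame; apply: injective_projections; rewrite /= !scaleRE; ring. Qed.

Lemma frameZ c X Y : c *: frame X Y = frame (c * X) (c * Y).
Proof. by rewrite /frame; apply: injective_projections; rewrite /= !scaleRE; ring. Qed.

Lemma frame_inj X Y X' Y' : frame X Y = frame X' Y' -> X = X' /\ Y = Y'.
Proof.
move=> e; have := congr1 xcoord e; have := congr1 ycoord e.
by rewrite !xcoord_frame !ycoord_frame.
Qed.

Definition form_at X Y : R := ((u + X) / a) ^+ 2 + ((v + Y) / b) ^+ 2.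

Lemma ellipse_form_frame X Y : ellipse_form E (P + frame X Y) = form_at X Y.
Proof.
rewrite /ellipse_form /form_at -/a -/b /u /v.
have -> : P + frame X Y - centre E = (P - centre E) + frame X Y by rewrite addrAC.
have e1 : dot (P - centre E + frame X Y) (major_dir E) = xcoord (P - centre E) + X.
  by rewrite -[in RHS](xcoord_frame X Y) /xcoord /dot /=; ring.
have e2 : dot (P - centre E + frame X Y) (minor_dir E) = ycoord (P - centre E) + Y.
  by rewrite -[in RHS](ycoord_frame X Y) /ycoord /dot /=; ring.
by rewrite e1 e2.
Qed.

Lemma boundaryP z : elliptic_boundary E z <->
  exists c s, c ^+ 2 + s ^+ 2 = 1 /\ z = P + bpoint c s.
Proof.
rewrite /elliptic_boundary /=.
have zE : z = P + frame (xcoord (z - P)) (ycoord (z - P)).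
  by rewrite -frame_coord addrC subrK.
split=> [|[c [s [cs ->]]]]; last first.
  rewrite ellipse_form_frame /form_at -cs; field.
  by rewrite !gt_eqF.
rewrite {1}zE ellipse_form_frame => e.
exists ((u + xcoord (z - P)) / a), ((v + ycoord (z - P)) / b); split => //.
rewrite {1}zE; congr (_ + frame _ _); field; by rewrite gt_eqF.
Qed.

Lemma grad_ellipse_form c s : c ^+ 2 + s ^+ 2 = 1 ->
  grad (ellipse_form E) (P + bpoint c s) = 2 *: bnormal c s.
Proof.
move=> cs; have zE : P + bpoint c s - centre E = frame (a * c) (b * s).
  rewrite addrAC [P - _]frame_coord frameD; congr frame; rewrite -/u -/v; ring.
have -> w : grad (ellipse_form E) w =
    (2 * xcoord (w - centre E) / a ^+ 2) *: major_dir E +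
    (2 * ycoord (w - centre E) / b ^+ 2) *: minor_dir E.
  apply: gradE; rewrite /ellipse_form /dot /= -/a -/b; deriv;
  rewrite /xcoord /ycoord /dot /= ?scaleRE; field; by rewrite !gt_eqF.
rewrite zE xcoord_frame ycoord_frame /bnormal frameZ /frame.
by congr (_ *: _ + _ *: _); field; rewrite gt_eqF.
Qed.

Hypothesis P_in : elliptic_domain E P.

Lemma P_coords : (u / a) ^+ 2 + (v / b) ^+ 2 < 1.
Proof. exact: P_in. Qed.

(** P lies strictly on the inner side of every tangent line. *)
Lemma bnormal_bpoint_gt0 c s : c ^+ 2 + s ^+ 2 = 1 -> 0 < dot (bnormal c s) (bpoint c s).
Proof.
move=> cs; rewrite dot_frame.
have -> : c / a * (a * c - u) + s / b * (b * s - v) =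
    (c ^+ 2 + s ^+ 2) - (c * (u / a) + s * (v / b)) by field; rewrite !gt_eqF.
have := P_coords; rewrite cs; move: (u / a) (v / b) => U V UV.
have := sqr_ge0 (c - U); have := sqr_ge0 (s - V); nra.
Qed.

Lemma bpoint_neq0 c s : c ^+ 2 + s ^+ 2 = 1 -> bpoint c s != 0.
Proof.
move=> /bnormal_bpoint_gt0; apply: contraTneq => ->.
by rewrite /dot /= !mulr0 addr0 ltxx.
Qed.

Lemma bnormal_neq0 c s : c ^+ 2 + s ^+ 2 = 1 -> bnormal c s != 0.
Proof.
move=> /bnormal_bpoint_gt0; apply: contraTneq => ->.
by rewrite /dot /= !mul0r addr0 ltxx.
Qed.

(** A convex combination that charges an interior point is interior; this
    keeps inner arcs in the domain. *)
Lemma domain_convex c s c' s' (l n k : R) y :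
  c ^+ 2 + s ^+ 2 = 1 -> c' ^+ 2 + s' ^+ 2 = 1 ->
  0 <= l -> 0 <= n -> 0 < k -> l + n + k = 1 -> elliptic_domain E (P + y) ->
  elliptic_domain E (P + (l *: bpoint c s + n *: bpoint c' s' + k *: y)).
Proof.
move=> cs cs' l0 n0 k0 lnk; rewrite (frame_coord y) /elliptic_domain /=.
rewrite !frameZ !frameD !ellipse_form_frame /form_at.
move: (xcoord y) (ycoord y) => X Y yD.
have q (A B C : R) : (l * A + n * B + k * C) ^+ 2 <=
    l * A ^+ 2 + n * B ^+ 2 + k * C ^+ 2.
  have -> : l * A ^+ 2 + n * B ^+ 2 + k * C ^+ 2 =
    (l * A ^+ 2 + n * B ^+ 2 + k * C ^+ 2) * (l + n + k) by rewrite lnk mulr1.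
  have h1 := mulr_ge0 (mulr_ge0 l0 n0) (sqr_ge0 (A - B)).
  have h2 := mulr_ge0 (mulr_ge0 l0 (ltW k0)) (sqr_ge0 (A - C)).
  have h3 := mulr_ge0 (mulr_ge0 n0 (ltW k0)) (sqr_ge0 (B - C)).
  lra.
have e1 : (u + (l * (a * c - u) + n * (a * c' - u) + k * X)) / a =
    l * c + n * c' + k * ((u + X) / a).
  have -> : u + (l * (a * c - u) + n * (a * c' - u) + k * X) =
     u * (1 - (l + n + k)) + a * (l * c + n * c') + k * (u + X) by ring.
  by rewrite lnk; field; rewrite gt_eqF.
have e2 : (v + (l * (b * s - v) + n * (b * s' - v) + k * Y)) / b =
    l * s + n * s' + k * ((v + Y) / b).
  have -> : v + (l * (b * s - v) + n * (b * s' - v) + k * Y) =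
     v * (1 - (l + n + k)) + b * (l * s + n * s') + k * (v + Y) by ring.
  by rewrite lnk; field; rewrite gt_eqF.
rewrite e1 e2.
have := q c c' ((u + X) / a); have := q s s' ((v + Y) / b).
move: ((u + X) / a) ((v + Y) / b) yD => U V yD; nra.
Qed.

(** By convexity, the half-plane beyond a tangent line is outside the ellipse;
    this keeps outer arcs out of the domain. *)
Lemma outside_tangent c s y : c ^+ 2 + s ^+ 2 = 1 ->
  0 < dot (bnormal c s) (y - bpoint c s) -> 1 < ellipse_form E (P + y).
Proof.
move=> cs; rewrite (frame_coord y); move: (xcoord y) (ycoord y) => X Y.
have -> : frame X Y - bpoint c s = frame (u + X - a * c) (v + Y - b * s).
  rewrite /bpoint -scaleN1r frameZ frameD; congr frame; ring.
rewrite dot_frame ellipse_form_frame /form_at.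
have -> : c / a * (u + X - a * c) + s / b * (v + Y - b * s) =
  c * ((u + X) / a) + s * ((v + Y) / b) - (c ^+ 2 + s ^+ 2) by field; rewrite !gt_eqF.
rewrite cs; move: ((u + X) / a) ((v + Y) / b) => U V h.
have := sqr_ge0 (c - U); have := sqr_ge0 (s - V); nra.
Qed.

Lemma domain_near : exists2 e : R, 0 < e & forall y, dot y y <= e -> elliptic_domain E (P + y).
Proof.
pose g := 1 - ((u / a) ^+ 2 + (v / b) ^+ 2).
have g0 : 0 < g by rewrite subr_gt0; exact: P_coords.
pose t := g / 4.
have t0 : 0 < t by rewrite divr_gt0.
exists (Num.min a b ^+ 2 * t ^+ 2) => [|y].
  by rewrite mulr_gt0// exprn_gt0// lt_min a_gt0.
rewrite (frame_coord y) /elliptic_domain /= ellipse_form_frame /form_at.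
move: (xcoord y) (ycoord y) => X Y; rewrite dot_frame => XY.
have H (w A : R) : 0 < A -> Num.min a b <= A -> w ^+ 2 <= Num.min a b ^+ 2 * t ^+ 2 ->
    `|w / A| <= t.
  move=> A0 mA h; rewrite -(ler_pXn2r (n := 2)) ?nnegrE ?(ltW t0)//.
  rewrite real_normK ?num_real// expr_div_n ler_pdivrMr ?exprn_gt0//.
  apply: (le_trans h); rewrite mulrC ler_wpM2l ?sqr_ge0// lerXn2r ?nnegrE ?(ltW A0)//.
  by rewrite le_min (ltW a_gt0) ltW.
have m1 : Num.min a b <= a by rewrite ge_min lexx.
have m2 : Num.min a b <= b by rewrite ge_min lexx orbT.
have hX : `|X / a| <= t by apply: H => //; nra.
have hY : `|Y / b| <= t by apply: H => //; nra.
rewrite (mulrDl u X) (mulrDl v Y); move: hX hY; rewrite !ler_norml => /andP[x1 x2] /andP[y1 y2].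
have gE : (u / a) ^+ 2 + (v / b) ^+ 2 = 1 - 4 * t.
  by rewrite /t [4 * _]mulrC divfK ?pnatr_eq0// /g subKr.
have t1 : 4 * t <= 1.
  by rewrite -subr_ge0 -gE addr_ge0 ?sqr_ge0.
clearbody t.
move: (u / a) (v / b) (X / a) (Y / b) gE x1 x2 y1 y2 => U V x y' gE x1 x2 y1 y2.
have k (W w : R) : - t <= w -> w <= t -> 2 * W * w <= t * (W ^+ 2 + 1).
  move=> w1 w2; have h1 : 0 <= (t - w) * (W + 1) ^+ 2.
    by rewrite mulr_ge0 ?sqr_ge0// subr_ge0.
  have h2 : 0 <= (t + w) * (W - 1) ^+ 2.
    by rewrite mulr_ge0 ?sqr_ge0//; lra.
  lra.
have q (w : R) : - t <= w -> w <= t -> w ^+ 2 <= t / 4.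
  by move=> w1 w2; nra.
have := k U x x1 x2; have := k V y' y1 y2; have := q x x1 x2; have := q y' y1 y2.
have : t * (U ^+ 2 + V ^+ 2) <= t.
  by have := mulr_ge0 (ltW t0) (ltW t0); rewrite gE; lra.
lra.
Qed.

End EllipseGeometry.

(** * Critical points of the distance to the mass *)

Section CriticalPoints.
Context {R : realType}.

(** The left-hand side changes sign between the ends of the quadrant. *)
Lemma trig_root (A B d : R) : 0 < A -> 0 < B ->
  exists c s : R, [/\ 0 < c, 0 < s, c ^+ 2 + s ^+ 2 = 1 & A * s - B * c - d * (s * c) = 0].
Proof.
move=> A0 B0; pose f t := A * sin t - B * cos t - d * (sin t * cos t).
have pi20 : 0 < pi / 2 :> R by rewrite divr_gt0// pi_gt0.
have fc : continuous f.
  move=> t; have df : is_derive t 1 f (A * cos t + B * sin t - d * (cos t * cos t - sin t * sin t)).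
    by rewrite /f; deriv; ring.
  exact: is_derive_continuous df.
have f0 : f 0 = - B by rewrite /f sin0 cos0; ring.
have f1 : f (pi / 2) = A by rewrite /f sin_pihalf cos_pihalf; ring.
have [|t] := IVT (v := 0) (ltW pi20) (continuous_subspaceT fc).
  by rewrite f0 f1 ge_min le_max oppr_le0 !(ltW A0, ltW B0) !orbT.
rewrite in_itv /= => /andP[t0 t1] ft.
have t0' : 0 < t.
  rewrite lt_neqAle t0 andbT; apply/eqP => t00; move: ft; rewrite -t00 f0 => /eqP.
  by rewrite oppr_eq0 gt_eqF.
have t1' : t < pi / 2.
  rewrite lt_neqAle t1 andbT; apply/eqP => t00; move: ft; rewrite t00 f1 => /eqP.
  by rewrite gt_eqF.
exists (cos t), (sin t); split => //.
- by apply: cos_gt0_pihalf; rewrite t1' andbT (lt_trans _ t0')// oppr_lt0.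
- by apply: sin_gt0_pi; rewrite t0' (lt_trans t1')// ltr_pdivrMr// ltr_pMr ?pi_gt0// ltr1n.
- exact: cos2Dsin2.
Qed.

Lemma half_dot_gt0 (p q : R * R) : (0 < half_dot p q) = (0 < enorm p * enorm q + dot p q).
Proof. by rewrite /half_dot sqrtr_gt0 pmulr_lgt0. Qed.

(** Lagrange's identity: equality in the Cauchy-Schwarz inequality forces
    vectors to be parallel. *)
Lemma opposite_cross (X Y X' Y' r : R) : 0 <= r ->
  r ^+ 2 = (X * X + Y * Y) * (X' * X' + Y' * Y') -> r + (X * X' + Y * Y') <= 0 ->
  X * Y' - Y * X' = 0.
Proof.
move=> r0 r2 h; apply/eqP; rewrite -sqrf_eq0 eq_le sqr_ge0 andbT.
have -> : (X * Y' - Y * X') ^+ 2 = r ^+ 2 - (X * X' + Y * Y') ^+ 2 by rewrite r2; ring.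
by move: {r2} (X * X' + Y * Y') h => D h; nra.
Qed.

Variables (E : ellipse R) (P : R * R).
Let a := semi_major E.
Let b := semi_minor E.
Hypotheses (b_gt0 : 0 < b) (ab : b < a).
Let a_gt0 : 0 < a. Proof. exact: lt_trans ab. Qed.
Hypothesis P_in : elliptic_domain E P.
Let u := xcoord E (P - centre E).
Let v := ycoord E (P - centre E).

(** The derivative of half the squared distance to P along the ellipse, in the
    eccentric anomaly, and (dslope) its second derivative. *)
Definition slope c s := dot (btangent E c s) (bpoint E P c s).
Definition dslope (c s : R) := - (a ^+ 2 - b ^+ 2) * (c ^+ 2 - s ^+ 2) + a * u * c + b * v * s.

Lemma slopeE c s : slope c s = a * u * s - b * v * c - (a ^+ 2 - b ^+ 2) * (s * c).
Proof. by rewrite /slope dot_frame -/a -/b -/u -/v; ring. Qed.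

(** At a critical point, the second derivative takes a form from which it does
    not vanish if a * u * s and b * v * c have the same sign. *)
Lemma dslopeM c s : slope c s = 0 ->
  s * c * dslope c s = a * u * s ^+ 3 + b * v * c ^+ 3.
Proof.
rewrite slopeE => e; rewrite /dslope.
transitivity ((a * u * s - b * v * c - (a ^+ 2 - b ^+ 2) * (s * c)) * (c ^+ 2 - s ^+ 2)
  + (a * u * s ^+ 3 + b * v * c ^+ 3)); first by ring.
by rewrite e mul0r add0r.
Qed.

Hypotheses (u_neq0 : u != 0) (v_neq0 : v != 0).

(** If p and q were opposite as seen from P, then, both being critical points,
    the chord from p to q would be normal to the ellipse at both ends; the tangents
    there are parallel, so q is the antipode of p, and the chord passes
    through the centre.  Adding the equations of the two critical points, the
    terms in u and v cancel, and the chord lies on an axis. *)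
Lemma critical_half_dot x y x' y' : x ^+ 2 + y ^+ 2 = 1 -> x' ^+ 2 + y' ^+ 2 = 1 ->
  slope x y = 0 -> slope x' y' = 0 -> y * x != 0 -> y' * x' != 0 -> x * x' < 0 ->
  0 < half_dot (bpoint E P x y) (bpoint E P x' y').
Proof.
move=> xy xy' s s' sc sc' xx'; have sE := slopeE x y; have sE' := slopeE x' y'.
have p0 := bpoint_neq0 a_gt0 b_gt0 P_in xy.
have q0 := bpoint_neq0 a_gt0 b_gt0 P_in xy'.
rewrite half_dot_gt0 ltNge; apply/negP.
move: s s' sE sE'; rewrite /slope /btangent -/a -/b.
set p := bpoint E P x y in p0 *; set q := bpoint E P x' y' in q0 *.
move=> s s' sE sE' h.
have r0 : 0 <= enorm p * enorm q by rewrite mulr_ge0 ?enorm_ge0.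
have pq2 : (enorm p * enorm q) ^+ 2 = dot p p * dot q q by rewrite exprMn !sqr_enorm.
move: pq2 h r0; move: (enorm p * enorm q) => r.
have p0' : ~~ ((xcoord E p == 0) && (ycoord E p == 0)).
  apply: contra p0 => /andP[/eqP pX /eqP pY].
  by rewrite (frame_coord E p) pX pY /frame !scale0r addr0.
have q0' : ~~ ((xcoord E q == 0) && (ycoord E q == 0)).
  apply: contra q0 => /andP[/eqP pX /eqP pY].
  by rewrite (frame_coord E q) pX pY /frame !scale0r addr0.
rewrite (frame_coord E p) (frame_coord E q) !dot_frame in s s' sE sE' *.
move: (xcoord E p) (ycoord E p) (xcoord E q) (ycoord E q) p0' q0' s s' sE sE'.
move=> X Y X' Y' p0' q0' s s' sE sE' pq2 h r0.
have cross := opposite_cross r0 pq2 h.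
have x0 : x != 0 by apply: contraNneq sc => ->; rewrite mulr0.
have x'0 : x' != 0 by apply: contraNneq sc' => ->; rewrite mulr0.
have bx : b * x != 0 by rewrite mulf_neq0// gt_eqF.
have bx' : b * x' != 0 by rewrite mulf_neq0// gt_eqF.
have YE : Y = a * y * X / (b * x).
  by apply: (mulIf bx); rewrite divfK//; apply/eqP; rewrite -subr_eq0 -s; apply/eqP; ring.
have YE' : Y' = a * y' * X' / (b * x').
  by apply: (mulIf bx'); rewrite divfK//; apply/eqP; rewrite -subr_eq0 -s'; apply/eqP; ring.
have X0 : X != 0 by apply: contraNneq p0' => X0; rewrite YE X0 mulr0 mul0r !eqxx.
have X'0 : X' != 0 by apply: contraNneq q0' => X0'; rewrite YE' X0' mulr0 mul0r !eqxx.
have par : y' * x = y * x'.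
  have : a * X * X' / (b * x * x') * (y' * x - y * x') = 0.
    rewrite -cross YE YE'; field; by rewrite x0 x'0 gt_eqF.
  move/eqP; rewrite mulf_eq0 => /orP[|/eqP/subr0_eq //].
  by rewrite !mulf_eq0 invr_eq0 !mulf_eq0 (negPf X0) (negPf X'0) (negPf x0) (negPf x'0)
    !gt_eqF.
pose k := x * x' + y * y'.
have x'E : x' = k * x.
  transitivity (x' * (x ^+ 2 + y ^+ 2)); first by rewrite xy mulr1.
  transitivity (x' * x ^+ 2 + y * (y * x')); first by ring.
  by rewrite -par /k; ring.
have y'E : y' = k * y.
  transitivity (y' * (x ^+ 2 + y ^+ 2)); first by rewrite xy mulr1.
  transitivity (y' * y ^+ 2 + x * (y' * x)); first by ring.
  by rewrite par /k; ring.
have k2 : k ^+ 2 = 1 by rewrite -xy' x'E y'E -[LHS]mulr1 -xy; ring.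
have k0 : k < 0.
  by move: xx'; rewrite x'E mulrCA -expr2 pmulr_llt0// exprn_even_gt0.
have kE : k = - 1.
  by move/eqP: k2; rewrite sqrf_eq1 => /orP[/eqP k1|/eqP //]; move: k0; rewrite k1 ltr10.
have /eqP : 2 * ((a ^+ 2 - b ^+ 2) * (y * x)) = 0.
  rewrite s in sE; rewrite s' x'E y'E kE in sE'.
  transitivity (- ((a * u * y - b * v * x - (a ^+ 2 - b ^+ 2) * (y * x)) +
    (a * u * (-1 * y) - b * v * (-1 * x) - (a ^+ 2 - b ^+ 2) * (-1 * y * (-1 * x))))).
    by ring.
  by rewrite -sE -sE' addr0 oppr0.
rewrite !mulf_eq0 -[(y == 0) || _]mulf_eq0 (negPf sc) orbF pnatr_eq0 /=.
by rewrite gt_eqF// subr_gt0 ltrXn2r// ltW.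
Qed.

(** One critical point lies in the open quadrant of the point of coordinates
    (u, v), the other in the opposite quadrant: by symmetry both are roots of the
    function of trig_root, with d = a ^ 2 - b ^ 2 and - d. *)
Lemma critical_points : exists C S : bool -> R,
  [/\ forall i, C i ^+ 2 + S i ^+ 2 = 1,
      forall i, slope (C i) (S i) = 0,
      forall i, dslope (C i) (S i) != 0,
      C false * C true < 0 &
      forall i j, 0 < half_dot (bpoint E P (C i) (S i)) (bpoint E P (C j) (S j))].
Proof.
have d0 : 0 < a ^+ 2 - b ^+ 2 by rewrite subr_gt0 ltrXn2r// ltW.
set d := a ^+ 2 - b ^+ 2 in d0.
pose A := `|a * u|; pose B := `|b * v|.
have A0 : 0 < A by rewrite normr_gt0 mulf_neq0// gt_eqF.
have B0 : 0 < B by rewrite normr_gt0 mulf_neq0// gt_eqF.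
pose sA := Num.sg (a * u); pose sB := Num.sg (b * v).
have AE : a * u = sA * A by rewrite /sA /A -numEsg.
have BE : b * v = sB * B by rewrite /sB /B -numEsg.
have sA2 : sA ^+ 2 = 1 by rewrite sqr_sg mulf_neq0// gt_eqF.
have sB2 : sB ^+ 2 = 1 by rewrite sqr_sg mulf_neq0// gt_eqF.
have [c0 [s0 [c00 s00 cs0 e0]]] := trig_root d A0 B0.
have [c1 [s1 [c10 s10 cs1 e1]]] := trig_root (- d) A0 B0.
pose C i := if i then - sA * c1 else sA * c0.
pose S i := if i then - sB * s1 else sB * s0.
have CS i : C i ^+ 2 + S i ^+ 2 = 1.
  by case: i; rewrite /C /S !exprMn ?sqrrN sA2 sB2 !mul1r.
have sl i : slope (C i) (S i) = 0.
  rewrite slopeE -/d AE BE; case: i; rewrite /C /S.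
    transitivity (- (sA * sB) * (A * s1 - B * c1 - - d * (s1 * c1))); first by ring.
    by rewrite e1 mulr0.
  transitivity (sA * sB * (A * s0 - B * c0 - d * (s0 * c0))); first by ring.
  by rewrite e0 mulr0.
have SC i : S i * C i != 0.
  have sA0 : sA != 0 by rewrite -sqrf_eq0 sA2 oner_eq0.
  have sB0 : sB != 0 by rewrite -sqrf_eq0 sB2 oner_eq0.
  by case: i; rewrite /C /S !mulf_neq0 ?oppr_eq0// gt_eqF.
have CC : C false * C true < 0.
  have -> : C false * C true = - (sA ^+ 2 * (c0 * c1)) by rewrite /C; ring.
  by rewrite sA2 mul1r oppr_lt0 mulr_gt0.
exists C, S; split => //.
- move=> i; apply: contraTneq (oner_neq0 R) => ds.
  have := dslopeM (sl i); rewrite ds mulr0 AE BE => /esym/eqP.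
  have pos (c s : R) : 0 < c -> 0 < s -> A * s ^+ 3 + B * c ^+ 3 != 0.
    by move=> c' s'; rewrite gt_eqF// addr_gt0// mulr_gt0// exprn_gt0.
  have -> : sA * A * S i ^+ 3 + sB * B * C i ^+ 3 =
     (if i then - (sA * sB) else sA * sB) *
     (if i then A * s1 ^+ 3 + B * c1 ^+ 3 else A * s0 ^+ 3 + B * c0 ^+ 3).
    case: i {ds}; rewrite /C /S.
      transitivity (- (sA * A * (sB * sB ^+ 2) * s1 ^+ 3 +
         sB * B * (sA * sA ^+ 2) * c1 ^+ 3)); first by ring.
      by rewrite sA2 sB2; ring.
    transitivity (sA * A * (sB * sB ^+ 2) * s0 ^+ 3 +
       sB * B * (sA * sA ^+ 2) * c0 ^+ 3); first by ring.
    by rewrite sA2 sB2; ring.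
  have sAB : sA * sB != 0.
    by rewrite -sqrf_eq0 exprMn sA2 sB2 mul1r oner_eq0.
  by rewrite mulf_eq0; case: i {ds} => /orP[]; rewrite ?oppr_eq0 ?(negPf sAB) ?(negPf (pos _ _ _ _)).
- have ii i : 0 < half_dot (bpoint E P (C i) (S i)) (bpoint E P (C i) (S i)).
    rewrite half_dot_gt0 -expr2 sqr_enorm -mulr2n pmulrn_lgt0// dot_gt0//.
    exact: bpoint_neq0.
  have ft : 0 < half_dot (bpoint E P (C false) (S false)) (bpoint E P (C true) (S true)).
    by apply: critical_half_dot.
  by case=> -[]//; rewrite half_dotC.
Qed.

End CriticalPoints.

(** * Launching angles and the reflection law *)

Section Launch.
Context {R : realType}.
Implicit Types (p n v w : R * R) (V : R * R -> R) (alpha : R).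

Definition perp n : R * R := (- n.2, n.1).

Lemma plane_decomp n v : dot n n = 1 -> v = dot v n *: n + dot v (perp n) *: perp n.
Proof.
rewrite /dot /perp => n1; apply: injective_projections; rewrite /= !scaleRE.
  transitivity (v.1 * (n.1 * n.1 + n.2 * n.2)); first by rewrite n1 mulr1.
  by ring.
transitivity (v.2 * (n.1 * n.1 + n.2 * n.2)); first by rewrite n1 mulr1.
by ring.
Qed.

Lemma plane_eq n v w : dot n n = 1 -> dot v n = dot w n ->
  dot v (perp n) = dot w (perp n) -> v = w.
Proof.
by move=> n1 e1 e2; rewrite (plane_decomp v n1) (plane_decomp w n1) e1 e2.
Qed.

Lemma dot_decomp n v : dot n n = 1 -> dot v v = dot v n ^+ 2 + dot v (perp n) ^+ 2.
Proof.
rewrite /dot /perp /= => n1.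
transitivity ((v.1 * v.1 + v.2 * v.2) * (n.1 * n.1 + n.2 * n.2)).
  by rewrite n1 mulr1.
by ring.
Qed.

Lemma dot_launch V p n alpha : dot n n = 1 ->
  dot (launch V p n alpha) n = Num.sqrt (2 * V p) * cos alpha /\
  dot (launch V p n alpha) (perp n) = Num.sqrt (2 * V p) * sin alpha.
Proof.
rewrite /dot /perp /launch /rot /= => n1; rewrite !scaleRE; split.
  transitivity (Num.sqrt (2 * V p) * cos alpha * (n.1 * n.1 + n.2 * n.2)).
    by ring.
  by rewrite n1 mulr1.
transitivity (Num.sqrt (2 * V p) * sin alpha * (n.1 * n.1 + n.2 * n.2)).
  by ring.
by rewrite n1 mulr1.
Qed.

Lemma open_angle_in alpha : open_angle alpha ->
  alpha \in `[- (pi / 2), pi / 2]%R.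
Proof. by move=> /andP[a b]; rewrite in_itv /= !ltW. Qed.

Lemma open_angle_sin_inj alpha beta : open_angle alpha -> open_angle beta ->
  sin alpha = sin beta -> alpha = beta.
Proof. by move=> /open_angle_in a /open_angle_in b; exact: sin_inj. Qed.

Lemma launch_inj V p n alpha beta : dot n n = 1 -> 0 < V p ->
  open_angle alpha -> open_angle beta ->
  launch V p n alpha = launch V p n beta -> alpha = beta.
Proof.
move=> n1 V0 a b e; apply: open_angle_sin_inj => //.
have [_ h1] := dot_launch V p alpha n1; have [_ h2] := dot_launch V p beta n1.
have s0 : Num.sqrt (2 * V p) != 0 by rewrite gt_eqF// sqrtr_gt0 mulr_gt0.
by apply: (mulfI s0); rewrite -h1 -h2 e.
Qed.

Definition launch_sin V p n v := dot v (perp n) / Num.sqrt (2 * V p).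

(** A velocity of the right length on the right side of the tangent line is
    launched at an angle between - pi / 2 and pi / 2, which the sine determines. *)
Lemma launchK V p n v (alpha := asin (launch_sin V p n v)) :
  dot n n = 1 -> 0 < V p -> dot v v = 2 * V p -> 0 < dot v n ->
  [/\ -1 < launch_sin V p n v < 1, open_angle alpha,
      sin alpha = launch_sin V p n v & launch V p n alpha = v].
Proof.
move=> n1 V0 vV vn; set S := Num.sqrt (2 * V p).
have V20 : 0 < 2 * V p by rewrite mulr_gt0.
have S0 : 0 < S by rewrite sqrtr_gt0.
have S2 : S ^+ 2 = 2 * V p by rewrite sqr_sqrtr// ltW.
pose x := launch_sin V p n v; pose y := dot v n / S.
have y0 : 0 < y by rewrite divr_gt0.
have xy : x ^+ 2 + y ^+ 2 = 1.
  rewrite /x /y /launch_sin -/S !expr_div_n -mulrDl addrC -dot_decomp// vV S2 divff//.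
  by rewrite gt_eqF.
have x1 : -1 < x < 1 by nra.
have x1' : -1 <= x <= 1 by case/andP: x1 => ? ?; rewrite !ltW.
have oa : open_angle alpha.
  by rewrite /open_angle /alpha asin_ltpi2 ?asin_gtNpi2//; case/andP: x1 => ? ?; apply/andP; split => //; exact: ltW.
have sa : sin alpha = x by rewrite asinK.
have ca : cos alpha = y.
  rewrite cos_asin// -/x; have -> : 1 - x ^+ 2 = y ^+ 2 by rewrite -xy; ring.
  by rewrite sqrtr_sqr ger0_norm// ltW.
split => //; have [h1 h2] := dot_launch V p alpha n1.
apply: (plane_eq n1).
  by rewrite h1 ca -/S /y mulrC divfK// gt_eqF.
by rewrite h2 sa -/S /x /launch_sin -/S mulrC divfK// gt_eqF.
Qed.

(** Two velocities of equal length with the same tangential component have the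
    same or opposite normal components. *)
Lemma reflection_law n v w : dot n n = 1 -> dot w w = dot v v ->
  0 < dot w n -> dot v n < 0 -> dot w (perp n) = dot v (perp n) ->
  Defs.reflect n w = v.
Proof.
move=> n1 wv wn vn e; have := dot_decomp w n1; rewrite wv (dot_decomp v n1) e.
move=> /addIr /eqP; rewrite eqf_sqr => /orP[/eqP e'|/eqP e'].
  by move: vn; rewrite e' ltNge ltW.
have rn x : dot (Defs.reflect n w) x = dot w x - 2 * dot w n * dot n x.
  by rewrite /Defs.reflect /dot /= !scaleRE; ring.
apply: (plane_eq n1); rewrite rn.
  by rewrite n1 e'; ring.
have -> : dot n (perp n) = 0 by rewrite /dot /perp /=; ring.
by rewrite mulr0 subr0.
Qed.

Lemma reflect_involutive n v : dot n n = 1 -> Defs.reflect n (Defs.reflect n v) = v.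
Proof.
move=> n1; have rn x : dot (Defs.reflect n v) x = dot v x - 2 * dot v n * dot n x.
  by rewrite /Defs.reflect /dot /= !scaleRE; ring.
rewrite {1}/Defs.reflect rn n1 /Defs.reflect.
by apply: injective_projections; rewrite /= !scaleRE; ring.
Qed.

End Launch.

(** * The harmonic arc joining two points *)

Section OuterArc.
Context {R : realType}.
Implicit Types (P p m : R * R) (omega hE : R).

(** The cosine c of omega T, where T is the duration of the arc from p to m.
    The motion joining p to m in the time T has the prescribed energy iff
    L c ^ 2 - 2 c (p . m) + |p| ^ 2 + |m| ^ 2 - L = 0.  For p = m the roots are 1,
    with T = 0, and the smaller one, which belongs to the arc going
    straight up and falling back; so the smaller root is the one to follow. *)
Definition outer_cos omega hE p m : R :=
  let L := 2 * hE / omega ^+ 2 in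
  (dot p m - Num.sqrt (dot p m ^+ 2 - L * (dot p p + dot m m - L))) / L.

Definition outer_arrival omega hE p m : R * R :=
  let c := outer_cos omega hE p m in
  (omega / Num.sqrt (1 - c ^+ 2)) *: (c *: m - p).

Lemma outer_cosC omega hE p m : outer_cos omega hE p m = outer_cos omega hE m p.
Proof. by rewrite /outer_cos dotC (addrC (dot p p)). Qed.

(** The arc is the combination of p and m with coefficients
    l = sin (omega (T - t)) / sin (omega T) and
    n = sin (omega t) / sin (omega T). *)
Lemma outer_connection omega hE P p m (L := 2 * hE / omega ^+ 2)
    (c := outer_cos omega hE p m) :
  0 < omega -> 0 < hE -> 0 <= dot p m ^+ 2 - L * (dot p p + dot m m - L) ->
  -1 < c < 1 ->
  exists z u T, [/\ outer_motion omega hE P z u, 0 < T,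
    z 0 = P + p /\ u 0 = - outer_arrival omega hE m p,
    z T = P + m /\ u T = outer_arrival omega hE p m &
    forall t, 0 < t < T -> exists l n, [/\ 0 < l, 0 < n,
      l ^+ 2 + n ^+ 2 + 2 * l * n * c = 1 & z t = P + (l *: p + n *: m)]].
Proof.
move=> o0 h0 disc c1; have [cN1 cP1] := andP c1.
have L0 : 0 < L by rewrite divr_gt0 ?exprn_gt0// mulr_gt0.
have c1' : -1 <= c <= 1 by rewrite !ltW.
pose s := Num.sqrt (1 - c ^+ 2).
have c21 : 0 < 1 - c ^+ 2 by nra.
have s0 : 0 < s by rewrite sqrtr_gt0.
have s2 : s ^+ 2 = 1 - c ^+ 2 by rewrite sqr_sqrtr// ltW.
have s0' : s != 0 by rewrite gt_eqF.
have o0' : omega != 0 by rewrite gt_eqF.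
have LE : L * omega ^+ 2 = 2 * hE by rewrite /L divfK// expf_neq0.
have cE : L * c ^+ 2 - 2 * c * dot p m + (dot p p + dot m m - L) = 0.
  have e : (L * c - dot p m) ^+ 2 = dot p m ^+ 2 - L * (dot p p + dot m m - L).
    have -> : L * c = dot p m - Num.sqrt (dot p m ^+ 2 - L * (dot p p + dot m m - L)).
      by rewrite /c /outer_cos -/L mulrC divfK// gt_eqF.
    by rewrite addrAC subrr add0r sqrrN sqr_sqrtr.
  apply: (mulfI (lt0r_neq0 L0)); rewrite mulr0.
  transitivity ((L * c - dot p m) ^+ 2 - (dot p m ^+ 2 - L * (dot p p + dot m m - L))).
    by ring.
  by rewrite e subrr.
pose v : R * R := (omega / s) *: (m - c *: p).
pose z (t : R) : R * R :=
  (P.1 + (p.1 * cos (omega * t) + v.1 / omega * sin (omega * t)),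
   P.2 + (p.2 * cos (omega * t) + v.2 / omega * sin (omega * t))).
pose u (t : R) : R * R :=
  (v.1 * cos (omega * t) - omega * p.1 * sin (omega * t),
   v.2 * cos (omega * t) - omega * p.2 * sin (omega * t)).
have vv : dot v v + omega ^+ 2 * dot p p = 2 * hE.
  rewrite -LE; apply: (mulfI (_ : s ^+ 2 != 0)); first by rewrite expf_neq0.
  transitivity (omega ^+ 2 * (dot m m - 2 * c * dot p m + c ^+ 2 * dot p p +
      s ^+ 2 * dot p p)).
    by rewrite /v /dot /= !scaleRE; field.
  have -> : dot m m = L - dot p p - L * c ^+ 2 + 2 * c * dot p m.
    by apply/eqP; rewrite -subr_eq0 -cE; apply/eqP; ring.
  by rewrite s2; ring.
pose th := acos c.
have cth : cos th = c by rewrite acosK.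
have sth : sin th = s by rewrite sin_acos.
have th0 : 0 < th by rewrite acos_gt0// cP1 ltW.
have thpi : th < pi by rewrite acos_ltpi// cN1 ltW.
pose T := th / omega.
have oT : omega * T = th by rewrite mulrC divfK.
exists z, u, T; split.
- move=> t; split.
  + by apply/is_derive_pairP; split; rewrite /z /u /=; deriv; field.
  + by rewrite grad_V_outer; apply/is_derive_pairP; split; rewrite /z /u /=;
      deriv; rewrite ?scaleRE; field; rewrite o0' s0'.
  + rewrite /V_outer !sqr_enorm.
    have e : dot (u t) (u t) + omega ^+ 2 * dot (z t - P) (z t - P) = 2 * hE.
      transitivity ((dot v v + omega ^+ 2 * dot p p) *
        (cos (omega * t) ^+ 2 + sin (omega * t) ^+ 2)).
        by rewrite /dot /z /u /=; field.
      by rewrite cos2Dsin2 mulr1.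
    by lra.
- by rewrite divr_gt0.
- rewrite /z /u mulr0 cos0 sin0 !mulr0 !mulr1 !addr0 !subr0; split.
    by rewrite [in RHS]pairD.
  by apply: injective_projections;
    rewrite /outer_arrival outer_cosC -/c -/s /v /= !scaleRE; ring.
- rewrite /z /u oT cth sth; split.
    by apply: injective_projections; rewrite /v /= !scaleRE; field; rewrite o0' s0'.
  rewrite /outer_arrival -/c -/s /v.
  have E (x y : R) : omega / s * (x - c * y) * c - omega * y * s =
      omega / s * (c * x - y).
    transitivity (omega / s * (c * x - (c ^+ 2 + s ^+ 2) * y)); first by field.
    by rewrite s2 [c ^+ 2 + _]addrC subrK mul1r.
  by apply: injective_projections; rewrite /= !scaleRE E.
- move=> t /andP[t0 tT].
  have ot0 : 0 < omega * t by rewrite mulr_gt0.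
  have otT : omega * t < th by rewrite -oT ltr_pM2l.
  exists (sin (th - omega * t) / s), (sin (omega * t) / s); split.
  + rewrite divr_gt0// sin_gt0_pi// subr_gt0 otT /=.
    by apply: lt_trans thpi; rewrite ltrBlDr ltrDl.
  + by rewrite divr_gt0// sin_gt0_pi// ot0 (lt_trans otT).
  + rewrite sinB cth sth; have cs := cos2Dsin2 (omega * t).
    transitivity ((s ^+ 2 * cos (omega * t) ^+ 2 +
       (1 - c ^+ 2) * sin (omega * t) ^+ 2) / s ^+ 2); first by field.
    by rewrite -s2 -mulrDr cs mulr1 divff// expf_neq0.
  + rewrite sinB cth sth.
    by apply: injective_projections; rewrite /z /v /= !scaleRE; field; rewrite o0' s0'.
Qed.

End OuterArc.

(** * Arcs between points of the ellipse *)

Section EllipseArcs.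
Context {R : realType}.
Variables (E : ellipse R) (P : R * R).
Let a := semi_major E.
Let b := semi_minor E.
Hypotheses (a_gt0 : 0 < a) (b_gt0 : 0 < b).
Hypothesis P_in : elliptic_domain E P.
Implicit Types (c s mu h : R) (v w : R * R).
Local Notation pt c s := (bpoint E P c s).
Local Notation N c s := (bnormal E c s).
Local Notation tau c s := (btangent E c s).

(** The tangent btangent is the normal bnormal turned by a right angle and
    multiplied by a b; this is the inverse of its length. *)
Definition tangent_scale c s : R := (a * b * enorm (N c s))^-1.

Lemma dotZr k v w : dot v (k *: w) = k * dot v w.
Proof. by rewrite /dot /= !scaleRE; ring. Qed.

Lemma dotZl k v w : dot (k *: v) w = k * dot v w.
Proof. by rewrite /dot /= !scaleRE; ring. Qed.

Lemma dotNr v w : dot v (- w) = - dot v w.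
Proof. by rewrite /dot /=; ring. Qed.

Lemma dotNl v w : dot (- v) w = - dot v w.
Proof. by rewrite /dot /=; ring. Qed.

Lemma dotDl v v' w : dot (v + v') w = dot v w + dot v' w.
Proof. by rewrite /dot /=; ring. Qed.

Lemma perpN v : perp (- v) = - perp v.
Proof. by rewrite /perp; apply: injective_projections. Qed.

Lemma outward_normalE c s : c ^+ 2 + s ^+ 2 = 1 ->
  outward_normal E (P + pt c s) = (enorm (N c s))^-1 *: N c s.
Proof.
move=> cs; rewrite /outward_normal grad_ellipse_form//.
have n0 : enorm (N c s) != 0.
  by rewrite gt_eqF// enorm_gt0//; exact (bnormal_neq0 a_gt0 b_gt0 P_in cs).
have -> : enorm (2 *: N c s) = 2 * enorm (N c s).
  apply: enormE; first by rewrite mulr_ge0// enorm_ge0.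
  by rewrite exprMn sqr_enorm dotZl dotZr; ring.
rewrite scalerA; congr (_ *: _); field => //.
Qed.

Section NormalFrame.
Variables (c s : R).
Hypothesis cs : c ^+ 2 + s ^+ 2 = 1.
Let n := outward_normal E (P + pt c s).

Lemma dot_outward_normal v : dot v n = (enorm (N c s))^-1 * dot v (N c s).
Proof. by rewrite /n outward_normalE// dotZr. Qed.

Lemma outward_normal_unit : dot n n = 1.
Proof.
rewrite {2}/n outward_normalE// dotZr dotC dot_outward_normal -sqr_enorm.
have n0 : enorm (N c s) != 0.
  by rewrite gt_eqF// enorm_gt0//; exact (bnormal_neq0 a_gt0 b_gt0 P_in cs).
by field.
Qed.

Lemma inward_normal_unit : dot (inward_normal E (P + pt c s)) (inward_normal E (P + pt c s)) = 1.
Proof. by rewrite /inward_normal dotNl dotNr opprK outward_normal_unit. Qed.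

Lemma dot_outward_normal_gt0 v : (0 < dot v n) = (0 < dot v (N c s)).
Proof.
rewrite dot_outward_normal pmulr_rgt0// invr_gt0 enorm_gt0//.
exact (bnormal_neq0 a_gt0 b_gt0 P_in cs).
Qed.

Lemma dot_perp_normal v : dot v (perp n) = tangent_scale c s * dot v (tau c s).
Proof.
rewrite /n outward_normalE// /tangent_scale invfM.
have n0 : enorm (N c s) != 0.
  by rewrite gt_eqF// enorm_gt0//; exact (bnormal_neq0 a_gt0 b_gt0 P_in cs).
set r := enorm _ in n0 *.
rewrite /perp /bnormal /btangent /frame /major_dir /minor_dir /rot /dot /= !scaleRE.
rewrite -/a -/b; field; by rewrite n0 !gt_eqF.
Qed.

End NormalFrame.

Lemma bpoint_boundary c s : c ^+ 2 + s ^+ 2 = 1 -> elliptic_boundary E (P + pt c s).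
Proof. by move=> cs; apply/boundaryP => //; exists c, s. Qed.

Lemma P_notin_boundary z : elliptic_boundary E z -> z != P.
Proof.
move=> bz; apply/eqP => zP; have := P_in; rewrite /elliptic_domain /= -zP bz ltxx.
by [].
Qed.

Lemma domain_boundary_disjoint z : elliptic_domain E z -> ~ elliptic_boundary E z.
Proof. by rewrite /elliptic_domain /elliptic_boundary /= => + e; rewrite e ltxx. Qed.

Lemma inner_arc_unique mu h p v q w q' w' : elliptic_boundary E p ->
  inner_arc E mu h P p v q w -> inner_arc E mu h P p v q' w' -> q = q' /\ w = w'.
Proof.
move=> bp; apply: arc_unique.
- move=> z u z' u' m m' z0 zz uu; apply: (inner_motion_unique m m') => //.
  by rewrite z0; exact: P_notin_boundary.
- move=> z u t [_ zN _] /P_notin_boundary/eqP zP.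
  by have [] := zN t zP.
- exact: domain_boundary_disjoint.
Qed.

Lemma outer_arc_unique omega hE p v q w q' w' : omega != 0 ->
  outer_arc E P omega hE p v q w -> outer_arc E P omega hE p v q' w' -> q = q' /\ w = w'.
Proof.
move=> o0; apply: arc_unique.
- by move=> z u z' u' m m' _ zz uu t _; exact: (outer_motion_unique o0 m m').
- by move=> z u t zN _; have [] := zN t.
- by move=> x xO bx; apply: xO; right.
Qed.

(** The arc stays in the domain as a convex combination of two points of the
    ellipse and of a point that is interior. *)
Lemma inner_arc_bpoint mu h c s c' s' : 0 < mu -> 0 < h ->
  c ^+ 2 + s ^+ 2 = 1 -> c' ^+ 2 + s' ^+ 2 = 1 ->
  0 < half_dot (pt c s) (pt c' s') ->
  elliptic_domain E (P + (- bend (mu / h) (pt c s) (pt c' s')) *: bisector (pt c s) (pt c' s')) ->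
  inner_arc E mu h P (P + pt c s) (- arrival mu h (pt c' s') (pt c s))
    (P + pt c' s') (arrival mu h (pt c s) (pt c' s')).
Proof.
move=> mu0 h0 cs cs' m0 inD.
have p0 := bpoint_neq0 a_gt0 b_gt0 P_in cs.
have q0 := bpoint_neq0 a_gt0 b_gt0 P_in cs'.
have [x0 _ _] := bend_eq m0 (divr_gt0 mu0 h0).
have [z [u [T [zu T0 [z0 u0] [zT uT] zD]]]] := kepler_arc P mu0 h0 p0 q0 m0.
exists z, u, T; split => //.
  move=> t /zD[l [n [l0 n0 ln ->]]].
  by apply: domain_convex => //; rewrite ?sqr_ge0// divr_gt0// !mulr_gt0.
by rewrite zT; split => //; exact: bpoint_boundary.
Qed.

Lemma arrival_energy mu h c s c' s' : 0 < mu -> 0 < h ->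
  c ^+ 2 + s ^+ 2 = 1 -> c' ^+ 2 + s' ^+ 2 = 1 ->
  0 < half_dot (pt c s) (pt c' s') ->
  dot (arrival mu h (pt c s) (pt c' s')) (arrival mu h (pt c s) (pt c' s')) =
    2 * V_inner mu h P (P + pt c' s').
Proof.
move=> mu0 h0 cs cs' m0.
have p0 := bpoint_neq0 a_gt0 b_gt0 P_in cs.
have q0 := bpoint_neq0 a_gt0 b_gt0 P_in cs'.
have [z [u [T [[_ zN _] T0 _ [zT uT] _]]]] := kepler_arc P mu0 h0 p0 q0 m0.
have zP : z T <> P by rewrite zT => /eqP; rewrite addrC -subr_eq0 addrK (negPf q0).
have [_ _] := zN T zP; rewrite zT uT sqr_enorm => e.
by lra.
Qed.

Lemma V_inner_gt0 mu h z : 0 < mu -> 0 < h -> 0 < V_inner mu h P z.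
Proof.
by move=> mu0 h0; rewrite ltr_pwDl// divr_ge0 ?enorm_ge0// ltW.
Qed.

(** The points of the arc are l p + n m with l + n > 1.  If n <= l, then
    n (1 - k) <= 2 (l + n - 1), so that the height of such a point over the tangent
    line at p is at least n / 2 times the quantity supposed positive at p; if
    l <= n, the same holds at m. *)
Lemma outer_arc_bpoint omega hE c s c' s' (k := outer_cos omega hE (pt c s) (pt c' s'))
    (L := 2 * hE / omega ^+ 2) :
  0 < omega -> 0 < hE -> c ^+ 2 + s ^+ 2 = 1 -> c' ^+ 2 + s' ^+ 2 = 1 ->
  0 <= dot (pt c s) (pt c' s') ^+ 2 -
    L * (dot (pt c s) (pt c s) + dot (pt c' s') (pt c' s') - L) ->
  -1 < k < 1 ->
  0 < (1 - k) * dot (N c s) (pt c s) + 2 * dot (N c s) (pt c' s' - pt c s) ->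
  0 < (1 - k) * dot (N c' s') (pt c' s') + 2 * dot (N c' s') (pt c s - pt c' s') ->
  outer_arc E P omega hE (P + pt c s) (- outer_arrival omega hE (pt c' s') (pt c s))
    (P + pt c' s') (outer_arrival omega hE (pt c s) (pt c' s')).
Proof.
move=> o0 h0 cs cs' disc k1 np nm.
have [z [u [T [zu T0 [z0 u0] [zT uT] zO]]]] := outer_connection P o0 h0 disc k1.
exists z, u, T; split => //; last by rewrite zT; split => //; exact: bpoint_boundary.
move=> t /zO[l [n [l0 n0 ln ->]]]; rewrite -/k in ln.
have Np := bnormal_bpoint_gt0 a_gt0 b_gt0 P_in cs.
have Nm := bnormal_bpoint_gt0 a_gt0 b_gt0 P_in cs'.
have [kN kP] := andP k1.
suff : 1 < ellipse_form E (P + (l *: pt c s + n *: pt c' s')).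
  by move=> F1 [|]; rewrite /elliptic_domain /elliptic_boundary /= => F; move: F1; rewrite ?F ?ltxx// ltNge ltW.
have ln1 : 1 < l + n.
  rewrite -(ltr_pXn2r (n := 2)) ?nnegrE ?addr_ge0 ?(ltW l0) ?(ltW n0)// expr1n.
  have -> : (l + n) ^+ 2 = 1 + 2 * (l * n * (1 - k)).
    transitivity ((l ^+ 2 + n ^+ 2 + 2 * l * n * k) + 2 * (l * n * (1 - k))).
      by ring.
    by rewrite ln.
  by rewrite ltrDl !mulr_gt0// subr_gt0.
have key (x y : R) : 0 < x -> 0 < y -> y <= x -> 1 < x + y ->
    x ^+ 2 + y ^+ 2 + 2 * x * y * k = 1 -> y * (1 - k) <= 2 * (x + y - 1).
  move=> x0 y0 yx xy e.
  have h1 : (x + y - 1) * (x + y + 1) = 2 * x * y * (1 - k).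
    transitivity ((x ^+ 2 + y ^+ 2 + 2 * x * y * k) + 2 * x * y * (1 - k) - 1); first by ring.
    by rewrite e; ring.
  rewrite -(ler_pM2r (_ : 0 < x + y + 1)); last by lra.
  rewrite -mulrA [X in _ <= X](_ : _ = 2 * (2 * x * y * (1 - k))); last first.
    by rewrite -h1; ring.
  have -> : 2 * (2 * x * y * (1 - k)) = y * ((1 - k) * (4 * x)) by ring.
  by rewrite ler_pM2l// ler_pM2l ?subr_gt0//; lra.
case: (leP n l) => nl.
  apply: (outside_tangent a_gt0 b_gt0 cs).
  have -> : dot (N c s) (l *: pt c s + n *: pt c' s' - pt c s) =
     (l + n - 1) * dot (N c s) (pt c s) + n * dot (N c s) (pt c' s' - pt c s).
    by rewrite /dot /= !scaleRE; ring.
  have := key l n l0 n0 nl ln1 ln.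
  move/(ler_wpM2r (ltW Np)) => h1; have := mulr_gt0 n0 np; lra.
apply: (outside_tangent a_gt0 b_gt0 cs').
have -> : dot (N c' s') (l *: pt c s + n *: pt c' s' - pt c' s') =
   (l + n - 1) * dot (N c' s') (pt c' s') + l * dot (N c' s') (pt c s - pt c' s').
  by rewrite /dot /= !scaleRE; ring.
have ln1' : 1 < n + l by rewrite addrC.
have ln' : n ^+ 2 + l ^+ 2 + 2 * n * l * k = 1 by apply: (etrans _ ln); ring.
have := key n l n0 l0 (ltW nl) ln1' ln'.
move/(ler_wpM2r (ltW Nm)) => h1; have := mulr_gt0 l0 nm; lra.
Qed.

Lemma outer_arrival_energy omega hE c s c' s' (k := outer_cos omega hE (pt c s) (pt c' s'))
    (L := 2 * hE / omega ^+ 2) :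
  0 < omega -> 0 < hE ->
  0 <= dot (pt c s) (pt c' s') ^+ 2 -
    L * (dot (pt c s) (pt c s) + dot (pt c' s') (pt c' s') - L) ->
  -1 < k < 1 ->
  dot (outer_arrival omega hE (pt c s) (pt c' s')) (outer_arrival omega hE (pt c s) (pt c' s')) =
    2 * V_outer omega hE P (P + pt c' s').
Proof.
move=> o0 h0 disc k1.
have [z [u [T [zN T0 _ [zT uT] _]]]] := outer_connection P o0 h0 disc k1.
have [_ _] := zN T; rewrite zT uT sqr_enorm => e.
by lra.
Qed.

End EllipseArcs.

(** * Fixed points indexed by bi-infinite sequences *)

Section CodedFixedPoint.
Context {R : realType}.

Definition unshift (s : int -> bool) : int -> bool := fun i => s (i - 1).
Notation shift s := (bernoulli_shift (A := bool) s).

Lemma shift_unshift s : shift (unshift s) = s.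
Proof. by apply/funext => i; rewrite /bernoulli_shift /unshift addrK. Qed.

Lemma unshift_shift s : unshift (shift s) = s.
Proof. by apply/funext => i; rewrite /bernoulli_shift /unshift subrK. Qed.

Lemma bernoulli_shift0 s : shift s 0 = s 1.
Proof. by rewrite /bernoulli_shift add0r. Qed.

Lemma unshift0 s : unshift s 0 = s (- 1).
Proof. by rewrite /unshift sub0r. Qed.

Lemma nbhs_cylinder (s : bisequence bool) (n : nat) :
  \forall s' \near s, forall j : int, (`|j| <= n)%N -> s' j = s j.
Proof.
have one (j : int) : \forall s' \near s, s' j = s j.
  have := @proj_continuous _ (fun _ : int => discrete_topology bool) j s.
  by move=> /(_ [set s j]); apply; exact: discrete_set1.
elim: n => [|n IH].
  apply: filterS (one 0) => s' e j; rewrite leqn0 absz_eq0 => /eqP ->.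
  exact: e.
apply: filterS3 IH (one n.+1%:Z) (one (- n.+1%:Z)) => s' e1 e2 e3 j.
rewrite leq_eqVlt => /orP[/eqP jn|]; last exact: e1.
by case: j jn => j /= [->] //; rewrite NegzE.
Qed.

(** Continuity for the product topology, in terms of the central window of a
    sequence. *)
Definition cylinder_continuous (f : (int -> bool) -> R) : Prop :=
  forall (s : int -> bool) (e : R), 0 < e -> exists n : nat, forall s' : int -> bool,
    (forall j : int, (`|j| <= n)%N -> s' j = s j) -> `|f s - f s'| <= e.

Lemma cylinder_continuousP f : cylinder_continuous f ->
  continuous (f : bisequence bool -> R).
Proof.
move=> fc s; apply/cvgrPdist_le => e e0; have [n fn] := fc s e e0.
exact: filterS fn (nbhs_cylinder s n).
Qed.

Lemma cylinder_continuous_shift f : cylinder_continuous f ->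
  cylinder_continuous (fun s => f (shift s)).
Proof.
move=> fc s e e0; have [n fn] := fc (shift s) e e0; exists n.+1 => s' ss'.
by apply: fn => j jn; rewrite /bernoulli_shift ss'//; lia.
Qed.

Lemma half_powers_eq0 (c K : R) : (forall n, `|c| <= K / 2 ^+ n) -> c = 0.
Proof.
move=> cK; apply/eqP; rewrite -normr_eq0; apply: contraT => c0.
have {}c0 : 0 < `|c| by rewrite lt_def c0 normr_ge0.
have [n Kn] : exists n : nat, K / `|c| < n%:R.
  by exists (Num.truncn (K / `|c|)).+1; exact: truncnS_gt.
have := cK n; rewrite ler_pdivlMr ?exprn_gt0//.
rewrite ltr_pdivrMr// in Kn; move=> h.
have n2 : n%:R <= 2 ^+ n :> R by rewrite -natrX ler_nat ltnW// ltn_expl.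
have := ler_wpM2l (ltW c0) n2; lra.
Qed.

(** The unknowns X s, one for each sequence s, are coupled along the shift
    orbits.  Iterating the contraction phi from 0, the n-th approximation depends
    only on the symbols of index at most n in absolute value; the limit is
    therefore continuous in s, uniformly approached at the rate 2 ^ - n. *)
Variables (rho : R)
  (phi : (int -> bool) -> (bool -> R) -> (bool -> R) -> (bool -> R) -> bool -> R).
Hypothesis rho_ge0 : 0 <= rho.
Let box (Z : bool -> R) := forall b, `|Z b| <= rho.
Hypothesis phi_box : forall s Z1 Z2 Z3, box Z1 -> box Z2 -> box Z3 ->
  box (phi s Z1 Z2 Z3).
Hypothesis phi_contraction : forall s Z1 Z2 Z3 Z1' Z2' Z3' (d : R),
  box Z1 -> box Z2 -> box Z3 -> box Z1' -> box Z2' -> box Z3' ->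
  (forall b, `|Z1 b - Z1' b| <= d) -> (forall b, `|Z2 b - Z2' b| <= d) ->
  (forall b, `|Z3 b - Z3' b| <= d) ->
  forall b, `|phi s Z1 Z2 Z3 b - phi s Z1' Z2' Z3' b| <= d / 2.
Hypothesis phi_local : forall s s' Z1 Z2 Z3,
  (forall j : int, (`|j| <= 1)%N -> s j = s' j) -> phi s Z1 Z2 Z3 = phi s' Z1 Z2 Z3.

Fixpoint approx n (s : int -> bool) : bool -> R :=
  if n is n'.+1 then
    phi s (approx n' (unshift s)) (approx n' s) (approx n' (shift s))
  else fun=> 0.

Let approx_box n s : box (approx n s).
Proof.
elim: n s => [|n IH] s b /=; first by rewrite normr0.
exact: phi_box.
Qed.

Let approx_step n s b : `|approx n.+1 s b - approx n s b| <= rho / 2 ^+ n.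
Proof.
elim: n s b => [|n IH] s b.
  by rewrite expr0 divr1 /= subr0; apply: phi_box => c; rewrite normr0.
rewrite exprSr invfM mulrA; apply: phi_contraction;
  by [exact: approx_box | exact: (@approx_box n.+1) | exact: IH].
Qed.

(* The intervals of centre y n and radius d n are nested; the limit is the
   supremum of their left ends. *)
Let approx_limit s b : exists x : R, forall n, `|x - approx n s b| <= 2 * rho / 2 ^+ n.
Proof.
pose y n := approx n s b; pose d n : R := 2 * rho / 2 ^+ n.
have dS n : d n = 2 * d n.+1 by rewrite /d exprSr; field; rewrite expf_neq0.
have step n : `|y n.+1 - y n| <= d n.+1.
  by rewrite (le_trans (approx_step n s b))// /d exprSr; rewrite le_eqVlt; apply/orP; left;
    apply/eqP; field; rewrite expf_neq0.
have dec n m : y (m + n)%N - d (m + n)%N >= y n - d n /\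
    y (m + n)%N + d (m + n)%N <= y n + d n.
  elim: m => [|m [l u]]; first by rewrite add0n.
  have := step (m + n)%N; rewrite addSn ler_norml => /andP[]; have := dS (m + n)%N.
  by move=> ? ? ?; split; lra.
have d0 n : 0 <= d n by rewrite divr_ge0 ?mulr_ge0 ?exprn_ge0.
have lu m n : y m - d m <= y n + d n.
  have [l _] := dec m n; have [_ u] := dec n m; rewrite addnC in u.
  by have := d0 (n + m)%N; lra.
pose A := [set y n - d n | n in [set: nat]].
have Aub n : ubound A (y n + d n) by move=> _ [m _ <-]; exact: lu.
have A0 : A !=set0 by exists (y 0%N - d 0%N), 0%N.
exists (sup A) => n; rewrite ler_distl; apply/andP; split.
  by apply: sup_upper_bound; [split => //; exists (y n + d n) | exists n].
by apply: ge_sup A0 _; exact: Aub.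
Qed.

Let approx_local n s s' : (forall j : int, (`|j| <= n)%N -> s j = s' j) ->
  approx n s = approx n s'.
Proof.
elim: n s s' => [//|n IH] s s' ss' /=.
rewrite (IH (unshift s) (unshift s')) ?(IH s s') ?(IH (shift s) (shift s')).
- by apply: phi_local => j j1; apply: ss'; exact: leq_trans j1 _.
- by move=> j jn; rewrite /bernoulli_shift ss'//; lia.
- by move=> j jn; apply: ss'; exact: leqW.
- by move=> j jn; rewrite /unshift ss'//; lia.
Qed.

(** One fixed point for each sequence, compatible with the shift, instead of one
    in the space of bounded sequences: contraction gives existence and the locality
    of phi gives continuity in the sequence. *)
Lemma coded_fixed_point : exists X : (int -> bool) -> bool -> R,
  [/\ forall s b, `|X s b| <= rho,
      forall s b, X s b = phi s (X (unshift s)) (X s) (X (shift s)) b &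
      forall b, cylinder_continuous (fun s => X s b)].
Proof.
have [X XE] : exists X : (int -> bool) -> bool -> R,
    forall s b n, `|X s b - approx n s b| <= 2 * rho / 2 ^+ n.
  exists (fun s b => projT1 (cid (approx_limit s b))) => s b.
  by case: cid.
have Xbox s : box (X s).
  move=> b; rewrite leNgt; apply/negP => rX.
  have : `|X s b| - rho = 0.
    apply: (@half_powers_eq0 _ (2 * rho)) => n.
    have h0 : 0 <= `|X s b| - rho by rewrite subr_ge0 ltW.
    rewrite (ger0_norm h0).
    apply: le_trans (XE s b n); rewrite lerBlDr.
    apply: (le_trans (_ : _ <= `|X s b - approx n s b| + `|approx n s b|)).
      by rewrite -[in leLHS](subrK (approx n s b) (X s b)) ler_normD.
    by rewrite lerD2l; exact: approx_box.
  by move/eqP; rewrite subr_eq0 gt_eqF.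
exists X; split => //.
- move=> s b; apply/eqP; rewrite -subr_eq0; apply/eqP.
  apply: (@half_powers_eq0 _ (2 * rho)) => n.
  set w := phi _ _ _ _ _.
  have -> : X s b - w = (X s b - approx n.+1 s b) + (approx n.+1 s b - w) by ring.
  rewrite (le_trans (ler_normD _ _))//.
  have h1 := XE s b n.+1.
  have h2 : `|approx n.+1 s b - w| <= 2 * rho / 2 ^+ n / 2.
    rewrite /w /=; apply: phi_contraction => //; try exact: approx_box;
      by move=> b'; rewrite distrC.
  apply: (le_trans (lerD h1 h2)); rewrite le_eqVlt; apply/orP; left;
  apply/eqP; rewrite exprSr; field.
  by rewrite expf_neq0.
- move=> b s e e0.
  have [n ne] : exists n : nat, 4 * rho / 2 ^+ n <= e.
    apply: contrapT => /forallNP H.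
    have : e = 0.
      apply: (@half_powers_eq0 _ (4 * rho)) => n; rewrite gtr0_norm//.
      by apply: ltW; rewrite ltNge; exact/negP/H.
    by move/eqP; rewrite gt_eqF.
  exists n => s' ss'.
  have ap : approx n s = approx n s' by apply: approx_local => j /ss' ->.
  have -> : X s b - X s' b = (X s b - approx n s b) - (X s' b - approx n s' b).
    by rewrite ap; ring.
  rewrite (le_trans (ler_normB _ _))//; apply: le_trans ne.
  apply: (le_trans (lerD (XE s b n) (XE s' b n))); rewrite le_eqVlt; apply/orP; left.
  by apply/eqP; field; rewrite expf_neq0.
Qed.

End CodedFixedPoint.

(** * Conjugacy with the Bernoulli shift *)

Section Bernoulli.
(** The coding g need not be injective a priori.  The map f, being functional
    along g, recovers the future symbols of s from g s; the past ones are
    recovered by g_backward, that is by the injectivity of the dynamics. *)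
Variables (T : choiceType) (Y : topologicalType) (iota : T -> Y).
Variables (f : T -> T -> Prop) (g : bisequence bool -> T).
Hypothesis Y_hausdorff : hausdorff_space Y.
Hypothesis g_continuous : continuous (iota \o g).
Hypothesis iota_inj : forall s s', iota (g s) = iota (g s') -> g s = g s'.
Hypothesis f_shift : forall s, f (g s) (g (bernoulli_shift s)).
Hypothesis f_functional : forall s y, f (g s) y -> y = g (bernoulli_shift s).
Hypothesis g_symbol : forall s s', g s = g s' -> s 0 = s' 0.
Hypothesis g_backward : forall s s', g s = g s' -> g (unshift s) = g (unshift s').

Lemma coding_inj s s' : g s = g s' -> s = s'.
Proof.
move=> ss'; apply/funext => i; case: i => n.
  have : forall s s', g s = g s' -> s n%:Z = s' n%:Z.
    elim: n => [|n IH] r r' rr'; first exact: g_symbol.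
    have -> : n.+1%:Z = n%:Z + 1 by rewrite intS addrC.
    apply: (IH (bernoulli_shift r) (bernoulli_shift r')).
    by apply/esym/f_functional; rewrite rr'; exact: f_shift.
  exact.
have : forall s s', g s = g s' -> s (Negz n) = s' (Negz n).
  elim: n => [|n IH] r r' rr'; first exact: (g_symbol (g_backward rr')).
  have -> : Negz n.+1 = Negz n - 1 by rewrite !NegzE intS opprD addrC.
  exact: (IH (unshift r) (unshift r') (g_backward rr')).
exact.
Qed.

Let g_inj : injective (iota \o g).
Proof. by move=> s s' /iota_inj /coding_inj. Qed.

Lemma compact_bisequence : compact [set: bisequence bool].
Proof.
have := @tychonoff int (fun _ => discrete_topology bool) (fun _ => setT).
move=> /(_ (fun _ => finite_compact (@finite_finset _ [set: bool]))).
by rewrite (_ : [set _ | _] = setT) //; apply/seteqP; split.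
Qed.

(** The inverse h of g on its range is continuous, as g is a continuous
    injection of a compact space into a Hausdorff one: the preimage by h of a
    closed set is the trace of its compact image. *)
Lemma bernoulli_of_coding :
  has_bernoulli_subsystem (f : initial_topology iota -> initial_topology iota -> Prop).
Proof.
pose X : set (initial_topology iota) := range g.
pose h (x : initial_topology iota) : bisequence bool :=
  if pselect (exists s, g s = x) is left e then projT1 (cid e) else (fun=> false).
have gK s : h (g s) = s.
  rewrite /h; case: pselect => [e|[]]; last by exists s.
  by case: cid => s' /= e'; apply: g_inj; rewrite /= e'.
exists (bool : finType), X, h, g; split.
- by rewrite card_bool.
- split.
    apply/continuous_closedP => C Cc; apply/closed_subspaceP.
    exists (iota @^-1` ((iota \o g) @` C)).
      have closedF : closed ((iota \o g) @` C).
        apply: compact_closed => //; apply: continuous_compact.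
          exact: continuous_subspaceT.
        rewrite -[C]setTI; apply: compact_closedI => //; exact: compact_bisequence.
      move/continuous_closedP: (@initial_continuous _ _ iota); exact.
    apply/seteqP; split=> [x [[s' Cs' e] [s _ sx]]|x [+ [s _ sx]]].
      split; last by exists s.
      by move: e; rewrite -sx => /g_inj e; change (C (h (g s))); rewrite gK -e.
    rewrite -sx => Cs; have {}Cs : C (h (g s)) := Cs.
    by rewrite gK in Cs; split; exists s.
  apply/continuousP => _ [A Ao <-].
  by move/continuousP: g_continuous => /(_ A Ao).
- by move=> x [s _ <-]; rewrite gK.
- by move=> s; split; [exists s | exact: gK].
- move=> _ [s _ <-]; split; first by exists (g (bernoulli_shift s)).
  move=> y /f_functional ->; split; first by exists (bernoulli_shift s).
  by rewrite !gK.
Qed.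

End Bernoulli.

(** * Arrival velocities at high energy *)

Section VectorLipschitz.
Context {R : realType} {H X : Type}.
Variables (W : H -> Prop) (D : X -> Prop) (d : X -> X -> R).
Hypothesis d_ge0 : forall x y, 0 <= d x y.
Implicit Types (f g : H -> X -> R) (p q : H -> X -> R * R).

Definition vlip p := ulip W D d (fun h x => (p h x).1) /\ ulip W D d (fun h x => (p h x).2).

Lemma eq_ulip f g : (forall h x, W h -> D x -> f h x = g h x) ->
  ulip W D d f -> ulip W D d g.
Proof.
move=> fg [K K0 fK]; exists K => // h x y Wh Dx Dy.
by rewrite -!fg//; exact: fK.
Qed.

Lemma ulipB f g : ulip W D d f -> ulip W D d g -> ulip W D d (fun h x => f h x - g h x).
Proof. by move=> fl gl; apply: ulipD => //; exact: ulipN. Qed.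

Lemma vlipD p q : vlip p -> vlip q -> vlip (fun h x => p h x + q h x).
Proof. by move=> [? ?] [? ?]; split; exact: ulipD. Qed.

Lemma vlipZ f p : ulip W D d f -> vlip p -> vlip (fun h x => f h x *: p h x).
Proof.
by move=> fl [? ?]; split; under eq_fun do under eq_fun do rewrite /= scaleRE; exact: ulipM.
Qed.

Lemma vlipN p : vlip p -> vlip (fun h x => - p h x).
Proof. by move=> [? ?]; split; exact: ulipN. Qed.

Lemma vlipB p q : vlip p -> vlip q -> vlip (fun h x => p h x - q h x).
Proof. by move=> pl ql; apply: vlipD => //; exact: vlipN. Qed.

Lemma vlip_const (c : R * R) : vlip (fun _ _ => c).
Proof. by split; exact: ulip_const. Qed.

Lemma ulip_dot p q : vlip p -> vlip q -> ulip W D d (fun h x => dot (p h x) (q h x)).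
Proof. by move=> [? ?] [? ?]; apply: ulipD => //; exact: ulipM. Qed.

Lemma vlip_frame (E : ellipse R) f g : ulip W D d f -> ulip W D d g ->
  vlip (fun h x => frame E (f h x) (g h x)).
Proof. by move=> fl gl; apply: vlipD; apply: vlipZ => //; exact: vlip_const. Qed.

Lemma ulip_enorm p (r : R) : 0 < r -> (forall h x, W h -> D x -> r <= dot (p h x) (p h x)) ->
  vlip p -> ulip W D d (fun h x => enorm (p h x)).
Proof. by move=> r0 rp pl; apply: (ulip_sqrt d_ge0 r0 rp); exact: ulip_dot. Qed.

Lemma ulip_norm_bound f : ulip W D d f ->
  exists2 K, 0 < K & forall h x, W h -> D x -> `|f h x| <= K.
Proof.
move=> [K K0 fK]; exists (K + 1); first by rewrite ltr_wpDl.
by move=> h x Wh Dx; have [fx _] := fK h x x Wh Dx Dx; rewrite (le_trans fx)// lerDl.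
Qed.

End VectorLipschitz.

Section ArrivalDefect.
Context {R : realType}.
Implicit Types (p q tau : R * R) (eta : R).

(** At infinite energy the velocity at q is radial, hence proportional to q.  Its
    component along a tangent vector tau is, up to a positive factor,
    arrival_tangent; the defect is the difference with the radial value dot q tau,
    divided by eta.  Its expression does not contain the inverse of eta, and so is
    bounded and Lipschitz uniformly as eta tends to 0. *)
Definition bend_rate eta p q : R :=
  (half_dot p q + Num.sqrt (half_dot p q ^+ 2 + eta ^+ 2 + eta * (enorm p + enorm q)))^-1.

Definition arrival_tangent eta p q tau : R :=
  (dot q tau + bend eta p q * dot (bisector p q) tau) / Num.sqrt (1 - bend eta p q ^+ 2).

Definition arrival_defect eta p q tau : R :=
  bend_rate eta p q * dot (bisector p q) tau / Num.sqrt (1 - bend eta p q ^+ 2) +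
  dot q tau * (eta * bend_rate eta p q ^+ 2) /
    (Num.sqrt (1 - bend eta p q ^+ 2) * (1 + Num.sqrt (1 - bend eta p q ^+ 2))).

Lemma dot_arrival (mu h : R) p q tau : dot (arrival mu h p q) tau =
  Num.sqrt (2 * h) / enorm q * arrival_tangent (mu / h) p q tau.
Proof.
rewrite /arrival dotZl dotDl dotZl /arrival_tangent invfM.
by rewrite -!mulrA; congr (_ * (_ * _)); rewrite mulrC.
Qed.

(** 1 / s - 1 = x ^ 2 / (s (1 + s)) for s ^ 2 = 1 - x ^ 2, and x is eta times
    bend_rate. *)
Lemma arrival_tangentE eta p q tau : 0 < half_dot p q -> 0 < eta ->
  arrival_tangent eta p q tau = dot q tau + eta * arrival_defect eta p q tau.
Proof.
move=> m0 e0; have [x0 x1 _] := bend_eq m0 e0.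
have xE : bend eta p q = eta * bend_rate eta p q by [].
have s20 : 0 < 1 - bend eta p q ^+ 2 by rewrite subr_gt0 expr_lt1// ltW.
rewrite /arrival_tangent /arrival_defect; set s := Num.sqrt _.
have s0 : 0 < s by rewrite sqrtr_gt0.
have s1 : 1 + s != 0 by rewrite gt_eqF// addr_gt0.
have s2 : s ^+ 2 = 1 - (eta * bend_rate eta p q) ^+ 2 by rewrite -xE sqr_sqrtr// ltW.
rewrite xE; set y := bend_rate _ _ _ in s2 *.
have E : eta ^+ 2 * y ^+ 2 = 1 - s ^+ 2 by rewrite s2; ring.
have -> : eta * (y * dot (bisector p q) tau / s + dot q tau * (eta * y ^+ 2) / (s * (1 + s))) =
   eta * y * dot (bisector p q) tau / s + dot q tau * (eta ^+ 2 * y ^+ 2) / (s * (1 + s)).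
  by field; rewrite s1 gt_eqF.
by rewrite E; field; rewrite s1 gt_eqF.
Qed.

Lemma bend_rate_bound eta p q (m : R) : 0 <= eta -> 0 < m -> m <= half_dot p q ->
  0 < bend_rate eta p q /\ bend_rate eta p q <= m^-1.
Proof.
move=> e0 m0 mh; have h0 : 0 < half_dot p q by exact: lt_le_trans mh.
rewrite /bend_rate; set S := Num.sqrt _; have S0 : 0 <= S by exact: sqrtr_ge0.
have mS : m <= half_dot p q + S by rewrite (le_trans mh)// lerDl.
have mS0 : 0 < half_dot p q + S by exact: lt_le_trans mS.
by rewrite invr_gt0 mS0 lef_pV2.
Qed.

Lemma bend_bound eta p q (m : R) : 0 <= eta -> 0 < m -> m <= half_dot p q ->
  0 <= bend eta p q <= eta / m.
Proof.
move=> e0 m0 mh; have [y0 ym] := bend_rate_bound e0 m0 mh.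
have xE : bend eta p q = eta * bend_rate eta p q by [].
by rewrite xE mulr_ge0 ?(ltW y0)//= ler_wpM2l.
Qed.

Lemma vlip_bisector {H X : Type} (W : H -> Prop) (D : X -> Prop) (d : X -> X -> R)
    (p q : H -> X -> R * R) (r m : R) : (forall x y, 0 <= d x y) ->
  0 < r -> 0 < m ->
  (forall h x, W h -> D x -> r <= dot (p h x) (p h x)) ->
  (forall h x, W h -> D x -> r <= dot (q h x) (q h x)) ->
  (forall h x, W h -> D x -> m <= half_dot (p h x) (q h x)) ->
  vlip W D d p -> vlip W D d q ->
  ulip W D d (fun h x => half_dot (p h x) (q h x)) /\
  vlip W D d (fun h x => bisector (p h x) (q h x)).
Proof.
move=> d0 r0 m0 rp rq mh pl ql.
have np : ulip W D d (fun h x => enorm (p h x)) by exact (ulip_enorm d0 r0 rp pl).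
have nq : ulip W D d (fun h x => enorm (q h x)) by exact (ulip_enorm d0 r0 rq ql).
have hd : ulip W D d (fun h x => half_dot (p h x) (q h x)).
  apply: (@ulip_sqrt _ _ _ _ _ _ d0 _ (m ^+ 2)); first by rewrite exprn_gt0.
    move=> h x Wh Dx; have mm := mh h x Wh Dx.
    have hd0 : 0 < half_dot (p h x) (q h x) by exact: lt_le_trans mm.
    have := hd0; rewrite half_dot_gt0 => pq0.
    rewrite -[leRHS]sqr_sqrtr; last by rewrite divr_ge0// ltW.
    by rewrite lerXn2r// nnegrE ltW.
  apply: ulipM; last exact: ulip_const.
  by apply: ulipD => //; [exact: ulipM | exact: ulip_dot].
split => //; apply: vlipZ.
  apply: (@ulipV _ _ _ _ _ _ d0 _ (2 * m)); first by rewrite mulr_gt0.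
    by move=> h x Wh Dx; rewrite ler_wpM2l// mh.
  by apply: ulipM => //; exact: ulip_const.
by apply: vlipD; exact: vlipZ.
Qed.

Lemma ulip_arrival_defect {X : Type} (D : X -> Prop) (d : X -> X -> R) (e0 r m : R)
    (p q tau : R -> X -> R * R) (W := fun eta : R => 0 < eta <= e0) :
  (forall x y, 0 <= d x y) -> 0 < r -> 0 < m -> e0 <= m / 2 ->
  (forall h x, W h -> D x -> r <= dot (p h x) (p h x)) ->
  (forall h x, W h -> D x -> r <= dot (q h x) (q h x)) ->
  (forall h x, W h -> D x -> m <= half_dot (p h x) (q h x)) ->
  vlip W D d p -> vlip W D d q -> vlip W D d tau ->
  ulip W D d (fun h x => arrival_defect h (p h x) (q h x) (tau h x)).
Proof.
move=> d0 r0 m0 em rp rq mh pl ql tl.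
have [hd bl] := vlip_bisector d0 r0 m0 rp rq mh pl ql.
have np : ulip W D d (fun h x => enorm (p h x)) by exact (ulip_enorm d0 r0 rp pl).
have nq : ulip W D d (fun h x => enorm (q h x)) by exact (ulip_enorm d0 r0 rq ql).
have el : ulip W D d (fun h _ => h).
  by apply: (@ulip_cst _ _ _ _ _ _ d0 _ e0) => h /andP[h0 he]; rewrite gtr0_norm.
have yl : ulip W D d (fun h x => bend_rate h (p h x) (q h x)).
  apply: (@ulipV _ _ _ _ _ _ d0 _ m) => //.
    move=> h x Wh Dx; rewrite (le_trans (mh h x Wh Dx))// lerDl; exact: sqrtr_ge0.
  apply: ulipD => //.
  apply: (@ulip_sqrt _ _ _ _ _ _ d0 _ (m ^+ 2)); first by rewrite exprn_gt0.
    move=> h x Wh Dx; have [h0 _] := andP Wh; have mm := mh h x Wh Dx.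
    have m2 : m ^+ 2 <= half_dot (p h x) (q h x) ^+ 2.
      by rewrite lerXn2r// nnegrE ?(ltW m0)// (le_trans _ mm)// ltW.
    rewrite -addrA (le_trans m2)// lerDl addr_ge0 ?sqr_ge0//.
    by rewrite mulr_ge0 ?addr_ge0 ?enorm_ge0// ltW.
  by repeat first [apply: ulipD | exact: ulipX | apply: ulipM].
have xl : ulip W D d (fun h x => bend h (p h x) (q h x)) by exact: ulipM el yl.
have sge h x : W h -> D x -> 1 / 2 <= Num.sqrt (1 - bend h (p h x) (q h x) ^+ 2) /\
    1 / 4 <= 1 - bend h (p h x) (q h x) ^+ 2.
  move=> Wh Dx; have [h0 he] := andP Wh.
  have /andP[x0 xm] := bend_bound (ltW h0) m0 (mh h x Wh Dx).
  have x12 : bend h (p h x) (q h x) <= 1 / 2.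
    by rewrite (le_trans xm)// ler_pdivrMr//; lra.
  have h4 : 1 / 4 <= 1 - bend h (p h x) (q h x) ^+ 2 by nra.
  split => //; rewrite -(ler_pXn2r (n := 2)) ?nnegrE ?sqrtr_ge0 ?divr_ge0// sqr_sqrtr.
    by lra.
  by lra.
have sl : ulip W D d (fun h x => Num.sqrt (1 - bend h (p h x) (q h x) ^+ 2)).
  apply: (@ulip_sqrt _ _ _ _ _ _ d0 _ (1 / 4)); first by rewrite divr_gt0.
    by move=> h x Wh Dx; have [] := sge h x Wh Dx.
  by apply: ulipB => //; [exact: ulip_const | exact: ulipX].
have siV : ulip W D d (fun h x => (Num.sqrt (1 - bend h (p h x) (q h x) ^+ 2))^-1).
  apply: (@ulipV _ _ _ _ _ _ d0 _ (1 / 2)); [by rewrite divr_gt0 | | exact: sl].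
  by move=> h x Wh Dx; have [] := sge h x Wh Dx.
rewrite /arrival_defect; apply: ulipD.
  by apply: ulipM => //; apply: ulipM => //; exact: ulip_dot.
apply: ulipM; first by apply: ulipM; [exact: ulip_dot | apply: ulipM => //; exact: ulipX].
apply: (@ulipV _ _ _ _ _ _ d0 _ (1 / 2)); first by rewrite divr_gt0.
  by move=> h x Wh Dx; have [h2 _] := sge h x Wh Dx; nra.
by apply: ulipM => //; apply: ulipD => //; exact: ulip_const.
Qed.

End ArrivalDefect.

(** * Charts of the ellipse at two critical points *)

Section SmallBoxes.
Context {R : realType}.
Implicit Types (f : R -> R) (r : R).

Definition dbox r (x : R * R) : Prop := `|x.1| <= r /\ `|x.2| <= r.

Lemma dboxI r (t t' : R) : `|t| <= r -> `|t'| <= r -> dbox r (t, t').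
Proof. by []. Qed.

Lemma dbox_le r r' z : r' <= r -> dbox r' z -> dbox r z.
Proof. by move=> rr [h1 h2]; split; exact: le_trans rr. Qed.

Lemma lipschitz_of_derive f f' (K r : R) :
  (forall x : R, is_derive x 1 f (f' x)) -> (forall x : R, `|x| <= r -> `|f' x| <= K) ->
  forall x y : R, `|x| <= r -> `|y| <= r -> `|f x - f y| <= K * `|x - y|.
Proof.
move=> df fK x y; wlog xy : x y / x < y => [H xr yr|xr yr].
  have [xy|xy|->] := ltgtP x y; first exact: H.
    by rewrite distrC (distrC x); exact: H.
  by rewrite !subrr normr0 mulr0.
have fc : continuous f by move=> z; exact: is_derive_continuous (df z).
have [c] := MVT xy (fun z _ => df z) (continuous_subspaceT fc).
rewrite in_itv /= => /andP[xc cy] e.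
rewrite distrC e normrM (distrC x) ler_wpM2r// fK//.
move: xr yr; rewrite !ler_norml => /andP[x1 x2] /andP[y1 y2].
by rewrite (le_trans x1 (ltW xc)) (le_trans (ltW cy)).
Qed.

Lemma cos_lipschitz (x y : R) : `|cos x - cos y| <= `|x - y|.
Proof.
rewrite -[leRHS]mul1r; apply: (@lipschitz_of_derive cos (fun z => - sin z) 1 (`|x| + `|y|)).
- by move=> z _; rewrite normrN ler_norml sin_geN1 sin_le1.
- by rewrite lerDl.
- by rewrite lerDr.
Qed.

Lemma sin_lipschitz (x y : R) : `|sin x - sin y| <= `|x - y|.
Proof.
rewrite -[leRHS]mul1r; apply: (@lipschitz_of_derive sin cos 1 (`|x| + `|y|)).
- by move=> z _; rewrite ler_norml cos_geN1 cos_le1.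
- by rewrite lerDl.
- by rewrite lerDr.
Qed.

Lemma ulip_trig {H : Type} (W : H -> Prop) (D : R * R -> Prop) :
  [/\ ulip W D dist1 (fun _ x => cos x.1), ulip W D dist1 (fun _ x => sin x.1),
      ulip W D dist1 (fun _ x => cos x.2) & ulip W D dist1 (fun _ x => sin x.2)].
Proof.
split; exists 1 => // _ x y _ _ _; rewrite mul1r.
- by split; [rewrite ler_norml cos_geN1 cos_le1 | rewrite (le_trans (cos_lipschitz _ _))// lerDl].
- by split; [rewrite ler_norml sin_geN1 sin_le1 | rewrite (le_trans (sin_lipschitz _ _))// lerDl].
- by split; [rewrite ler_norml cos_geN1 cos_le1 | rewrite (le_trans (cos_lipschitz _ _))// lerDr].
- by split; [rewrite ler_norml sin_geN1 sin_le1 | rewrite (le_trans (sin_lipschitz _ _))// lerDr].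
Qed.

Lemma small_pos r (f : unit -> R * R -> R) : 0 < r ->
  ulip (fun _ => True) (dbox r) dist1 f -> 0 < f tt (0, 0) ->
  exists r', [/\ 0 < r', r' <= r & forall x, dbox r' x -> f tt (0, 0) / 2 <= f tt x].
Proof.
move=> r0 [K K0 fK] f0; pose e := f tt (0, 0) / (4 * (K + 1)).
have K1 : 0 < 4 * (K + 1) by rewrite mulr_gt0// ltr_wpDl.
have e0 : 0 < e by rewrite divr_gt0.
exists (Num.min r e); split; [by rewrite lt_min r0 | by rewrite ge_min lexx |].
move=> x xb.
have xr : dbox r x by apply: dbox_le xb; rewrite ge_min lexx.
have [x1 x2] : dbox e x by apply: dbox_le xb; rewrite ge_min lexx orbT.
have z0 : dbox r (0, 0) by split; rewrite normr0 ltW.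
have [_] := fK tt x (0, 0) I xr z0; rewrite /dist1 /= !subr0 ler_distl => /andP[h _].
have eE : f tt (0, 0) = e * (4 * (K + 1)) by rewrite divfK// gt_eqF.
have : K * (`|x.1| + `|x.2|) <= K * (e + e) by rewrite ler_wpM2l// lerD.
nra.
Qed.

End SmallBoxes.

Section Charts.
Context {R : realType}.
Variables (E : ellipse R) (P : R * R).
Let a := semi_major E.
Let b := semi_minor E.
Hypotheses (a_gt0 : 0 < a) (b_gt0 : 0 < b).
Hypothesis P_in : elliptic_domain E P.
Variables (C S : bool -> R).
Hypothesis CS1 : forall i, C i ^+ 2 + S i ^+ 2 = 1.
Implicit Types (i j : bool) (t : R).

(** The chart at the critical point i is the eccentric anomaly counted from it:
    t is the difference of anomalies. *)
Definition cosat i t := C i * cos t - S i * sin t.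
Definition sinat i t := S i * cos t + C i * sin t.
Definition chart i t := bpoint E P (cosat i t) (sinat i t).
Definition chart_tangent i t := btangent E (cosat i t) (sinat i t).
Definition chart_normal i t := bnormal E (cosat i t) (sinat i t).
Definition chart_slope i t := dot (chart i t) (chart_tangent i t).

Lemma cosat_sinat i t : cosat i t ^+ 2 + sinat i t ^+ 2 = 1.
Proof.
transitivity ((C i ^+ 2 + S i ^+ 2) * (cos t ^+ 2 + sin t ^+ 2)).
  by rewrite /cosat /sinat; ring.
by rewrite CS1 cos2Dsin2 mulr1.
Qed.

Lemma cosat0 i : cosat i 0 = C i.
Proof. by rewrite /cosat cos0 sin0; ring. Qed.

Lemma sinat0 i : sinat i 0 = S i.
Proof. by rewrite /sinat cos0 sin0; ring. Qed.

Lemma chart_slopeE i t : chart_slope i t = slope E P (cosat i t) (sinat i t).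
Proof. by rewrite /chart_slope dotC. Qed.

Lemma is_derive_chart_slope i t :
  is_derive t 1 (chart_slope i) (dslope E P (cosat i t) (sinat i t)).
Proof.
have -> : chart_slope i = (fun t => slope E P (cosat i t) (sinat i t)).
  by apply/funext => x; rewrite chart_slopeE.
under eq_fun do rewrite slopeE.
have dc : is_derive t 1 (cosat i) (- sinat i t).
  by rewrite /cosat /sinat; deriv; ring.
have ds : is_derive t 1 (sinat i) (cosat i t).
  by rewrite /cosat /sinat; deriv; ring.
by deriv; rewrite /dslope; ring.
Qed.

Lemma ulip_cosat {H : Type} (W : H -> Prop) (D : R * R -> Prop) i :
  [/\ ulip W D dist1 (fun _ x => cosat i x.1), ulip W D dist1 (fun _ x => sinat i x.1),
      ulip W D dist1 (fun _ x => cosat i x.2) & ulip W D dist1 (fun _ x => sinat i x.2)].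
Proof.
have [c1 s1 c2 s2] := ulip_trig W D; have d0 := @dist1_ge0 R.
have k (r : R) : ulip W D dist1 (fun _ _ => r) by exact: ulip_const.
by split; rewrite /cosat /sinat; [apply: ulipB|apply: ulipD|apply: ulipB|apply: ulipD];
  apply: ulipM.
Qed.

Lemma vlip_chart {H : Type} (W : H -> Prop) (D : R * R -> Prop) i :
  [/\ vlip W D dist1 (fun _ x => chart i x.1) /\ vlip W D dist1 (fun _ x => chart i x.2),
      vlip W D dist1 (fun _ x => chart_normal i x.1) /\
      vlip W D dist1 (fun _ x => chart_normal i x.2) &
      vlip W D dist1 (fun _ x => chart_tangent i x.1) /\
      vlip W D dist1 (fun _ x => chart_tangent i x.2)].
Proof.
have [c1 s1 c2 s2] := ulip_cosat W D i; have d0 := @dist1_ge0 R.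
have k (r : R) : ulip W D dist1 (fun _ _ => r) by exact: ulip_const.
split; split; apply: vlip_frame => //.
- by apply: ulipB => //; exact: ulipM.
- by apply: ulipB => //; exact: ulipM.
- by apply: ulipB => //; exact: ulipM.
- by apply: ulipB => //; exact: ulipM.
- exact: ulipM.
- exact: ulipM.
- exact: ulipM.
- exact: ulipM.
- by apply: ulipN => //; exact: ulipM.
- exact: ulipM.
- by apply: ulipN => //; exact: ulipM.
- exact: ulipM.
Qed.

Lemma bpoint_away : exists2 r : R, 0 < r & forall c s : R, c ^+ 2 + s ^+ 2 = 1 ->
  r <= dot (bpoint E P c s) (bpoint E P c s).
Proof.
have [e e0 eD] := domain_near a_gt0 b_gt0 P_in; exists e => // c s cs.
rewrite leNgt; apply/negP => /ltW /eD /domain_boundary_disjoint; apply.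
exact: bpoint_boundary.
Qed.

(** One step of Newton's method with the derivative at 0, which does not vanish,
    is a contraction near 0. *)
Lemma slope_contraction i : dslope E P (C i) (S i) != 0 ->
  exists2 r : R, 0 < r & forall x y, `|x| <= r -> `|y| <= r ->
    `|(x - chart_slope i x / dslope E P (C i) (S i)) -
      (y - chart_slope i y / dslope E P (C i) (S i))| <= 4^-1 * `|x - y|.
Proof.
move=> D0; set D := dslope _ _ _ _ in D0 *.
pose g t := 1 - dslope E P (cosat i t) (sinat i t) / D.
have gc : {for (0 : R), continuous g}.
  have dc : is_derive (0 : R) 1 (cosat i) (- sinat i 0).
    by rewrite /cosat /sinat; deriv; ring.
  have ds : is_derive (0 : R) 1 (sinat i) (cosat i 0).
    by rewrite /cosat /sinat; deriv; ring.
  have [l dg] : exists l, is_derive (0 : R) 1 g l.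
    by eexists; rewrite /g /dslope; repeat deriv1.
  exact: is_derive_continuous dg.
have g0 : g 0 = 0 by rewrite /g cosat0 sinat0 divff// subrr.
have q4 : 0 < 4^-1 :> R by rewrite invr_gt0.
have [e e0 ge] := near_ballP (cvgr_dist_lt _ _ gc _ q4).
exists (e / 2); first by rewrite divr_gt0.
apply: (@lipschitz_of_derive _ _ g) => [t|t te].
  by have ds := is_derive_chart_slope i t; rewrite /g; deriv; ring.
have /ge : `|t - 0| < e by rewrite subr0; apply: le_lt_trans te _; rewrite ltr_pdivrMr// ltr_pMr// ltr1n.
by rewrite g0 sub0r normrN => /ltW.
Qed.

Lemma finite_radius (Q : bool -> bool -> R -> Prop) :
  (forall i j r r', Q i j r -> 0 < r' -> r' <= r -> Q i j r') ->
  (forall i j, exists2 r, 0 < r & Q i j r) -> exists2 r, 0 < r & forall i j, Q i j r.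
Proof.
move=> mono ex.
have [r1 p1 q1] := ex false false; have [r2 p2 q2] := ex false true.
have [r3 p3 q3] := ex true false; have [r4 p4 q4] := ex true true.
pose r := Num.min (Num.min r1 r2) (Num.min r3 r4).
have r0 : 0 < r by rewrite !lt_min p1 p2 p3 p4.
exists r => // -[] [].
- by apply: mono q4 r0 _; rewrite /r !ge_min lexx !orbT.
- by apply: mono q3 r0 _; rewrite /r !ge_min lexx !orbT.
- by apply: mono q2 r0 _; rewrite /r !ge_min lexx !orbT.
- by apply: mono q1 r0 _; rewrite /r !ge_min lexx.
Qed.

Lemma chart_half_dot i j : 0 < half_dot (bpoint E P (C i) (S i)) (bpoint E P (C j) (S j)) ->
  exists2 r : R, 0 < r & exists2 m : R, 0 < m & forall x, dbox r x ->
    m <= half_dot (chart i x.1) (chart j x.2).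
Proof.
move=> h0; have [e e0 pe] := bpoint_away; have d0 := @dist1_ge0 R.
have [[p1 _] _ _] := vlip_chart (fun _ : unit => True) (dbox 1) i.
have [[_ p2] _ _] := vlip_chart (fun _ : unit => True) (dbox 1) j.
pose f (_ : unit) (x : R * R) := (enorm (chart i x.1) * enorm (chart j x.2) +
  dot (chart i x.1) (chart j x.2)) / 2.
have fl : ulip (fun _ => True) (dbox 1) dist1 f.
  apply: ulipM; last exact: ulip_const.
  apply: ulipD; last exact: ulip_dot.
  apply: ulipM; apply: (ulip_enorm d0 e0) => // _ x _ _; apply: pe; exact: cosat_sinat.
have f0 : 0 < f tt (0, 0).
  by move: h0; rewrite half_dot_gt0 /f /chart !cosat0 !sinat0 => h; rewrite divr_gt0.
have [r [r0 _ rf]] := small_pos ltr01 fl f0.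
exists r => //; exists (Num.sqrt (f tt (0, 0) / 2)).
  by rewrite sqrtr_gt0 divr_gt0.
by move=> x /rf h; rewrite /half_dot ler_wsqrtr.
Qed.

(** The charts stay on the two sides of the minor axis, so that a point of
    the ellipse remembers its chart. *)
Lemma chart_sign i : C i != 0 -> exists2 r : R, 0 < r & forall t, `|t| <= r -> 0 < C i * cosat i t.
Proof.
move=> C0; have d0 := @dist1_ge0 R.
have [c1 _ _ _] := ulip_cosat (fun _ : unit => True) (dbox 1) i.
have fl : ulip (fun _ : unit => True) (dbox 1) dist1 (fun _ x => C i * cosat i x.1).
  by apply: ulipM => //; exact: ulip_const.
have C2 : 0 < C i ^+ 2 by rewrite exprn_even_gt0.
have f0 : 0 < C i * cosat i (0 : R) by rewrite cosat0 -expr2.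
have [r [r0 _ rf]] := small_pos ltr01 fl f0.
exists r => // t tr; apply: (@lt_le_trans _ _ (C i * cosat i 0 / 2)); first by rewrite divr_gt0.
by apply: (rf (t, 0)); split => //=; rewrite normr0 ltW.
Qed.

End Charts.

(** * Perturbed chains and estimates in the charts *)

Section PerturbedChain.
Context {R : realType}.
(** A chain of unknowns X s that solve sl (s 0) (X s) = - G, where G couples X s
    to its neighbours in the orbit of s and is small with its Lipschitz constant,
    while sl i has the simple zero 0.  The unknowns are pairs indexed by bool, in
    view of the refractive billiard, which has two crossings of the ellipse per
    return; in the reflective one, the two members of a pair solve the same
    equation. *)
Variables (rho eps : R) (sl : bool -> R -> R) (D : bool -> R)
  (G : (int -> bool) -> (bool -> R) -> (bool -> R) -> (bool -> R) -> bool -> R).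
Hypotheses (rho_gt0 : 0 < rho) (D_neq0 : forall i, D i != 0) (sl0 : forall i, sl i 0 = 0).
Hypothesis sl_contraction : forall i (x y : R), `|x| <= rho -> `|y| <= rho ->
  `|(x - sl i x / D i) - (y - sl i y / D i)| <= 4^-1 * `|x - y|.
Let box (Z : bool -> R) := forall b, `|Z b| <= rho.
Hypothesis G_bound : forall s Z1 Z2 Z3 b, box Z1 -> box Z2 -> box Z3 ->
  `|G s Z1 Z2 Z3 b| <= eps.
Hypothesis G_lipschitz : forall s Z1 Z2 Z3 Z1' Z2' Z3' (d : R),
  box Z1 -> box Z2 -> box Z3 -> box Z1' -> box Z2' -> box Z3' ->
  (forall b, `|Z1 b - Z1' b| <= d) -> (forall b, `|Z2 b - Z2' b| <= d) ->
  (forall b, `|Z3 b - Z3' b| <= d) ->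
  forall b, `|G s Z1 Z2 Z3 b - G s Z1' Z2' Z3' b| <= eps * d.
Hypothesis G_local : forall s s' Z1 Z2 Z3,
  (forall j : int, (`|j| <= 1)%N -> s j = s' j) -> G s Z1 Z2 Z3 = G s' Z1 Z2 Z3.
Hypothesis eps_small : forall i, eps <= `|D i| / 4 /\ eps <= `|D i| * rho / 4.

(** X = X - (sl X + G) / D, the right-hand side being a contraction by
    1 / 4 + 1 / 4. *)
Lemma perturbed_chain : exists X : (int -> bool) -> bool -> R,
  [/\ forall s b, `|X s b| <= rho,
      forall s b, sl (s 0) (X s b) +
        G s (X (unshift s)) (X s) (X (bernoulli_shift (A := bool) s)) b = 0 &
      forall b, cylinder_continuous (fun s => X s b)].
Proof.
pose phi (s : int -> bool) Z1 Z2 Z3 b :=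
  (Z2 b - sl (s 0) (Z2 b) / D (s 0)) - G s Z1 Z2 Z3 b / D (s 0).
have nD i : 0 < `|D i| by rewrite normr_gt0.
have divD i (x e : R) : `|x| <= e * `|D i| -> `|x / D i| <= e.
  by move=> xe; rewrite normrM normfV ler_pdivrMr.
have := @coded_fixed_point R rho phi (ltW rho_gt0).
case.
- move=> s Z1 Z2 Z3 b1 b2 b3 b; rewrite /phi.
  have z0 : `|0 : R| <= rho by rewrite normr0 ltW.
  have := sl_contraction (s 0) (b2 b) z0; rewrite sl0 mul0r !subr0 => h1.
  have h2 : `|G s Z1 Z2 Z3 b / D (s 0)| <= rho / 4.
    apply: divD; rewrite (le_trans (G_bound _ _ b1 b2 b3))//.
    by have [_ h] := eps_small (s 0); rewrite (le_trans h)//; lra.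
  rewrite (le_trans (ler_normB _ _))// (le_trans (lerD h1 h2))//.
  by move: (b2 b) rho_gt0; move: (`|Z2 b|) => x; lra.
- move=> s Z1 Z2 Z3 Z1' Z2' Z3' d b1 b2 b3 b1' b2' b3' d1 d2 d3 b; rewrite /phi.
  have h1 := sl_contraction (s 0) (b2 b) (b2' b).
  have d0 : 0 <= d by exact: le_trans (d1 b).
  have h2 : `|(G s Z1 Z2 Z3 b - G s Z1' Z2' Z3' b) / D (s 0)| <= d / 4.
    apply: divD; rewrite (le_trans (G_lipschitz _ b1 b2 b3 b1' b2' b3' d1 d2 d3 b))//.
    have [h _] := eps_small (s 0).
    by rewrite (le_trans (ler_wpM2r d0 h))//; lra.
  have h3 := d2 b.
  rewrite [X in `|X|](_ : _ = ((Z2 b - sl (s 0) (Z2 b) / D (s 0)) -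
    (Z2' b - sl (s 0) (Z2' b) / D (s 0))) -
    (G s Z1 Z2 Z3 b - G s Z1' Z2' Z3' b) / D (s 0)); last by ring.
  have e4 : 4^-1 * `|Z2 b - Z2' b| <= 4^-1 * d by rewrite ler_wpM2l.
  rewrite (le_trans (ler_normB _ _))// (le_trans (lerD (h1) h2))//.
  by lra.
- move=> s s' Z1 Z2 Z3 ss'; rewrite /phi (G_local _ _ _ ss').
  by rewrite (ss' 0).
move=> X [Xbox XE Xc]; exists X; split => // s b.
have := XE s b; rewrite /phi => e.
apply: (mulIf (_ : (D (s 0))^-1 != 0)); first by rewrite invr_eq0.
by move/eqP: e; rewrite -subr_eq0 mul0r => /eqP e; rewrite -[RHS]e; ring.
Qed.

End PerturbedChain.

Section ChartEstimates.
Context {R : realType}.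
Variables (E : ellipse R) (P : R * R).
Let a := semi_major E.
Let b := semi_minor E.
Hypotheses (a_gt0 : 0 < a) (b_gt0 : 0 < b).
Hypothesis P_in : elliptic_domain E P.
Variables (C S : bool -> R).
Hypothesis CS1 : forall i, C i ^+ 2 + S i ^+ 2 = 1.
Implicit Types (i j : bool) (x y : R * R) (eta : R).
Local Notation pt := (chart E P C S).
Local Notation N := (chart_normal E C S).
Local Notation tau := (chart_tangent E C S).

Lemma bnormal_bpoint_away : exists2 n : R, 0 < n & forall c s : R,
  c ^+ 2 + s ^+ 2 = 1 -> n <= dot (bnormal E c s) (bpoint E P c s).
Proof.
pose U := xcoord E (P - centre E) / a; pose V := ycoord E (P - centre E) / b.
have UV : U ^+ 2 + V ^+ 2 < 1 by exact: P_coords.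
exists ((1 - (U ^+ 2 + V ^+ 2)) / 2) => [|c s cs].
  by rewrite divr_gt0// subr_gt0.
rewrite dot_frame -/a -/b.
have -> : c / a * (a * c - xcoord E (P - centre E)) + s / b * (b * s - ycoord E (P - centre E))
   = (c ^+ 2 + s ^+ 2) - (c * U + s * V).
  by rewrite /U /V; field; rewrite !gt_eqF.
rewrite cs; have := sqr_ge0 (c - U); have := sqr_ge0 (s - V).
move: U V UV => U V UV; nra.
Qed.

(** The high-energy conditions for an inner arc between two charts: its ends are
    not opposite, it stays in the domain, and it arrives transversally. *)
Definition inner_ok eta i j x : Prop :=
  [/\ 0 < half_dot (pt i x.1) (pt j x.2),
      elliptic_domain E (P + (- bend eta (pt i x.1) (pt j x.2)) *:
        bisector (pt i x.1) (pt j x.2)) &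
      0 < dot (pt j x.2 + bend eta (pt i x.1) (pt j x.2) *:
        bisector (pt i x.1) (pt j x.2)) (N j x.2)].

Definition chart_defect eta i j x : R :=
  arrival_defect eta (pt i x.1) (pt j x.2) (tau j x.2).

(** At eta = 0 the arc runs along the radii to P, which is interior, and it
    arrives transversally, because the ellipse is star-shaped about P.  Both
    conditions are open, and bend is at most eta / m. *)
Lemma inner_pair_data i j (r m : R) : 0 < m ->
  (forall x, dbox r x -> m <= half_dot (pt i x.1) (pt j x.2)) ->
  exists2 e : R, 0 < e & exists2 K : R, 0 < K & forall eta x y, 0 < eta <= e ->
    dbox r x -> dbox r y -> [/\ inner_ok eta i j x, `|chart_defect eta i j x| <= K &
      `|chart_defect eta i j x - chart_defect eta i j y| <= K * dist1 x y].
Proof.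
move=> m0 mh; have [p0 p00 pge] := bpoint_away a_gt0 b_gt0 P_in.
have [n0 n00 nge] := bnormal_bpoint_away.
have [d1 d1_gt0 dD] := domain_near a_gt0 b_gt0 P_in.
have d0 := @dist1_ge0 R.
pose W (eta : R) := 0 < eta <= m / 2.
have [[pl _] _ _] := vlip_chart E P C S W (dbox r) i.
have [[_ ql] [_ nl] [_ tl]] := vlip_chart E P C S W (dbox r) j.
have rp (h : R) x : W h -> dbox r x -> p0 <= dot (pt i x.1) (pt i x.1).
  by move=> _ _; apply: pge; exact: cosat_sinat.
have rq (h : R) x : W h -> dbox r x -> p0 <= dot (pt j x.2) (pt j x.2).
  by move=> _ _; apply: pge; exact: cosat_sinat.
have mh' (h : R) x : W h -> dbox r x -> m <= half_dot (pt i x.1) (pt j x.2).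
  by move=> _ /mh.
have [_ bl] := vlip_bisector d0 p00 m0 rp rq mh' pl ql.
have [K1 K10 B1] := ulip_norm_bound (ulip_dot bl bl).
have [K2 K20 B2] := ulip_norm_bound (ulip_dot bl nl).
have [K K0 HK] := ulip_arrival_defect d0 p00 m0 (lexx _) rp rq mh' pl ql tl.
pose e1 := Num.min (d1 / (K1 + 1)) 1.
pose e2 := n0 / (2 * K2).
pose e := Num.min (m / 2) (m * Num.min e1 e2).
have e10 : 0 < e1 by rewrite lt_min ltr01 andbT divr_gt0// addr_gt0.
have e20 : 0 < e2 by rewrite divr_gt0// mulr_gt0.
have e0 : 0 < e by rewrite lt_min divr_gt0//= mulr_gt0// lt_min e10.
exists e => //; exists (K + 1); first by rewrite ltr_wpDl.
move=> eta x y /andP[h0 he] xb yb.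
have Wh : W eta by rewrite /W h0 (le_trans he)// ge_min lexx.
have [k1 k2] := HK eta x y Wh xb yb.
split; [|by rewrite (le_trans k1)// lerDl|]; last first.
  by rewrite (le_trans k2)// ler_wpM2r// lerDl.
have mx := mh x xb; have hd0 : 0 < half_dot (pt i x.1) (pt j x.2) by exact: lt_le_trans mx.
have /andP[x0 xm] := bend_bound (ltW h0) m0 mx.
set be := bend _ _ _ in x0 xm *.
have be12 : be <= Num.min e1 e2.
  by rewrite (le_trans xm)// ler_pdivrMr// mulrC (le_trans he)// ge_min lexx orbT.
have be1 : be <= e1 by rewrite (le_trans be12)// ge_min lexx.
have be2 : be <= e2 by rewrite (le_trans be12)// ge_min lexx orbT.
split => //.
- apply: dD; rewrite dotZl dotZr -/be.
  have b1 : dot (bisector (pt i x.1) (pt j x.2)) (bisector (pt i x.1) (pt j x.2)) <= K1.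
    exact: le_trans (ler_norm _) (B1 eta x Wh xb).
  have be1' : be <= 1 by rewrite (le_trans be1)// ge_min lexx orbT.
  have bek : be * (K1 + 1) <= d1.
    by rewrite -ler_pdivlMr ?addr_gt0// (le_trans be1)// ge_min lexx.
  rewrite mulrA mulrNN; apply: (@le_trans _ _ (be * be * K1)).
    by rewrite ler_wpM2l// mulr_ge0.
  by rewrite -mulrA; nra.
- rewrite dotDl dotZl -/be.
  have nj : n0 <= dot (pt j x.2) (N j x.2).
    by rewrite dotC; apply: nge; exact: cosat_sinat.
  have b2 := B2 eta x Wh xb.
  have : - (be * K2) <= be * dot (bisector (pt i x.1) (pt j x.2)) (N j x.2).
    rewrite -mulrN ler_wpM2l//; move: b2; rewrite ler_norml => /andP[+ _]; exact.
  have : be * (2 * K2) <= n0 by rewrite -ler_pdivlMr ?mulr_gt0.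
  by move: (dot _ _) nj => Q nj h3 h4; lra.
Qed.

Hypothesis dslope_neq0 : forall i, dslope E P (C i) (S i) != 0.
Hypothesis C_neq0 : forall i, C i != 0.
Hypothesis half_dot_gt0' : forall i j,
  0 < half_dot (bpoint E P (C i) (S i)) (bpoint E P (C j) (S j)).

(** Common constants for the four pairs of charts. *)
Lemma inner_chart_data (r0 : R) : 0 < r0 -> exists r e K : R,
  [/\ 0 < r /\ r <= r0, 0 < e, 0 < K,
    forall i (t t' : R), `|t| <= r -> `|t'| <= r ->
      0 < C i * cosat C S i t /\
      `|(t - chart_slope E P C S i t / dslope E P (C i) (S i)) -
        (t' - chart_slope E P C S i t' / dslope E P (C i) (S i))| <= 4^-1 * `|t - t'| &
    forall i j eta x y, 0 < eta <= e -> dbox r x -> dbox r y ->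
      [/\ inner_ok eta i j x, `|chart_defect eta i j x| <= K &
      `|chart_defect eta i j x - chart_defect eta i j y| <= K * dist1 x y]].
Proof.
move=> r00.
have [r1 r10 H1] : exists2 r, 0 < r & forall i j, exists2 m : R, 0 < m & forall x, dbox r x ->
    m <= half_dot (pt i x.1) (pt j x.2).
  apply: (@finite_radius R (fun i j r => exists2 m : R, 0 < m & forall x, dbox r x ->
    m <= half_dot (pt i x.1) (pt j x.2))).
    move=> i j r r' [m m0 mh] _ rr; exists m => // x xb; apply: mh.
    exact: dbox_le rr xb.
  move=> i j; have [r r_gt0 [m m0 mh]] := chart_half_dot a_gt0 b_gt0 P_in CS1 (half_dot_gt0' i j).
  by exists r => //; exists m.
have [r2 r20 H2] : exists2 r, 0 < r & forall i (j : bool) (t t' : R), `|t| <= r -> `|t'| <= r ->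
      0 < C i * cosat C S i t /\
      `|(t - chart_slope E P C S i t / dslope E P (C i) (S i)) -
        (t' - chart_slope E P C S i t' / dslope E P (C i) (S i))| <= 4^-1 * `|t - t'|.
  apply: (@finite_radius R (fun i _ r => forall (t t' : R), `|t| <= r -> `|t'| <= r ->
      0 < C i * cosat C S i t /\
      `|(t - chart_slope E P C S i t / dslope E P (C i) (S i)) -
        (t' - chart_slope E P C S i t' / dslope E P (C i) (S i))| <= 4^-1 * `|t - t'|)).
    by move=> i j r r' h _ rr t t' tr tr'; apply: h; exact: le_trans rr.
  move=> i _; have [r r_gt0 h] := chart_sign S (C_neq0 i).
  have [r' r'0 h'] := slope_contraction (dslope_neq0 i).
  exists (Num.min r r'); first by rewrite lt_min r_gt0.
  move=> t t'; rewrite !le_min => /andP[t1 t2] /andP[t3 t4].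
  by split; [exact: h | exact: h'].
pose r := Num.min r0 (Num.min r1 r2).
have r_gt0 : 0 < r by rewrite !lt_min r00 r10.
have rr1 : r <= r1 by rewrite /r !ge_min lexx !orbT.
have rr2 : r <= r2 by rewrite /r !ge_min lexx !orbT.
have pd i j : exists2 e : R, 0 < e & exists2 K : R, 0 < K & forall eta x y, 0 < eta <= e ->
    dbox r x -> dbox r y -> [/\ inner_ok eta i j x, `|chart_defect eta i j x| <= K &
      `|chart_defect eta i j x - chart_defect eta i j y| <= K * dist1 x y].
  have [m m0 mh] := H1 i j; apply: (inner_pair_data m0) => x xb; apply: mh.
  exact: dbox_le rr1 xb.
have [e e0 He] : exists2 e : R, 0 < e & forall i j, exists2 K : R, 0 < K &
    forall eta x y, 0 < eta <= e ->
    dbox r x -> dbox r y -> [/\ inner_ok eta i j x, `|chart_defect eta i j x| <= K &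
      `|chart_defect eta i j x - chart_defect eta i j y| <= K * dist1 x y].
  apply: (@finite_radius R (fun i j e => exists2 K : R, 0 < K & forall eta x y, 0 < eta <= e ->
    dbox r x -> dbox r y -> [/\ inner_ok eta i j x, `|chart_defect eta i j x| <= K &
      `|chart_defect eta i j x - chart_defect eta i j y| <= K * dist1 x y])); last exact: pd.
  move=> i j e e' [K K0 h] _ ee; exists K => // eta x y /andP[h0 he]; apply: h.
  by rewrite h0 (le_trans he).
have [k k0 Hk] : exists2 k : R, 0 < k & forall i j eta x y, 0 < eta <= e ->
    dbox r x -> dbox r y -> [/\ inner_ok eta i j x, `|chart_defect eta i j x| <= k^-1 &
      `|chart_defect eta i j x - chart_defect eta i j y| <= k^-1 * dist1 x y].
  apply: (@finite_radius R (fun i j k => forall eta x y, 0 < eta <= e ->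
    dbox r x -> dbox r y -> [/\ inner_ok eta i j x, `|chart_defect eta i j x| <= k^-1 &
      `|chart_defect eta i j x - chart_defect eta i j y| <= k^-1 * dist1 x y])).
    move=> i j k k' h k'0 kk eta x y he xb yb; have [h1 h2 h3] := h eta x y he xb yb.
    have kk' : k^-1 <= k'^-1 by rewrite lef_pV2// posrE// (lt_le_trans k'0).
    split => //; first exact: le_trans kk'.
    by rewrite (le_trans h3)// ler_wpM2r// dist1_ge0.
  move=> i j; have [K K0 h] := He i j; exists K^-1; rewrite ?invr_gt0//.
  by rewrite invrK.
exists r, e, k^-1; split => //.
- by rewrite r_gt0 /r ge_min lexx.
- by rewrite invr_gt0.
- by move=> i t t' tr tr'; apply: H2 => //; exact: le_trans rr2.
Qed.

End ChartEstimates.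

(** * Coding the states of a billiard *)

Section StateCoding.
Context {R : realType}.

Lemma cylinder_continuous_local (F : (int -> bool) -> R * R -> R) (r : R)
    (u v : (int -> bool) -> R) :
  (forall s s', (forall j : int, (`|j| <= 1)%N -> s' j = s j) -> F s = F s') ->
  (forall s, ulip (fun _ : unit => True) (dbox r) dist1 (fun _ => F s)) ->
  (forall s, `|u s| <= r) -> (forall s, `|v s| <= r) ->
  cylinder_continuous u -> cylinder_continuous v ->
  cylinder_continuous (fun s => F s (u s, v s)).
Proof.
move=> Floc Flip ur vr uc vc s e e0.
have [K K0 FK] := Flip s.
pose d := e / (2 * (K + 1)).
have K1 : 0 < K + 1 by rewrite ltr_wpDl.
have d0 : 0 < d by rewrite divr_gt0// mulr_gt0.
have [n1 un] := uc s d d0; have [n2 vn] := vc s d d0.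
exists (maxn 1 (maxn n1 n2)) => s' ss'.
rewrite -(Floc s s'); last by move=> j j1; apply: ss'; rewrite (leq_trans j1)// leq_maxl.
have h1 := un s'; have h2 := vn s'.
have [_] := FK tt (u s, v s) (u s', v s') I (conj (ur s) (vr s)) (conj (ur s') (vr s')).
move=> h; apply: (le_trans h).
have {}h1 : `|u s - u s'| <= d.
  by apply: h1 => j jn; apply: ss'; rewrite (leq_trans jn)// !leq_max leqnn orbT.
have {}h2 : `|v s - v s'| <= d.
  by apply: h2 => j jn; apply: ss'; rewrite (leq_trans jn)// !leq_max leqnn !orbT.
apply: (@le_trans _ _ (K * (d + d))); first by rewrite ler_wpM2l// lerD.
have -> : e = d * (2 * (K + 1)) by rewrite divfK// gt_eqF// mulr_gt0.
by have := mulr_ge0 K0 (ltW d0); lra.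
Qed.

Lemma pair_continuous (T U V : topologicalType) (f : T -> U) (g : T -> V) (s : T) :
  {for s, continuous f} -> {for s, continuous g} ->
  {for s, continuous (fun s => (f s, g s))}.
Proof. by move=> fc gc; exact: (cvg_pair (G := nbhs (f s)) (H := nbhs (g s)) fc gc). Qed.

Lemma cylinder_continuous_pair (z : (int -> bool) -> R * R) :
  cylinder_continuous (fun s => (z s).1) -> cylinder_continuous (fun s => (z s).2) ->
  continuous (z : bisequence bool -> R * R).
Proof.
move=> /cylinder_continuousP c1 /cylinder_continuousP c2.
have -> : z = (fun s => ((z s).1, (z s).2)).
  by apply/funext => ?; exact: surjective_pairing.
by move=> s; exact: (pair_continuous (c1 s) (c2 s)).
Qed.

Variables (E : ellipse R) (gamma : R -> R * R).
Hypothesis gamma_regular : regular_parametrisation E gamma.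

(** A section of the parametrisation, discontinuous where the ellipse closes up;
    this is why phase space carries the topology pulled back by gamma. *)
Lemma boundary_parameter : exists xi : R * R -> R, forall z, elliptic_boundary E z ->
  0 <= xi z < 2 * pi /\ gamma (xi z) = z.
Proof.
have [_ _ [_ _ surj]] := gamma_regular.
have ex z : exists t, elliptic_boundary E z -> 0 <= t < 2 * pi /\ gamma t = z.
  have [bz|nbz] := pselect (elliptic_boundary E z); last by exists 0.
  by have [t ti <-] := surj z bz; exists t => _; rewrite /= in_itv in ti.
by exists (fun z => projT1 (cid (ex z))) => z; case: cid.
Qed.

Lemma gamma_inj t t' : 0 <= t < 2 * pi -> 0 <= t' < 2 * pi -> gamma t = gamma t' -> t = t'.
Proof.
have [_ _ [_ inj _]] := gamma_regular => ht ht'.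
by apply: inj; rewrite inE /= in_itv.
Qed.

(** The states of the subsystem are given by points z s of the ellipse and sines
    sg s of the angles.  The topology of phase space is that of the pair of the
    point and the angle, where arcsine is continuous inside ]-1, 1[. *)
Lemma bernoulli_of_states (f : R * R -> R * R -> Prop) (xi : R * R -> R)
    (z : (int -> bool) -> R * R) (sg : (int -> bool) -> R) :
  (forall w, elliptic_boundary E w -> 0 <= xi w < 2 * pi /\ gamma (xi w) = w) ->
  (forall s, elliptic_boundary E (z s)) -> (forall s, -1 < sg s < 1) ->
  cylinder_continuous (fun s => (z s).1) -> cylinder_continuous (fun s => (z s).2) ->
  cylinder_continuous sg ->
  (forall s, f (xi (z s), asin (sg s))
     (xi (z (bernoulli_shift (A := bool) s)), asin (sg (bernoulli_shift (A := bool) s)))) ->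
  (forall s y, f (xi (z s), asin (sg s)) y ->
     y = (xi (z (bernoulli_shift (A := bool) s)), asin (sg (bernoulli_shift (A := bool) s)))) ->
  (forall s s', z s = z s' -> s 0 = s' 0) ->
  (forall s s', z s = z s' -> sg s = sg s' ->
     z (unshift s) = z (unshift s') /\ sg (unshift s) = sg (unshift s')) ->
  has_bernoulli_subsystem (f : phase_topology gamma -> phase_topology gamma -> Prop).
Proof.
move=> xiP zb sgb z1c z2c sgc fs ff sym back.
pose iota (x : R * R) : (R * R) * R := (gamma x.1, x.2).
pose g (s : bisequence bool) : R * R := (xi (z s), asin (sg s)).
have ig s : iota (g s) = (z s, asin (sg s)).
  by rewrite /iota /g /=; have [_ ->] := xiP _ (zb s).
have sgin s : sg s \in `[-1, 1]%R by have /andP[? ?] := sgb s; rewrite in_itv /= !ltW.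
have sgK s : sin (asin (sg s)) = sg s by rewrite asinK.
have gz s s' : g s = g s' -> z s = z s' /\ sg s = sg s'.
  move=> e; have := ig s; rewrite e ig => -[e1 e2].
  by split => //; rewrite -(sgK s) -e2 sgK.
apply: (@bernoulli_of_coding _ _ iota f g).
- exact: norm_hausdorff.
- rewrite (_ : iota \o g = (fun s => (z s, asin (sg s)))); last by apply/funext => s; exact: ig.
  have zc : continuous (z : bisequence bool -> R * R).
    exact: cylinder_continuous_pair.
  move=> s; apply: (pair_continuous (zc s)).
  have sc : {for s, continuous (sg : bisequence bool -> R)}.
    by have := cylinder_continuousP sgc; exact.
  exact: (continuous_comp sc (continuous_asin (sgb s))).
- move=> s s'; rewrite !ig => -[e1 e2]; rewrite /g e1.
  by rewrite -[asin _]/(asin (sg s)) e2.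
- exact: fs.
- exact: ff.
- by move=> s s' /gz[/sym].
- move=> s s' /gz[e1 e2]; have [e3 e4] := back s s' e1 e2.
  by rewrite /g e3 e4.
Qed.

End StateCoding.

(** * Chaos in the reflective billiard *)

Section ChartArrivals.
Context {R : realType}.
Variables (E : ellipse R) (P : R * R).
Let a := semi_major E.
Let b := semi_minor E.
Hypotheses (a_gt0 : 0 < a) (b_gt0 : 0 < b).
Hypothesis P_in : elliptic_domain E P.
Variables (C S : bool -> R).
Hypothesis CS1 : forall i, C i ^+ 2 + S i ^+ 2 = 1.
Implicit Types (i j : bool) (t : R) (mu h : R).
Local Notation pt := (chart E P C S).
Local Notation N := (chart_normal E C S).
Local Notation tau := (chart_tangent E C S).
Local Notation slope_at := (chart_slope E P C S).
Local Notation defect := (chart_defect E P C S).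
Local Notation cs1 := (cosat_sinat CS1).

Definition chart_scale i t := tangent_scale E (cosat C S i t) (sinat C S i t).

Lemma chart_perp i t v : dot v (perp (outward_normal E (P + pt i t))) =
  chart_scale i t * dot v (tau i t).
Proof. exact: (dot_perp_normal a_gt0 b_gt0 P_in (cs1 i t)). Qed.

Lemma chart_outward_gt0 i t v :
  (0 < dot v (outward_normal E (P + pt i t))) = (0 < dot v (N i t)).
Proof. exact: (dot_outward_normal_gt0 a_gt0 b_gt0 P_in (cs1 i t)). Qed.

Lemma chart_outward_unit i t :
  dot (outward_normal E (P + pt i t)) (outward_normal E (P + pt i t)) = 1.
Proof. exact: (outward_normal_unit a_gt0 b_gt0 P_in (cs1 i t)). Qed.

Lemma chart_inward_unit i t :
  dot (inward_normal E (P + pt i t)) (inward_normal E (P + pt i t)) = 1.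
Proof. exact: (inward_normal_unit a_gt0 b_gt0 P_in (cs1 i t)). Qed.

Lemma chart_boundary i t : elliptic_boundary E (P + pt i t).
Proof. exact: (bpoint_boundary P a_gt0 b_gt0 (cs1 i t)). Qed.

Lemma chart_neq0 i t : pt i t != 0.
Proof. exact: (bpoint_neq0 a_gt0 b_gt0 P_in (cs1 i t)). Qed.

Lemma inner_arrival_facts mu h i j t t' (w := arrival mu h (pt i t) (pt j t')) :
  0 < mu -> 0 < h -> inner_ok E P C S (mu / h) i j (t, t') ->
  [/\ inner_arc E mu h P (P + pt i t) (- arrival mu h (pt j t') (pt i t)) (P + pt j t') w,
      dot w w = 2 * V_inner mu h P (P + pt j t'),
      0 < dot w (N j t') &
      dot w (tau j t') = Num.sqrt (2 * h) / enorm (pt j t') *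
        (slope_at j t' + mu / h * defect (mu / h) i j (t, t'))].
Proof.
move=> mu0 h0 [hd inD wN]; have eta0 : 0 < mu / h by rewrite divr_gt0.
split.
- exact: (inner_arc_bpoint a_gt0 b_gt0 P_in mu0 h0 (cs1 i t) (cs1 j t') hd inD).
- exact: (arrival_energy a_gt0 b_gt0 P_in mu0 h0 (cs1 i t) (cs1 j t') hd).
- rewrite /w /arrival dotZl mulr_gt0// divr_gt0 ?sqrtr_gt0 ?mulr_gt0//.
    by rewrite enorm_gt0// chart_neq0.
  have [x0 x1 _] := bend_eq hd eta0.
  by rewrite sqrtr_gt0 subr_gt0 expr_lt1// ltW.
- by rewrite /w dot_arrival (arrival_tangentE _ hd eta0).
Qed.

(** Arcs are reversible: the initial velocity of the arc from p to q is minus the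
    arrival velocity of the arc from q to p.  So velocities that enter the domain
    are written as - w, where w leaves it. *)
Lemma launch_inward V i t w (n := inward_normal E (P + pt i t))
    (sg := launch_sin V (P + pt i t) n (- w)) :
  0 < V (P + pt i t) -> dot w w = 2 * V (P + pt i t) -> 0 < dot w (N i t) ->
  [/\ -1 < sg < 1, open_angle (asin sg), sin (asin sg) = sg &
      launch V (P + pt i t) n (asin sg) = - w].
Proof.
move=> V0 wV wN; apply: (launchK (chart_inward_unit i t) V0).
  by rewrite dotNl dotNr opprK.
by rewrite /inward_normal dotNl dotNr opprK chart_outward_gt0.
Qed.

Lemma launch_sin_inward V i t w :
  launch_sin V (P + pt i t) (inward_normal E (P + pt i t)) (- w) =
  chart_scale i t * dot w (tau i t) / Num.sqrt (2 * V (P + pt i t)).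
Proof.
by rewrite /launch_sin /inward_normal perpN dotNl dotNr opprK chart_perp.
Qed.

Lemma launch_sin_outward V i t w :
  launch_sin V (P + pt i t) (outward_normal E (P + pt i t)) w =
  chart_scale i t * dot w (tau i t) / Num.sqrt (2 * V (P + pt i t)).
Proof. by rewrite /launch_sin chart_perp. Qed.

(** The two charts lie on different sides of the minor axis. *)
Lemma chart_bool_inj i j t t' : C false * C true < 0 ->
  0 < C i * cosat C S i t -> 0 < C j * cosat C S j t' -> pt i t = pt j t' -> i = j.
Proof.
move=> CC ci cj /frame_inj[e _].
have {}e : cosat C S i t = cosat C S j t'.
  by move/addIr: e; apply: mulfI; rewrite gt_eqF.
have ij : 0 < C i * C j * cosat C S j t' ^+ 2.
  by have := mulr_gt0 ci cj; rewrite e expr2 mulrACA.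
case: i j {ci cj e} ij => -[]// h.
  have := sqr_ge0 (cosat C S false t'); nra.
have := sqr_ge0 (cosat C S true t'); nra.
Qed.

Lemma chart_point_continuous (r : R) (t : (int -> bool) -> R) :
  (forall s, `|t s| <= r) -> cylinder_continuous t ->
  cylinder_continuous (fun s => (P + pt (s 0) (t s)).1) /\
  cylinder_continuous (fun s => (P + pt (s 0) (t s)).2).
Proof.
move=> tr tc; have d0 := @dist1_ge0 R; split.
- apply: (@cylinder_continuous_local _ (fun s x => (P + pt (s 0) x.2).1) r t t) => // s.
    by move=> s' ss'; rewrite ss'.
  have [[_ [p1 _]] _ _] := vlip_chart E P C S (fun _ : unit => True) (dbox r) (s 0).
  by apply: ulipD => //; exact: ulip_const.
- apply: (@cylinder_continuous_local _ (fun s x => (P + pt (s 0) x.2).2) r t t) => // s.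
    by move=> s' ss'; rewrite ss'.
  have [[_ [_ p2]] _ _] := vlip_chart E P C S (fun _ : unit => True) (dbox r) (s 0).
  by apply: ulipD => //; exact: ulip_const.
Qed.

Section Regularity.
Context {H : Type}.
Variables (W : H -> Prop) (D : R * R -> Prop) (i : bool).
Let d0 := @dist1_ge0 R.

Lemma ulip_chart_enorm :
  ulip W D dist1 (fun _ x => enorm (pt i x.1)) /\
  ulip W D dist1 (fun _ x => enorm (pt i x.2)).
Proof.
have [e e0 pe] := bpoint_away a_gt0 b_gt0 P_in; have [[p1 p2] _ _] := vlip_chart E P C S W D i.
by split; apply: (ulip_enorm d0 e0) => // _ x _ _; apply: pe; exact: cs1.
Qed.

Lemma ulip_chart_enormV : ulip W D dist1 (fun _ x => (enorm (pt i x.2))^-1).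
Proof.
have [e e0 pe] := bpoint_away a_gt0 b_gt0 P_in; have [_ n2] := ulip_chart_enorm.
apply: (@ulipV _ _ _ _ _ _ d0 _ (Num.sqrt e)) => //; first by rewrite sqrtr_gt0.
by move=> _ x _ _; rewrite ler_wsqrtr// pe//; exact: cs1.
Qed.

Lemma ulip_chart_slope : ulip W D dist1 (fun _ x => slope_at i x.2).
Proof. by have [[_ p2] _ [_ t2]] := vlip_chart E P C S W D i; exact: ulip_dot. Qed.

Lemma ulip_chart_scale : ulip W D dist1 (fun _ x => chart_scale i x.2).
Proof.
have [_ [_ n2] _] := vlip_chart E P C S W D i.
pose l := (a ^+ 2 + b ^+ 2)^-1.
have ab2 : 0 < a ^+ 2 + b ^+ 2 by rewrite addr_gt0// exprn_gt0.
have l0 : 0 < l by rewrite invr_gt0.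
have nl (h : H) x : W h -> D x -> l <= dot (N i x.2) (N i x.2).
  move=> _ _; rewrite dot_frame -!expr2 !expr_div_n -/a -/b.
  have -> : l = (cosat C S i x.2 ^+ 2 + sinat C S i x.2 ^+ 2) * l by rewrite cs1 mul1r.
  rewrite mulrDl; apply: lerD; rewrite ler_wpM2l ?sqr_ge0//.
    by rewrite lef_pV2 ?posrE ?exprn_gt0// lerDl sqr_ge0.
  by rewrite lef_pV2 ?posrE ?exprn_gt0// lerDr sqr_ge0.
have nn := ulip_enorm d0 l0 nl n2.
have sl0 : 0 < Num.sqrt l by rewrite sqrtr_gt0.
apply: (@ulipV _ _ _ _ _ _ d0 _ (a * b * Num.sqrt l)).
- by rewrite !mulr_gt0.
- move=> h x Wh Dx; rewrite ler_wpM2l ?mulr_ge0 ?(ltW a_gt0) ?(ltW b_gt0)//.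
  by rewrite ler_wsqrtr// (nl h x).
- by apply: ulipM => //; exact: ulip_const.
Qed.

End Regularity.

End ChartArrivals.

Section Reflective.
Context {R : realType}.
Variables (E : ellipse R) (P : R * R) (mu : R).
Let a := semi_major E.
Let b := semi_minor E.
Hypotheses (a_gt0 : 0 < a) (b_gt0 : 0 < b) (mu_gt0 : 0 < mu).
Hypothesis P_in : elliptic_domain E P.
Variables (C S : bool -> R).
Hypothesis CS1 : forall i, C i ^+ 2 + S i ^+ 2 = 1.
Hypothesis slope0 : forall i, slope E P (C i) (S i) = 0.
Hypothesis dslope_neq0 : forall i, dslope E P (C i) (S i) != 0.
Hypothesis C_opposite : C false * C true < 0.
Hypothesis half_dot_pos : forall i j,
  0 < half_dot (bpoint E P (C i) (S i)) (bpoint E P (C j) (S j)).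
Local Notation pt := (chart E P C S).
Local Notation N := (chart_normal E C S).
Local Notation tau := (chart_tangent E C S).
Local Notation slope_at := (chart_slope E P C S).
Local Notation defect := (chart_defect E P C S).
Local Notation shift s := (bernoulli_shift (A := bool) s).

Lemma C_neq0 i : C i != 0.
Proof.
by apply/eqP => Ci; move: C_opposite; case: i Ci => ->; rewrite ?mulr0 ?mul0r ltxx.
Qed.

Lemma slope_at0 i : slope_at i 0 = 0.
Proof. by rewrite chart_slopeE// cosat0 sinat0. Qed.

(** The size of perturbations that the two zeros of the slope tolerate. *)
Lemma slope_radius (r : R) : 0 < r -> exists2 l : R, 0 < l & forall i,
  l <= `|dslope E P (C i) (S i)| / 4 /\ l <= `|dslope E P (C i) (S i)| * r / 4.
Proof.
move=> r0; have dpos i : 0 < `|dslope E P (C i) (S i)| by rewrite normr_gt0.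
have [l l0 hl] : exists2 l : R, 0 < l & forall i (j : bool),
    l <= `|dslope E P (C i) (S i)| / 4 /\ l <= `|dslope E P (C i) (S i)| * r / 4.
  apply: (@finite_radius R (fun i _ l => l <= `|dslope E P (C i) (S i)| / 4 /\
    l <= `|dslope E P (C i) (S i)| * r / 4)).
    by move=> i j l l' [h1 h2] _ ll; split; exact: (le_trans ll).
  move=> i _.
  exists (Num.min (`|dslope E P (C i) (S i)| / 4) (`|dslope E P (C i) (S i)| * r / 4)).
    by rewrite lt_min !divr_gt0// mulr_gt0.
  by rewrite !ge_min !lexx !orbT.
by exists l => // i; exact: (hl i i).
Qed.

(** A bi-infinite sequence of symbols prescribes near which of the two critical
    points the successive bounces occur.  At the bounce s, between p (unshift s)
    and p (shift s), the reflection law equates the tangential components of the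
    arrival velocities of the two arcs from these points, up to sign:
    slope + eta * d1 = - (slope + eta * d2), with d1 and d2 the defects of the two
    arcs.  This is a perturbed chain with coupling eta / 2 * (d1 + d2).  The map is
    single-valued since arcs are unique, and a state determines the previous one by
    reversing the arc. *)
Lemma reflective_chaos : exists hstar : R, 0 < hstar /\ forall hI, hstar < hI ->
  chaotic E mu Reflective P hI.
Proof.
have [r [e [K [[r0 r1] e0 K0 geo inner]]]] := inner_chart_data a_gt0 b_gt0 P_in CS1
  dslope_neq0 C_neq0 half_dot_pos ltr01.
have [l l0 hl] := slope_radius r0.
(* This makes 2 eta K, the bound and Lipschitz constant of the coupling G below,
   at most l. *)
pose e1 := Num.min e (l / (2 * K)).
have e10 : 0 < e1 by rewrite lt_min e0 divr_gt0// mulr_gt0.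
exists (mu / e1); split=> [|hI hhI]; first by rewrite divr_gt0.
have hI0 : 0 < hI by apply: lt_trans hhI; rewrite divr_gt0.
pose eta := mu / hI.
have eta0 : 0 < eta by rewrite divr_gt0.
have eta1 : eta <= e1.
  by rewrite /eta ler_pdivrMr// mulrC -ler_pdivrMr// ltW.
have eta_e : 0 < eta <= e by rewrite eta0 (le_trans eta1)// ge_min lexx.
have etaK : 2 * eta * K <= l.
  rewrite mulrAC mulrC -ler_pdivlMr ?mulr_gt0// (le_trans eta1)//.
  by rewrite ge_min lexx orbT.
pose G (s : int -> bool) (Z1 Z2 Z3 : bool -> R) (b : bool) :=
  eta / 2 * (defect eta (s (- 1)) (s 0) (Z1 b, Z2 b) + defect eta (s 1) (s 0) (Z3 b, Z2 b)).
have e20 : 0 <= eta / 2 by rewrite divr_ge0// ltW.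
have [X [Xbox XE Xc]] : exists X : (int -> bool) -> bool -> R,
  [/\ forall s b, `|X s b| <= r,
      forall s b, slope_at (s 0) (X s b) +
        G s (X (unshift s)) (X s) (X (shift s)) b = 0 &
      forall b, cylinder_continuous (fun s => X s b)].
  apply: (@perturbed_chain R r (2 * eta * K) slope_at
     (fun i => dslope E P (C i) (S i)) G r0 dslope_neq0 slope_at0).
  - by move=> i x y xr yr; have [_] := geo i x y xr yr.
  - move=> s Z1 Z2 Z3 b' z1 z2 z3; rewrite /G normrM (ger0_norm e20).
    have [_ k1 _] := inner (s (-1)) (s 0) eta _ _ eta_e
      (dboxI (z1 b') (z2 b')) (dboxI (z1 b') (z2 b')).
    have [_ k2 _] := inner (s 1) (s 0) eta _ _ eta_e
      (dboxI (z3 b') (z2 b')) (dboxI (z3 b') (z2 b')).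
    have -> : 2 * eta * K = eta / 2 * (4 * K) by field.
    rewrite ler_wpM2l// (le_trans (ler_normD _ _))//; lra.
  - move=> s Z1 Z2 Z3 Z1' Z2' Z3' d z1 z2 z3 z1' z2' z3' d1 d2 d3 b'.
    have [_ _ k1] := inner (s (-1)) (s 0) eta _ _ eta_e
      (dboxI (z1 b') (z2 b')) (dboxI (z1' b') (z2' b')).
    have [_ _ k2] := inner (s 1) (s 0) eta _ _ eta_e
      (dboxI (z3 b') (z2 b')) (dboxI (z3' b') (z2' b')).
    rewrite /G -mulrBr normrM (ger0_norm e20).
    have -> : 2 * eta * K * d = eta / 2 * (K * (d + d) + K * (d + d)) by field.
    rewrite ler_wpM2l// opprD addrACA (le_trans (ler_normD _ _))// lerD//.
      apply: (le_trans k1); apply: ler_wpM2l; first exact: ltW.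
      exact: (lerD (d1 b') (d2 b')).
    apply: (le_trans k2); apply: ler_wpM2l; first exact: ltW.
    exact: (lerD (d3 b') (d2 b')).
  - by move=> s s' Z1 Z2 Z3 ss'; rewrite /G !ss'.
  - by move=> i; have [h1 h2] := hl i; split; exact: (le_trans etaK).
move=> gamma greg.
have [xi xiP] := boundary_parameter greg.
pose t s := X s false.
have tr s : `|t s| <= r by exact: Xbox.
pose p s := pt (s 0) (t s).
pose V := V_inner mu hI P.
pose w s' s := arrival mu hI (p s') (p s).
have facts s' s : [/\ inner_arc E mu hI P (P + p s') (- w s s') (P + p s) (w s' s),
      dot (w s' s) (w s' s) = 2 * V (P + p s),
      0 < dot (w s' s) (N (s 0) (t s)) &
      dot (w s' s) (tau (s 0) (t s)) = Num.sqrt (2 * hI) / enorm (p s) *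
        (slope_at (s 0) (t s) + eta * defect eta (s' 0) (s 0) (t s', t s))].
  apply: (inner_arrival_facts a_gt0 b_gt0 P_in CS1 mu_gt0 hI0).
  have bx : dbox r (t s', t s) by split; exact: tr.
  by have [] := inner (s' 0) (s 0) eta _ _ eta_e bx bx.
have V0 z : 0 < V z by exact: V_inner_gt0.
pose n s := outward_normal E (P + p s).
have n1 s : dot (n s) (n s) = 1 by exact: chart_outward_unit.
pose vout s := - w (shift s) s.
pose sg s := launch_sin V (P + p s) (inward_normal E (P + p s)) (vout s).
have lau s : [/\ -1 < sg s < 1, open_angle (asin (sg s)), sin (asin (sg s)) = sg s &
      launch V (P + p s) (inward_normal E (P + p s)) (asin (sg s)) = vout s].
  have [_ wV wN _] := facts (shift s) s.
  exact: (launch_inward a_gt0 b_gt0 P_in CS1 (V0 _) wV wN).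
(* The reflection law at p s is the equation solved by X s. *)
have law s : Defs.reflect (n s) (w (unshift s) s) = vout s.
  have [_ v1 N1 t1] := facts (unshift s) s; have [_ v2 N2 t2] := facts (shift s) s.
  apply: (reflection_law (n1 s)).
  - by rewrite /vout dotNl dotNr opprK v1 v2.
  - by rewrite chart_outward_gt0.
  - by rewrite /vout dotNl oppr_lt0 chart_outward_gt0.
  - rewrite /vout dotNl !chart_perp// t1 t2 -mulrN; congr (_ * _); rewrite -mulrN; congr (_ * _).
    have := XE s false; rewrite /G -/(t s) -/(t (unshift s)) -/(t (shift s)).
    rewrite unshift0 bernoulli_shift0 => eq.
    apply/eqP; rewrite -subr_eq0 opprK; apply/eqP.
    move: eq; set d1 := defect _ _ _ _; set d2 := defect _ _ _ _; move=> eq.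
    apply: (etrans (_ : _ = 2 * (slope_at (s 0) (t s) + eta / 2 * (d1 + d2)))); first by field.
    by rewrite eq mulr0.
have zb s : elliptic_boundary E (P + p s) by exact: chart_boundary.
have xi1 s : 0 <= xi (P + p s) < 2 * pi by have [] := xiP _ (zb s).
have xi2 s : gamma (xi (P + p s)) = P + p s by have [] := xiP _ (zb s).
have ps s : phase_space (xi (P + p s), asin (sg s)).
  by split; [exact: xi1 | have [] := lau s].
apply: (@bernoulli_of_states _ E gamma _ xi (fun s => P + p s) sg) => //.
- by move=> s; have [] := lau s.
- by have [] := chart_point_continuous E P C S tr (Xc false).
- by have [] := chart_point_continuous E P C S tr (Xc false).
- pose F (s : int -> bool) (x : R * R) := chart_scale E C S (s 0) x.2 *
    (Num.sqrt (2 * hI) / enorm (pt (s 0) x.2) *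
     (slope_at (s 0) x.2 + eta * defect eta (s 1) (s 0) x)) /
    Num.sqrt (2 * (hI + mu / enorm (pt (s 0) x.2))).
  have -> : sg = fun s => F s (t (shift s), t s).
    apply/funext => s; rewrite /sg /vout launch_sin_inward//.
    have [_ _ _ ->] := facts (shift s) s.
    by rewrite /F /V /V_inner bernoulli_shift0 [P + p s]addrC addrK.
  apply: (@cylinder_continuous_local _ F r) => //.
  + by move=> s s' ss'; rewrite /F !ss'.
  + move=> s; have d0 := @dist1_ge0 R.
    have c1 (c : R) : ulip (fun _ : unit => True) (dbox r) dist1 (fun _ _ => c).
      exact: ulip_const.
    have pV : ulip (fun _ : unit => True) (dbox r) dist1 (fun _ x => (enorm (pt (s 0) x.2))^-1).
      exact: ulip_chart_enormV.
    have dl : ulip (fun _ : unit => True) (dbox r) dist1 (fun _ x => defect eta (s 1) (s 0) x).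
      exists K => [|_ x y _ xb yb]; first exact: ltW.
      by have [] := inner (s 1) (s 0) eta x y eta_e xb yb.
    have h2 : 0 < 2 * hI by rewrite mulr_gt0.
    have hge x : 2 * hI <= 2 * (hI + mu / enorm (pt (s 0) x.2)).
      by rewrite ler_wpM2l// lerDl divr_ge0 ?enorm_ge0// ltW.
    apply: ulipM.
      apply: ulipM; first exact: ulip_chart_scale.
      apply: ulipM; first exact: ulipM.
      by apply: ulipD; [exact: ulip_chart_slope | exact: ulipM].
    apply: (@ulipV _ _ _ _ _ _ d0 _ (Num.sqrt (2 * hI))); first by rewrite sqrtr_gt0.
      by move=> _ x _ _; rewrite ler_wsqrtr.
    apply: (@ulip_sqrt _ _ _ _ _ _ d0 _ (2 * hI)) => //.
    by apply: ulipM => //; apply: ulipD => //; exact: ulipM.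
  + by apply: cylinder_continuous_shift; exact: Xc.
  + exact: Xc.
- move=> s; split => //=; rewrite !xi2; exists (w s (shift s)).
  have [_ _ _ ->] := lau s; have [_ _ _ ->] := lau (shift s).
  split; first by have [] := facts s (shift s).
  by have := law (shift s); rewrite unshift_shift.
- move=> s y [_ [y1 y2] /= [w' []]]; rewrite xi2.
  have [_ _ _ ->] := lau s => arc1 refl.
  have [arc2 _ _ _] := facts s (shift s).
  have [q w12] := inner_arc_unique P_in (zb s) arc1 arc2; subst w'.
  have y1E : y.1 = xi (P + p (shift s)).
    by apply: (gamma_inj greg) => //; rewrite xi2.
  rewrite [y]surjective_pairing y1E; congr (_, _).
  have [_ oa _ la] := lau (shift s).
  apply: (@launch_inj _ V (P + p (shift s)) (inward_normal E (P + p (shift s)))) => //.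
    exact: chart_inward_unit.
  rewrite la; move: refl; rewrite q -/V => <-.
  by have := law (shift s); rewrite unshift_shift.
- move=> s s' /addrI; apply: chart_bool_inj => //.
    by have [] := geo (s 0) (t s) (t s) (tr s) (tr s).
  by have [] := geo (s' 0) (t s') (t s') (tr s') (tr s').
- move=> s s' zz ss.
  have vv : vout s = vout s'.
    by have [_ _ _ <-] := lau s; have [_ _ _ <-] := lau s'; rewrite zz ss.
(* Reflection is invertible, so the state determines the velocity of arrival,
   and the reversed arc leads to the previous state. *)
  have ww : w (unshift s) s = w (unshift s') s'.
    rewrite -[LHS](reflect_involutive _ (n1 s)) -[RHS](reflect_involutive _ (n1 s')).
    by rewrite !law vv /n zz.
  have [arc1 _ _ _] := facts s (unshift s); have [arc2 _ _ _] := facts s' (unshift s').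
  rewrite ww zz in arc1.
  have [q wq] := inner_arc_unique P_in (zb s') arc1 arc2.
  split => //; rewrite /sg q; congr (launch_sin _ _ _ _).
  by rewrite /vout !shift_unshift wq.
Qed.

End Reflective.

(** * Outer arcs in the charts *)

Section OuterCharts.
Context {R : realType}.
Variables (E : ellipse R) (P : R * R) (omega hE : R).
Let a := semi_major E.
Let b := semi_minor E.
Hypotheses (a_gt0 : 0 < a) (b_gt0 : 0 < b) (omega_gt0 : 0 < omega) (hE_gt0 : 0 < hE).
Hypothesis P_in : elliptic_domain E P.
Hypothesis V_outer_gt0 : forall z, elliptic_boundary E z -> 0 < V_outer omega hE P z.
Variables (C S : bool -> R).
Hypothesis CS1 : forall i, C i ^+ 2 + S i ^+ 2 = 1.
Implicit Types (i j : bool) (t : R) (x y : R * R).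
Local Notation pt := (chart E P C S).
Local Notation N := (chart_normal E C S).
Local Notation tau := (chart_tangent E C S).
Local Notation cs1 := (cosat_sinat CS1).
Let L := 2 * hE / omega ^+ 2.
Let kk i x := outer_cos omega hE (pt i x.1) (pt i x.2).

Definition outer_disc i x := dot (pt i x.1) (pt i x.2) ^+ 2 -
  L * (dot (pt i x.1) (pt i x.1) + dot (pt i x.2) (pt i x.2) - L).

(** The conditions under which the harmonic arc between two points of a chart
    exists and stays outside the domain. *)
Definition outer_ok i x : Prop :=
  [/\ 0 <= outer_disc i x, -1 < kk i x < 1,
    0 < (1 - kk i x) * dot (N i x.1) (pt i x.1) + 2 * dot (N i x.1) (pt i x.2 - pt i x.1) &
    0 < (1 - kk i x) * dot (N i x.2) (pt i x.2) + 2 * dot (N i x.2) (pt i x.1 - pt i x.2)].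

(** The tangential component of the arrival velocity; the factor matches the
    denominator of inner arrival velocities. *)
Definition outer_tangent i x : R := enorm (pt i x.2) *
  dot (outer_arrival omega hE (pt i x.1) (pt i x.2)) (tau i x.2).

(** For equal end points the arc exists since their squared distance Q to P is
    less than L, by positivity of the potential: the discriminant is
    (L - Q) ^ 2, the cosine 2 Q / L - 1, and the arc leaves along the outward radius.
    All conditions are open. *)
Lemma outer_pair_data i : exists2 r : R, 0 < r & exists2 K : R, 0 < K &
  forall x y, dbox r x -> dbox r y -> [/\ outer_ok i x,
    K^-1 <= V_outer omega hE P (P + pt i x.2), `|outer_tangent i x| <= K &
    `|outer_tangent i x - outer_tangent i y| <= K * dist1 x y].
Proof.
have d0 := @dist1_ge0 R; pose W (_ : unit) := True.
have L0 : 0 < L by rewrite divr_gt0 ?exprn_gt0// mulr_gt0.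
pose Q := dot (pt i 0) (pt i 0).
have Q0 : 0 < Q by rewrite dot_gt0// (chart_neq0 a_gt0 b_gt0 P_in CS1).
have QL : Q < L.
  have bz : elliptic_boundary E (P + pt i 0) by exact: chart_boundary.
  have := V_outer_gt0 bz; rewrite /V_outer sqr_enorm [P + _]addrC addrK -/Q => h.
  by rewrite ltr_pdivlMr ?exprn_gt0//; lra.
have cl (r c : R) : ulip W (dbox r) dist1 (fun _ _ => c) by exact: ulip_const.
have V r := vlip_chart E P C S W (dbox r) i.
have dl r : ulip W (dbox r) dist1 (fun _ x => outer_disc i x).
  have [[p1 p2] _ _] := V r.
  apply: ulipB => //; first by apply: ulipX => //; exact: ulip_dot.
  by apply: ulipM => //; apply: ulipB => //; apply: ulipD => //; exact: ulip_dot.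
have disc0 : 0 < outer_disc i (0, 0).
  rewrite /outer_disc /= -/Q.
  have -> : Q ^+ 2 - L * (Q + Q - L) = (L - Q) ^+ 2 by ring.
  by rewrite exprn_even_gt0//= subr_eq0 gt_eqF.
have [r1 [r10 _ disc1]] := small_pos ltr01 (dl 1) disc0.
have kl r : r <= r1 -> ulip W (dbox r) dist1 (fun _ x => kk i x).
  move=> rr; have [[p1 p2] _ _] := V r.
  apply: ulipM => //; apply: ulipB => //; first exact: ulip_dot.
  apply: (@ulip_sqrt _ _ _ _ _ _ d0 _ (outer_disc i (0, 0) / 2)) => //.
    by rewrite divr_gt0.
  by move=> _ x _ xb; apply: disc1; exact: dbox_le rr xb.
have k0 : kk i (0, 0) = 2 * Q / L - 1.
  rewrite /kk /outer_cos /= -/L -/Q.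
  have -> : Q ^+ 2 - L * (Q + Q - L) = (L - Q) ^+ 2 by ring.
  rewrite sqrtr_sqr ger0_norm ?subr_ge0 ?(ltW QL)//.
  by field; exact: lt0r_neq0.
have k01 : 0 < 1 - kk i (0, 0) ^+ 2.
  have q0 : 0 < Q / L by rewrite divr_gt0.
  have q1 : Q / L < 1 by rewrite ltr_pdivrMr// mul1r.
  by rewrite k0 -mulrA; nra.
have [r2 [r20 r21 k2]] := small_pos (f := fun _ x => 1 - kk i x ^+ 2) r10
  (ulipB (cl _ _) (ulipX d0 2 (kl _ (lexx _)))) k01.
have Npos t : 0 < dot (N i t) (pt i t).
  exact (bnormal_bpoint_gt0 a_gt0 b_gt0 P_in (cs1 i t)).
have k0lt : kk i (0, 0) < 1.
  by rewrite k0; have : Q / L < 1 by [rewrite ltr_pdivrMr// mul1r]; rewrite -mulrA; lra.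
pose f3 (_ : unit) x := (1 - kk i x) * dot (N i x.1) (pt i x.1) +
  2 * dot (N i x.1) (pt i x.2 - pt i x.1).
pose f4 (_ : unit) x := (1 - kk i x) * dot (N i x.2) (pt i x.2) +
  2 * dot (N i x.2) (pt i x.1 - pt i x.2).
have z0 (v : R * R) : dot v (pt i 0 - pt i 0) = 0.
  by rewrite subrr /dot /= !mulr0 addr0.
have f3l : ulip W (dbox r1) dist1 f3.
  have [[p1 p2] [n1 n2] _] := V r1.
  apply: ulipD; apply: ulipM => //.
  - by apply: ulipB => //; exact: kl.
  - exact: ulip_dot.
  - by apply: ulip_dot => //; exact: vlipB.
have f4l : ulip W (dbox r1) dist1 f4.
  have [[p1 p2] [n1 n2] _] := V r1.
  apply: ulipD; apply: ulipM => //.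
  - by apply: ulipB => //; exact: kl.
  - exact: ulip_dot.
  - by apply: ulip_dot => //; exact: vlipB.
have f30 : 0 < f3 tt (0, 0) by rewrite /f3 /= z0 mulr0 addr0 mulr_gt0// subr_gt0.
have f40 : 0 < f4 tt (0, 0) by rewrite /f4 /= z0 mulr0 addr0 mulr_gt0// subr_gt0.
have [r3 [r30 r31 h3]] := small_pos r10 f3l f30.
have [r4 [r40 r41 h4]] := small_pos r10 f4l f40.
pose f5 (_ : unit) x := V_outer omega hE P (P + pt i x.2).
have f5l : ulip W (dbox r1) dist1 f5.
  have [[p1 p2] _ _] := V r1.
  apply: (@eq_ulip _ _ _ _ _ _ (fun _ x => hE - omega ^+ 2 / 2 * dot (pt i x.2) (pt i x.2))).
    by move=> h x _ _; rewrite /f5 /V_outer sqr_enorm [P + _]addrC addrK.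
  by apply: ulipB => //; apply: ulipM => //; exact: ulip_dot.
have f50 : 0 < f5 tt (0, 0) by apply: V_outer_gt0; exact: chart_boundary.
have [r5 [r50 r51 h5]] := small_pos r10 f5l f50.
pose r := Num.min r2 (Num.min (Num.min r3 r4) r5).
have r_gt0 : 0 < r by rewrite !lt_min r20 r30 r40.
have rr5 : r <= r5 by rewrite /r !ge_min lexx !orbT.
have rr2 : r <= r2 by rewrite /r ge_min lexx.
have rr3 : r <= r3 by rewrite /r !ge_min lexx !orbT.
have rr4 : r <= r4 by rewrite /r !ge_min lexx !orbT.
have rr1 : r <= r1 by exact: le_trans rr2 r21.
have k2' x : dbox r x -> (1 - kk i (0, 0) ^+ 2) / 2 <= 1 - kk i x ^+ 2.
  by move=> xb; apply: k2; exact: dbox_le rr2 xb.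
have tl : ulip W (dbox r) dist1 (fun _ x => outer_tangent i x).
  have [[p1 p2] _ [_ t2]] := V r; have kr := kl r rr1.
  have sl : ulip W (dbox r) dist1 (fun _ x => Num.sqrt (1 - kk i x ^+ 2)).
    apply: (@ulip_sqrt _ _ _ _ _ _ d0 _ ((1 - kk i (0, 0) ^+ 2) / 2)).
    - by rewrite divr_gt0.
    - by move=> _ x _; exact: k2'.
    - by apply: ulipB => //; exact: ulipX.
  apply: ulipM; first by have [] := ulip_chart_enorm a_gt0 b_gt0 P_in CS1 W (dbox r) i.
  apply: ulip_dot => //; apply: vlipZ; last first.
    by apply: vlipB => //; exact: vlipZ.
  apply: ulipM => //.
  apply: (@ulipV _ _ _ _ _ _ d0 _ (Num.sqrt ((1 - kk i (0, 0) ^+ 2) / 2))) => //.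
    by rewrite sqrtr_gt0 divr_gt0.
  by move=> _ x _ /k2' h; rewrite ler_wsqrtr.
have [K K0 HK] := tl.
pose v := f5 tt (0, 0) / 2; have v0 : 0 < v by rewrite divr_gt0.
have vV : 0 < v^-1 by rewrite invr_gt0.
have Kv : 0 < K + v^-1 by rewrite ltr_wpDl.
exists r => //; exists (K + v^-1) => // x y xb yb; have [l1 l2] := HK tt x y I xb yb.
split; last first.
- by rewrite (le_trans l2)// ler_wpM2r// lerDl ltW.
- by rewrite (le_trans l1)// lerDl ltW.
- apply: le_trans (h5 x (dbox_le rr5 xb)); rewrite -/v -[leRHS]invrK.
  by rewrite lef_pV2 ?posrE// lerDr.
have kx : 0 < 1 - kk i x ^+ 2 by apply: lt_le_trans (k2' x xb); rewrite divr_gt0.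
split.
- have h := disc1 x (dbox_le rr1 xb); apply: le_trans h.
  by rewrite divr_ge0// ltW.
- by nra.
- by apply: lt_le_trans (h3 x (dbox_le rr3 xb)); rewrite divr_gt0.
- by apply: lt_le_trans (h4 x (dbox_le rr4 xb)); rewrite divr_gt0.
Qed.

Lemma outer_chart_data : exists r K : R, [/\ 0 < r, 0 < K &
  forall i x y, dbox r x -> dbox r y -> [/\ outer_ok i x,
    K^-1 <= V_outer omega hE P (P + pt i x.2), `|outer_tangent i x| <= K &
    `|outer_tangent i x - outer_tangent i y| <= K * dist1 x y]].
Proof.
have [r1 r10 [K1 K10 h1]] := outer_pair_data false.
have [r2 r20 [K2 K20 h2]] := outer_pair_data true.
exists (Num.min r1 r2), (K1 + K2); split; rewrite ?addr_gt0 ?lt_min ?r10//.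
have m1 : Num.min r1 r2 <= r1 by rewrite ge_min lexx.
have m2 : Num.min r1 r2 <= r2 by rewrite ge_min lexx orbT.
have d0 := @dist1_ge0 R.
case=> x y xb yb.
  have [q2 v2 b2 l2] := h2 x y (dbox_le m2 xb) (dbox_le m2 yb); split => //.
    by apply: le_trans v2; rewrite lef_pV2 ?posrE ?addr_gt0// lerDr ltW.
    by rewrite (le_trans b2)// lerDr ltW.
  by rewrite (le_trans l2)// ler_wpM2r// lerDr ltW.
have [q2 v2 b2 l2] := h1 x y (dbox_le m1 xb) (dbox_le m1 yb); split => //.
  by apply: le_trans v2; rewrite lef_pV2 ?posrE ?addr_gt0// lerDl ltW.
  by rewrite (le_trans b2)// lerDl ltW.
by rewrite (le_trans l2)// ler_wpM2r// lerDl ltW.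
Qed.

Lemma outer_arrival_facts i t t' (w := outer_arrival omega hE (pt i t) (pt i t')) :
  outer_ok i (t, t') ->
  [/\ outer_arc E P omega hE (P + pt i t) (- outer_arrival omega hE (pt i t') (pt i t))
        (P + pt i t') w,
      dot w w = 2 * V_outer omega hE P (P + pt i t'),
      dot w (N i t') < 0 &
      dot w (tau i t') = outer_tangent i (t, t') / enorm (pt i t')].
Proof.
move=> [disc k1 n1 n2].
have ke : kk i (t, t') = outer_cos omega hE (pt i t) (pt i t') by [].
split.
- exact: (outer_arc_bpoint a_gt0 b_gt0 P_in omega_gt0 hE_gt0 (cs1 i t) (cs1 i t') disc k1 n1 n2).
- exact: (outer_arrival_energy omega_gt0 hE_gt0 disc k1).
- rewrite /w /outer_arrival dotZl -ke.
  have Np : 0 < dot (N i t') (pt i t').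
    exact (bnormal_bpoint_gt0 a_gt0 b_gt0 P_in (cs1 i t')).
  move: k1 n2; rewrite /= => /andP[kN kP] n2.
  have s0 : 0 < omega / Num.sqrt (1 - kk i (t, t') ^+ 2).
    by rewrite divr_gt0// sqrtr_gt0; nra.
  rewrite pmulr_rlt0//.
  have -> : dot (kk i (t, t') *: pt i t' - pt i t) (N i t') =
     - ((1 - kk i (t, t')) * dot (N i t') (pt i t') + dot (N i t') (pt i t - pt i t')).
    by rewrite /dot /= !scaleRE; ring.
  have : 0 < (1 - kk i (t, t')) * dot (N i t') (pt i t') by rewrite mulr_gt0// subr_gt0.
  by rewrite oppr_lt0; lra.
- rewrite /w /outer_tangent /= mulrC mulKf// gt_eqF// enorm_gt0//.
  exact: (chart_neq0 a_gt0 b_gt0 P_in CS1).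
Qed.

End OuterCharts.

(** * Chaos in the refractive billiard *)

Section Refractive.
Context {R : realType}.
Variables (E : ellipse R) (P : R * R) (mu omega hE : R).
Let a := semi_major E.
Let b := semi_minor E.
Hypotheses (a_gt0 : 0 < a) (b_gt0 : 0 < b) (mu_gt0 : 0 < mu)
  (omega_gt0 : 0 < omega) (hE_gt0 : 0 < hE).
Hypothesis P_in : elliptic_domain E P.
Hypothesis V_outer_gt0 : forall z, elliptic_boundary E z -> 0 < V_outer omega hE P z.
Variables (C S : bool -> R).
Hypothesis CS1 : forall i, C i ^+ 2 + S i ^+ 2 = 1.
Hypothesis slope0 : forall i, slope E P (C i) (S i) = 0.
Hypothesis dslope_neq0 : forall i, dslope E P (C i) (S i) != 0.
Hypothesis C_opposite : C false * C true < 0.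
Hypothesis half_dot_pos : forall i j,
  0 < half_dot (bpoint E P (C i) (S i)) (bpoint E P (C j) (S j)).
Implicit Types (s : int -> bool).
Local Notation pt := (chart E P C S).
Local Notation N := (chart_normal E C S).
Local Notation tau := (chart_tangent E C S).
Local Notation slope_at := (chart_slope E P C S).
Local Notation defect := (chart_defect E P C S).
Local Notation otan := (outer_tangent E P omega hE C S).
Local Notation shift s := (bernoulli_shift (A := bool) s).
Local Notation VE := (V_outer omega hE P).

(** Snell's law equates the quantities on the left for the two potentials; so it
    is continuity of the tangential component of the velocity. *)
Lemma sqrt_mul_launch_sin (V : R * R -> R) (p n v : R * R) : 0 < V p ->
  Num.sqrt (V p) * launch_sin V p n v = dot v (perp n) / Num.sqrt 2.
Proof.
move=> V0; rewrite /launch_sin sqrtrM//.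
have s2 : Num.sqrt 2 != 0 :> R by rewrite gt_eqF// sqrtr_gt0.
have sV : Num.sqrt (V p) != 0 by rewrite gt_eqF// sqrtr_gt0.
by field; rewrite s2 sV.
Qed.

(** Now the outer arc from p s to m s stays in the chart s 0, and the inner arc
    from m s goes to p (shift s).  Snell's law at p s and at m s are two equations,
    each of the form slope + eta * defect + kap * outer_tangent = 0, where
    kap = (2 hI) ^ (- 1 / 2), because outer velocities remain bounded while
    the inner ones grow like (2 hI) ^ (1 / 2).  They form a perturbed chain for the
    pair of anomalies of p s (index false) and m s (index true), with a coupling
    that is small for large hI. *)
Lemma refractive_chaos : exists hstar : R, 0 < hstar /\ forall hI, hstar < hI ->
  chaotic E mu (Refractive omega hE) P hI.
Proof.
have [ro [Ko [ro0 Ko0 outer]]] := outer_chart_data a_gt0 b_gt0 omega_gt0 hE_gt0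
  P_in V_outer_gt0 CS1.
have [r [e [K [[r0 r1] e0 K0 geo inner]]]] := inner_chart_data a_gt0 b_gt0 P_in CS1
  dslope_neq0 (C_neq0 C_opposite) half_dot_pos ro0.
have {}outer i x y : dbox r x -> dbox r y -> [/\ outer_ok E P omega hE C S i x,
    Ko^-1 <= V_outer omega hE P (P + pt i x.2), `|otan i x| <= Ko &
    `|otan i x - otan i y| <= Ko * dist1 x y].
  by move=> /(dbox_le r1) xb /(dbox_le r1) yb; exact: outer.
have [l l0 hl] := slope_radius dslope_neq0 r0.
pose e1 := Num.min e (l / (4 * K)).
have e10 : 0 < e1 by rewrite lt_min e0 divr_gt0// mulr_gt0.
(* e1 and c1 make eta K and kap Ko at most l / 4, hence eps at most l. *)
pose c1 := 4 * Ko / l; have c10 : 0 < c1 by rewrite divr_gt0// mulr_gt0.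
have me1 : 0 < mu / e1 by rewrite divr_gt0.
exists (mu / e1 + c1 ^+ 2); split=> [|hI hhI]; first by rewrite addr_gt0// exprn_gt0.
have c12 : 0 < c1 ^+ 2 by rewrite exprn_gt0.
have hI1 : mu / e1 < hI by lra.
have hI2 : c1 ^+ 2 < hI by lra.
have hI0 : 0 < hI by exact: lt_trans hI1.
pose eta := mu / hI.
have eta0 : 0 < eta by rewrite divr_gt0.
have eta1 : eta <= e1.
  by rewrite /eta ler_pdivrMr// mulrC -ler_pdivrMr// ltW.
have eta_e : 0 < eta <= e by rewrite eta0 (le_trans eta1)// ge_min lexx.
have etaK : eta * (4 * K) <= l.
  by rewrite -ler_pdivlMr ?mulr_gt0// (le_trans eta1)// ge_min lexx orbT.
have sh0 : 0 < Num.sqrt (2 * hI) by rewrite sqrtr_gt0 mulr_gt0.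
pose kap := (Num.sqrt (2 * hI))^-1.
have kap0 : 0 < kap by rewrite invr_gt0.
have kapK : kap * (4 * Ko) <= l.
  rewrite [kap * _]mulrC ler_pdivrMr// [l * _]mulrC -ler_pdivrMr// -/c1.
  rewrite -[leLHS]gtr0_norm// -sqrtr_sqr ler_wsqrtr//.
  by rewrite (le_trans (ltW hI2))//; lra.
pose G (s : int -> bool) (Z1 Z2 Z3 : bool -> R) (c : bool) :=
  if c then eta * defect eta (s 1) (s 0) (Z3 false, Z2 true) + kap * otan (s 0) (Z2 false, Z2 true)
  else eta * defect eta (s (- 1)) (s 0) (Z1 true, Z2 false) + kap * otan (s 0) (Z2 true, Z2 false).
pose eps := 2 * (eta * K + kap * Ko).
have eps_l : eps <= l by rewrite /eps; lra.
have etaK0 : 0 < eta * K by exact: mulr_gt0.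
have kapK0 : 0 < kap * Ko by exact: mulr_gt0.
have bound (x y : R) : `|x| <= K -> `|y| <= Ko -> `|eta * x + kap * y| <= eps.
  move=> xK yK; rewrite (le_trans (ler_normD _ _))// (normrM eta) (normrM kap) (gtr0_norm eta0) (gtr0_norm kap0).
  have h1 := ler_wpM2l (ltW eta0) xK; have h2 := ler_wpM2l (ltW kap0) yK.
  by rewrite /eps; lra.
have lip (x y x' y' d : R) : `|x - x'| <= K * (d + d) -> `|y - y'| <= Ko * (d + d) ->
    `|(eta * x + kap * y) - (eta * x' + kap * y')| <= eps * d.
  move=> xK yK.
  have -> : eta * x + kap * y - (eta * x' + kap * y') = eta * (x - x') + kap * (y - y') by ring.
  rewrite (le_trans (ler_normD _ _))// (normrM eta) (normrM kap) (gtr0_norm eta0) (gtr0_norm kap0).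
  have h1 := ler_wpM2l (ltW eta0) xK; have h2 := ler_wpM2l (ltW kap0) yK.
  have -> : eps * d = eta * (K * (d + d)) + kap * (Ko * (d + d)) by rewrite /eps; ring.
  exact: lerD h1 h2.
have [X [Xbox XE Xc]] : exists X : (int -> bool) -> bool -> R,
  [/\ forall s c, `|X s c| <= r,
      forall s c, slope_at (s 0) (X s c) +
        G s (X (unshift s)) (X s) (X (shift s)) c = 0 &
      forall c, cylinder_continuous (fun s => X s c)].
  apply: (@perturbed_chain R r eps slope_at
     (fun i => dslope E P (C i) (S i)) G r0 dslope_neq0 (slope_at0 slope0)).
  - by move=> i x y xr yr; have [_] := geo i x y xr yr.
  - move=> s Z1 Z2 Z3 [] z1 z2 z3; rewrite /G; apply: bound.
    + by have [] := inner (s 1) (s 0) eta _ _ eta_e (dboxI (z3 false) (z2 true))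
        (dboxI (z3 false) (z2 true)).
    + by have [] := outer (s 0) _ _ (dboxI (z2 false) (z2 true)) (dboxI (z2 false) (z2 true)).
    + by have [] := inner (s (-1)) (s 0) eta _ _ eta_e (dboxI (z1 true) (z2 false))
        (dboxI (z1 true) (z2 false)).
    + by have [] := outer (s 0) _ _ (dboxI (z2 true) (z2 false)) (dboxI (z2 true) (z2 false)).
  - move=> s Z1 Z2 Z3 Z1' Z2' Z3' d z1 z2 z3 z1' z2' z3' d1 d2 d3 [];
      rewrite /G; apply: lip.
    + have [_ _ h] := inner (s 1) (s 0) eta _ _ eta_e (dboxI (z3 false) (z2 true))
        (dboxI (z3' false) (z2' true)).
      apply: (le_trans h); apply: ler_wpM2l; first exact: ltW.
      exact: (lerD (d3 false) (d2 true)).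
    + have [_ _ _ h] := outer (s 0) _ _ (dboxI (z2 false) (z2 true)) (dboxI (z2' false) (z2' true)).
      apply: (le_trans h); apply: ler_wpM2l; first exact: ltW.
      exact: (lerD (d2 false) (d2 true)).
    + have [_ _ h] := inner (s (-1)) (s 0) eta _ _ eta_e (dboxI (z1 true) (z2 false))
        (dboxI (z1' true) (z2' false)).
      apply: (le_trans h); apply: ler_wpM2l; first exact: ltW.
      exact: (lerD (d1 true) (d2 false)).
    + have [_ _ _ h] := outer (s 0) _ _ (dboxI (z2 true) (z2 false)) (dboxI (z2' true) (z2' false)).
      apply: (le_trans h); apply: ler_wpM2l; first exact: ltW.
      exact: (lerD (d2 true) (d2 false)).
  - by move=> s s' Z1 Z2 Z3 ss'; rewrite /G !ss'.
  - by move=> i; have [h1 h2] := hl i; split; exact: (le_trans eps_l).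
move=> gamma greg.
have [xi xiP] := boundary_parameter greg.
pose t s := X s false; pose t' s := X s true.
have tr s : `|t s| <= r by exact: Xbox.
have tr' s : `|t' s| <= r by exact: Xbox.
pose p s := pt (s 0) (t s); pose m s := pt (s 0) (t' s).
pose V := V_inner mu hI P.
have V0 z : 0 < V z by exact: V_inner_gt0.
have pb s : elliptic_boundary E (P + p s) by exact: chart_boundary.
have mb s : elliptic_boundary E (P + m s) by exact: chart_boundary.
have arc_mp s s' : [/\ inner_arc E mu hI P (P + m s) (- arrival mu hI (p s') (m s))
        (P + p s') (arrival mu hI (m s) (p s')),
      dot (arrival mu hI (m s) (p s')) (arrival mu hI (m s) (p s')) = 2 * V (P + p s'),
      0 < dot (arrival mu hI (m s) (p s')) (N (s' 0) (t s')) &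
      dot (arrival mu hI (m s) (p s')) (tau (s' 0) (t s')) =
        Num.sqrt (2 * hI) / enorm (p s') *
        (slope_at (s' 0) (t s') + eta * defect eta (s 0) (s' 0) (t' s, t s'))].
  apply: (inner_arrival_facts a_gt0 b_gt0 P_in CS1 mu_gt0 hI0).
  by have [] := inner (s 0) (s' 0) eta _ _ eta_e (dboxI (tr' s) (tr s')) (dboxI (tr' s) (tr s')).
have arc_pm s s' : [/\ inner_arc E mu hI P (P + p s) (- arrival mu hI (m s') (p s))
        (P + m s') (arrival mu hI (p s) (m s')),
      dot (arrival mu hI (p s) (m s')) (arrival mu hI (p s) (m s')) = 2 * V (P + m s'),
      0 < dot (arrival mu hI (p s) (m s')) (N (s' 0) (t' s')) &
      dot (arrival mu hI (p s) (m s')) (tau (s' 0) (t' s')) =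
        Num.sqrt (2 * hI) / enorm (m s') *
        (slope_at (s' 0) (t' s') + eta * defect eta (s 0) (s' 0) (t s, t' s'))].
  apply: (inner_arrival_facts a_gt0 b_gt0 P_in CS1 mu_gt0 hI0).
  by have [] := inner (s 0) (s' 0) eta _ _ eta_e (dboxI (tr s) (tr' s')) (dboxI (tr s) (tr' s')).
have out_pm s : [/\ outer_arc E P omega hE (P + p s) (- outer_arrival omega hE (m s) (p s))
        (P + m s) (outer_arrival omega hE (p s) (m s)),
      dot (outer_arrival omega hE (p s) (m s)) (outer_arrival omega hE (p s) (m s)) =
        2 * VE (P + m s),
      dot (outer_arrival omega hE (p s) (m s)) (N (s 0) (t' s)) < 0 &
      dot (outer_arrival omega hE (p s) (m s)) (tau (s 0) (t' s)) =
        otan (s 0) (t s, t' s) / enorm (m s)].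
  apply: (outer_arrival_facts a_gt0 b_gt0 omega_gt0 hE_gt0 P_in CS1).
  by have [] := outer (s 0) _ _ (dboxI (tr s) (tr' s)) (dboxI (tr s) (tr' s)).
have out_mp s : [/\ outer_arc E P omega hE (P + m s) (- outer_arrival omega hE (p s) (m s))
        (P + p s) (outer_arrival omega hE (m s) (p s)),
      dot (outer_arrival omega hE (m s) (p s)) (outer_arrival omega hE (m s) (p s)) =
        2 * VE (P + p s),
      dot (outer_arrival omega hE (m s) (p s)) (N (s 0) (t s)) < 0 &
      dot (outer_arrival omega hE (m s) (p s)) (tau (s 0) (t s)) =
        otan (s 0) (t' s, t s) / enorm (p s)].
  apply: (outer_arrival_facts a_gt0 b_gt0 omega_gt0 hE_gt0 P_in CS1).
  by have [] := outer (s 0) _ _ (dboxI (tr' s) (tr s)) (dboxI (tr' s) (tr s)).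
(* vE leaves p outwards, wE reaches m from outside, vI leaves m
   inwards, wI reaches p from inside. *)
pose vE s := - outer_arrival omega hE (m s) (p s).
pose wE s := outer_arrival omega hE (p s) (m s).
pose vI s := - arrival mu hI (p (shift s)) (m s).
pose wI s := arrival mu hI (m (unshift s)) (p s).
pose nout s := outward_normal E (P + p s).
pose nin s := inward_normal E (P + m s).
pose sg s := launch_sin VE (P + p s) (nout s) (vE s).
pose sE s := launch_sin VE (P + m s) (nin s) (wE s).
pose sI s := launch_sin V (P + m s) (nin s) (vI s).
pose bI s := launch_sin V (P + p s) (nout s) (wI s).
have VEp s : 0 < VE (P + p s) by exact: V_outer_gt0.
have VEm s : 0 < VE (P + m s) by exact: V_outer_gt0.
have nout1 s : dot (nout s) (nout s) = 1 by exact: chart_outward_unit.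
have nin1 s : dot (nin s) (nin s) = 1 by exact: chart_inward_unit.
have lau_sg s : [/\ -1 < sg s < 1, open_angle (asin (sg s)), sin (asin (sg s)) = sg s &
    launch VE (P + p s) (nout s) (asin (sg s)) = vE s].
  have [_ e2 e3 _] := out_mp s; apply: (launchK (nout1 s) (VEp s)).
    by rewrite /vE dotNl dotNr opprK.
  by rewrite /vE chart_outward_gt0// dotNl oppr_gt0.
have lau_sE s : [/\ -1 < sE s < 1, open_angle (asin (sE s)), sin (asin (sE s)) = sE s &
    launch VE (P + m s) (nin s) (asin (sE s)) = wE s].
  have [_ e2 e3 _] := out_pm s; rewrite /sE -[wE s]opprK.
  apply: (launch_inward a_gt0 b_gt0 P_in CS1 (VEm s)).
    by rewrite dotNl dotNr opprK.
  by rewrite dotNl oppr_gt0.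
have lau_sI s : [/\ -1 < sI s < 1, open_angle (asin (sI s)), sin (asin (sI s)) = sI s &
    launch V (P + m s) (nin s) (asin (sI s)) = vI s].
  have [_ e2 e3 _] := arc_pm (shift s) s.
  exact: (launch_inward a_gt0 b_gt0 P_in CS1 (V0 _) e2 e3).
have lau_bI s : [/\ -1 < bI s < 1, open_angle (asin (bI s)), sin (asin (bI s)) = bI s &
    launch V (P + p s) (nout s) (asin (bI s)) = wI s].
  have [_ e2 e3 _] := arc_mp (unshift s) s; apply: (launchK (nout1 s) (V0 _)) => //.
  by rewrite chart_outward_gt0.
have kapE (x y z : R) : y != 0 -> x + kap * z = 0 -> Num.sqrt (2 * hI) / y * x = - (z / y).
  move=> y0 /eqP; rewrite addr_eq0 => /eqP ->; rewrite /kap.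
  by field; rewrite y0 gt_eqF.
have np0 s : enorm (p s) != 0.
  by rewrite gt_eqF// enorm_gt0// (chart_neq0 a_gt0 b_gt0 P_in CS1).
have nm0 s : enorm (m s) != 0.
  by rewrite gt_eqF// enorm_gt0// (chart_neq0 a_gt0 b_gt0 P_in CS1).
(* Snell's laws at p and at m are the two equations solved by X. *)
have law_p s : dot (wI s) (perp (nout s)) = dot (vE s) (perp (nout s)).
  rewrite /vE dotNl !chart_perp//; have [_ _ _ ->] := arc_mp (unshift s) s.
  have [_ _ _ ->] := out_mp s; rewrite -mulrN; congr (_ * _).
  have := XE s false; rewrite /G -/(t s) -/(t' s) -/(t' (unshift s)).
  by rewrite unshift0 addrA; exact: kapE.
have law_m s : dot (wE s) (perp (nin s)) = dot (vI s) (perp (nin s)).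
  rewrite /vI /nin /inward_normal perpN dotNl !dotNr opprK !chart_perp//.
  have [_ _ _ ->] := arc_pm (shift s) s; have [_ _ _ ->] := out_pm s.
  rewrite -mulrN; congr (_ * _).
  have := XE s true; rewrite /G -/(t s) -/(t' s) -/(t (shift s)).
  by rewrite bernoulli_shift0 addrA => /(kapE _ _ _ (nm0 s)) ->.
have snell_m s : Num.sqrt (V (P + m s)) * sI s = Num.sqrt (VE (P + m s)) * sE s.
  by rewrite !sqrt_mul_launch_sin// law_m.
have snell_p s : Num.sqrt (V (P + p s)) * bI s = Num.sqrt (VE (P + p s)) * sg s.
  by rewrite !sqrt_mul_launch_sin// law_p.
have xi1 s : 0 <= xi (P + p s) < 2 * pi by have [] := xiP _ (pb s).
have xi2 s : gamma (xi (P + p s)) = P + p s by have [] := xiP _ (pb s).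
have ps s : phase_space (xi (P + p s), asin (sg s)).
  by split; [exact: xi1 | have [] := lau_sg s].
have sqV0 z : Num.sqrt (V z) != 0 by rewrite gt_eqF// sqrtr_gt0.
have sqVE s : Num.sqrt (VE (P + p s)) != 0 by rewrite gt_eqF// sqrtr_gt0.
apply: (@bernoulli_of_states _ E gamma _ xi (fun s => P + p s) sg) => //.
- by move=> s; have [] := lau_sg s.
- by have [] := chart_point_continuous E P C S tr (Xc false).
- by have [] := chart_point_continuous E P C S tr (Xc false).
- pose F (s : int -> bool) (x : R * R) := chart_scale E C S (s 0) x.2 *
    - (otan (s 0) x * (enorm (pt (s 0) x.2))^-1) / Num.sqrt (2 * VE (P + pt (s 0) x.2)).
  have -> : sg = fun s => F s (t' s, t s).
    apply/funext => s; rewrite /sg launch_sin_outward// /vE dotNl.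
    by have [_ _ _ ->] := out_mp s.
  apply: (@cylinder_continuous_local _ F r) => //.
  + by move=> s s' ss'; rewrite /F !ss'.
  + move=> s; have d0 := @dist1_ge0 R.
    have k1 (c : R) : ulip (fun _ : unit => True) (dbox r) dist1 (fun _ _ => c).
      exact: ulip_const.
    have ol : ulip (fun _ : unit => True) (dbox r) dist1 (fun _ x => otan (s 0) x).
      exists Ko => [|_ x y _ xb yb]; first exact: ltW.
      by have [] := outer (s 0) x y xb yb.
    have Vl : ulip (fun _ : unit => True) (dbox r) dist1 (fun _ x => VE (P + pt (s 0) x.2)).
      have [[_ p2] _ _] := vlip_chart E P C S (fun _ : unit => True) (dbox r) (s 0).
      apply: (@eq_ulip _ _ _ _ _ _
        (fun _ x => hE - omega ^+ 2 / 2 * dot (pt (s 0) x.2) (pt (s 0) x.2))).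
        by move=> h x _ _; rewrite /V_outer sqr_enorm [P + _]addrC addrK.
      by apply: ulipB => //; apply: ulipM => //; exact: ulip_dot.
    have Vge x : dbox r x -> 2 * Ko^-1 <= 2 * VE (P + pt (s 0) x.2).
      by move=> xb; have [_ h _ _] := outer (s 0) x x xb xb; rewrite ler_wpM2l.
    have K2 : 0 < 2 * Ko^-1 by rewrite mulr_gt0// invr_gt0.
    apply: ulipM.
      apply: ulipM; first exact: ulip_chart_scale.
      by apply: ulipN; apply: ulipM => //; exact: ulip_chart_enormV.
    apply: (@ulipV _ _ _ _ _ _ d0 _ (Num.sqrt (2 * Ko^-1))); first by rewrite sqrtr_gt0.
      by move=> _ x _ /Vge h; rewrite ler_wsqrtr.
    apply: (@ulip_sqrt _ _ _ _ _ _ d0 _ (2 * Ko^-1)) => //.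
      by move=> _ x _ /Vge.
    exact: ulipM.
  + exact: Xc.
  + exact: Xc.
- move=> s; split => //=; rewrite !xi2.
  exists (P + m s), (asin (sE s)), (asin (sI s)), (asin (bI (shift s))).
  have [_ oE snE lE] := lau_sE s; have [_ oI snI lI] := lau_sI s.
  have [_ ob snb lb] := lau_bI (shift s); have [_ og sng lg] := lau_sg s.
  have [_ og' sng' lg'] := lau_sg (shift s).
  split; [by split | by rewrite lg lE; have [] := out_pm s | by rewrite /snell snI snE
    | | by rewrite /snell snb sng'].
  by rewrite lI lb /wI unshift_shift; have [] := arc_mp s (shift s).
- move=> s y [_ [y1 y2] /= [z [aE [aI [b' [[oE oI ob] arcE snm arcI snp]]]]]].
  rewrite xi2 in arcE; have [_ _ _ lg] := lau_sg s; rewrite lg in arcE.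
  have [arcE' _ _ _] := out_pm s.
  have [zE vz] := outer_arc_unique (lt0r_neq0 omega_gt0) arcE arcE'; subst z.
  have [_ oE' snE lE] := lau_sE s; have [_ oI' snI lI] := lau_sI s.
  have aEE : aE = asin (sE s).
    by apply: (launch_inj (nin1 s) (VEm s) oE oE'); rewrite lE vz.
  have aIE : aI = asin (sI s).
    apply: (open_angle_sin_inj oI oI'); apply: (mulfI (sqV0 (P + m s))).
    by rewrite snm aEE snE snI snell_m.
  rewrite aIE lI in arcI.
  have [arcI' _ _ _] := arc_mp s (shift s).
  have [q wq] := inner_arc_unique P_in (mb s) arcI arcI'.
  have y1E : y.1 = xi (P + p (shift s)) by apply: (gamma_inj greg) => //; rewrite xi2.
  rewrite [y]surjective_pairing y1E; congr (_, _).
  rewrite q in wq snp.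
  have [_ ob' snb lb] := lau_bI (shift s); have [_ og' sng' _] := lau_sg (shift s).
  have b'E : b' = asin (bI (shift s)).
    apply: (launch_inj (nout1 (shift s)) (V0 (P + p (shift s))) ob ob').
    by rewrite lb /wI unshift_shift -wq.
  apply: (open_angle_sin_inj y2 og'); apply: (mulfI (sqVE (shift s))).
  by rewrite sng' -snell_p -snb -b'E -snp.
- move=> s s' /addrI; apply: chart_bool_inj => //.
    by have [] := geo (s 0) (t s) (t s) (tr s) (tr s).
  by have [] := geo (s' 0) (t s') (t s') (tr s') (tr s').
- move=> s s' zz ss.
(* Going backwards: Snell's law at p gives the inner velocity, the reversed inner
   arc gives m, Snell's law there gives the outer velocity, and the reversed outer
   arc gives the previous state. *)
  have bb : bI s = bI s'.
    apply: (mulfI (sqV0 (P + p s))); rewrite snell_p ss zz.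
    by rewrite snell_p.
  have ww : wI s = wI s'.
    have [_ _ _ <-] := lau_bI s; have [_ _ _ <-] := lau_bI s'.
    by rewrite bb /nout zz.
  have [arc1 _ _ _] := arc_pm s (unshift s); have [arc2 _ _ _] := arc_pm s' (unshift s').
  rewrite -/(wI s) -/(wI s') ww zz in arc1 arc2.
  have [q wq] := inner_arc_unique P_in (pb s') arc1 arc2.
  have vv : vI (unshift s) = vI (unshift s') by rewrite /vI !shift_unshift wq.
  have EE : sE (unshift s) = sE (unshift s').
    have := snell_m (unshift s); have := snell_m (unshift s').
    have -> : sI (unshift s) = sI (unshift s') by rewrite /sI /nin q vv.
    have sq : Num.sqrt (VE (P + m (unshift s'))) != 0 by rewrite gt_eqF// sqrtr_gt0.
    by rewrite q => -> /(mulfI sq) ->.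
  have we : wE (unshift s) = wE (unshift s').
    have [_ _ _ <-] := lau_sE (unshift s); have [_ _ _ <-] := lau_sE (unshift s').
    by rewrite EE /nin q.
  have [oarc1 _ _ _] := out_mp (unshift s); have [oarc2 _ _ _] := out_mp (unshift s').
  rewrite -/(wE (unshift s)) we q in oarc1; rewrite -/(wE (unshift s')) in oarc2.
  have [q' wq'] := outer_arc_unique (lt0r_neq0 omega_gt0) oarc1 oarc2.
  by split => //; rewrite /sg /nout /vE q' wq'.
Qed.

End Refractive.

(** * Lines are negligible *)

Section NullSets.
Context {R : realType}.

(** A line is either vertical, hence the product of a point and a line, or it has
    one point above every abscissa. *)
Lemma line_null (n : R * R) (c : R) : n != 0 -> lebesgue_null [set z : R * R | dot z n = c].
Proof.
move=> n0; rewrite /lebesgue_null.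
have mL : measurable [set z : R * R | dot z n = c].
  have mf : measurable_fun setT (fun z : R * R => dot z n).
    rewrite /dot; apply: measurable_funD; apply: measurable_funM => //.
  have := mf measurableT _ (measurable_set1 c); rewrite setTI.
  by rewrite (_ : _ @^-1` _ = [set z | dot z n = c]).
have [n2|n2] := eqVneq n.2 0.
  have n1 : n.1 != 0 by apply: contraNneq n0 => n1; apply/eqP/injective_projections.
  have E : [set z : R * R | dot z n = c] = [set c / n.1] `*` setT.
    apply/seteqP; split=> z /=; rewrite /dot n2 mulr0 addr0.
      by move=> <-; split => //; rewrite mulfK.
    by move=> [-> _]; rewrite divfK.
  exists [set z : R * R | dot z n = c]; split => //.
  rewrite E product_measure1E//; apply/eqP; rewrite mule_eq0.
  by apply/orP; left; apply/eqP; exact: lebesgue_measure_set1.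
exists [set z : R * R | dot z n = c]; split => //.
rewrite /product_measure1 /=; apply: integral0_eq => x _ /=.
have -> : xsection [set z : R * R | dot z n = c] x = [set (c - x * n.1) / n.2].
  apply/seteqP; split=> y; rewrite /xsection /= in_setE /= /dot /=.
    by move=> <-; rewrite [x * _ + _]addrC addrK mulfK.
  by move=> ->; rewrite divfK// addrC subrK.
exact: lebesgue_measure_set1.
Qed.

End NullSets.

(** * Chaos for almost every position of the mass *)

Theorem theorem5 (R : realType) (E : ellipse R) (mu : R) (B : billiard R)
    (semi_minor_gt0 : 0 < semi_minor E)
    (different_semi_axes : semi_minor E < semi_major E)
    (mu_gt0 : 0 < mu) (admissible_B : admissible E B) :
  exists Dt : set (R * R),
    [/\ Dt `<=` elliptic_domain E,
        (forall P, Dt P ->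
           exists hstar : R, 0 < hstar /\
             forall hI, hstar < hI -> chaotic E mu B P hI) &
        lebesgue_null (elliptic_domain E `\` Dt) /\
          foci E `<=` elliptic_domain E `\` Dt].
Proof.
have a0 : 0 < semi_major E by exact: lt_trans different_semi_axes.
pose X (P : R * R) := xcoord E (P - centre E).
pose Y (P : R * R) := ycoord E (P - centre E).
exists [set P | [/\ elliptic_domain E P, X P != 0 & Y P != 0]]; split.
- by move=> P [].
- move=> P [P_in X0 Y0].
  have [C [S [CS1 sl0 dsl CC hd]]] := critical_points semi_minor_gt0 different_semi_axes P_in X0 Y0.
  case: B admissible_B => [_|omega hE [w0 h0 Vpos]].
    exact: (reflective_chaos a0 semi_minor_gt0 mu_gt0 P_in CS1 sl0 dsl CC hd).
  apply: (refractive_chaos a0 semi_minor_gt0 mu_gt0 w0 h0 P_in _ CS1 sl0 dsl CC hd) => z.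
  exact: Vpos.
- split.
    have M0 : major_dir E != 0.
      apply/eqP => M0; have := xcoord_frame E 1 0.
      by rewrite /xcoord M0 /dot /= !mulr0 addr0 => /esym/eqP; rewrite oner_eq0.
    have m0 : minor_dir E != 0.
      apply/eqP => m0; have := ycoord_frame E 0 1.
      by rewrite /ycoord m0 /dot /= !mulr0 addr0 => /esym/eqP; rewrite oner_eq0.
    have n1 := line_null (dot (centre E) (major_dir E)) M0.
    have n2 := line_null (dot (centre E) (minor_dir E)) m0.
    apply: negligibleS (negligibleU n1 n2) => z [Dz nDt] /=.
    have dE v : dot (z - centre E) v = 0 -> dot z v = dot (centre E) v.
      by rewrite /dot /= => e; apply/eqP; rewrite -subr_eq0 -e; apply/eqP; ring.
    have [Xz|Xz] := eqVneq (X z) 0; first by left; exact: dE.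
    have [Yz|Yz] := eqVneq (Y z) 0; first by right; exact: dE.
    by case: nDt.
  pose f := Num.sqrt (semi_major E ^+ 2 - semi_minor E ^+ 2).
  have ab2 : semi_minor E ^+ 2 < semi_major E ^+ 2 by rewrite ltrXn2r// ltW.
  have f2 : f ^+ 2 = semi_major E ^+ 2 - semi_minor E ^+ 2.
    by rewrite sqr_sqrtr// subr_ge0 ltW.
  suff H (c : R) : c ^+ 2 = f ^+ 2 ->
      (elliptic_domain E `\` [set P | [/\ elliptic_domain E P, X P != 0 & Y P != 0]])
        (centre E + c *: major_dir E).
    move=> z [->|->]; first exact: H.
    by rewrite -/f -scaleNr; apply: H; rewrite sqrrN.
  move=> cf; have zE : centre E + c *: major_dir E - centre E = frame E c 0.
    by rewrite addrC addKr /frame scale0r addr0.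
  split; last by move=> [_ _]; rewrite /Y zE ycoord_frame eqxx.
  rewrite /elliptic_domain /ellipse_form /= zE.
  rewrite -/(xcoord E _) -/(ycoord E _) xcoord_frame ycoord_frame mul0r expr0n addr0.
  rewrite expr_div_n cf f2 ltr_pdivrMr ?exprn_gt0// mul1r ltrBlDr ltrDl.
  by rewrite exprn_gt0.
Qed.
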